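(* For every $p_0>2$ there exists an admissible weight $\mu_0$ on the unit disc $\mathbb{D}\subset\mathbb{C}$ such that, for $p\in(1,\infty)$, the weighted Bergman projection $\mathbf{B}_{\mu_0}$ is bounded on $L^p(\mathbb{D},\mu_0)$ if and only if $p\in(q_0,p_0)$, where $\frac1{p_0}+\frac1{q_0}=1$.
   Context: A weight on a domain $\Omega\subset\mathbb{C}^n$ is a non-negative measurable function $\mu$ on $\Omega$. For $p\in[1,\infty)$, $L^p(\Omega,\mu)$ is the space of measurable functions $f$ on $\Omega$ with $\|f\|_{p,\mu}^p=\int_\Omega |f|^p\mu\,dA<\infty$, where $dA$ is Lebesgue measure. $L^2_a(\Omega,\mu)$ is the subspace of holomorphic functions in $L^2(\Omega,\mu)$; for all weights considered it is infinite dimensional. The weight $\mu$ is admissible if for every compact $K\subset\Omega$ there is $C_K>0$ with $\sup_{z\in K}|f(z)|\le C_K\|f\|_{2,\mu}$ for all $f\in L^2_a(\Omega,\mu)$; then $L^2_a(\Omega,\mu)$ is closed in $L^2(\Omega,\mu)$. The weighted Bergman projection is the orthogonal projection $\mathbf{B}_{\Omega,\mu}:L^2(\Omega,\mu)\to L^2_a(\Omega,\mu)$; when $\Omega=\mathbb{D}$ it is written $\mathbf{B}_\mu$. It is said to be bounded on $L^p(\Omega,\mu)$ if there is $C>0$ with $\|\mathbf{B}_{\Omega,\mu}f\|_{p,\mu}\le C\|f\|_{p,\mu}$ for all $f\in L^2(\Omega,\mu)\cap L^p(\Omega,\mu)$. *)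

(* Defs.v *)
From mathcomp Require Import all_boot all_order all_algebra.
From mathcomp Require Import all_classical all_reals all_analysis.
From mathcomp Require Import complex.
Import Order.TTheory GRing.Theory Num.Theory.
Import numFieldNormedType.Exports.

Set Implicit Arguments.
Unset Strict Implicit.
Unset Printing Implicit Defensive.

Local Open Scope classical_set_scope.
Local Open Scope ring_scope.
Local Open Scope complex_scope.

(* R[i] carries its usual topology under the alias R[i]^o.  It carries no
   sigma-algebra, so measurability and integration over a subset of R[i] are
   expressed on R * R, with its Borel sigma-algebra, through plane_pt.
   Functions on a domain are total functions on R[i] whose values off the domain are
   irrelevant. *)

Section WeightedBergman.
Variable R : realType.
Local Notation C := R[i].
Implicit Types (Omega : set C) (mu : C -> R) (f g h : C -> C) (p : R).

Definition cmod (z : C) : R := ComplexField.Normc.normc z.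

Local Notation plane := (measurableTypeR R * measurableTypeR R)%type.

Definition plane_pt (w : plane) : C := (w.1 : R) +i* (w.2 : R).

Definition plane_set Omega : set plane := plane_pt @^-1` Omega.

Definition area := (@lebesgue_measure R \x @lebesgue_measure R)%E.

Definition real_measurable Omega (u : C -> R) : Prop :=
  measurable_fun (plane_set Omega) (u \o plane_pt).

Definition complex_measurable Omega f : Prop :=
  real_measurable Omega (fun z => complex.Re (f z)) /\
  real_measurable Omega (fun z => complex.Im (f z)).

Definition weight Omega mu : Prop :=
  (forall z, Omega z -> 0 <= mu z) /\ real_measurable Omega mu.

Definition Lp_norm Omega mu p f : \bar R :=
  ((\int[area]_(w in plane_set Omega)
      (cmod (f (plane_pt w)) `^ p * mu (plane_pt w))%:E) `^ p^-1)%E.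

Definition Lp_space Omega mu p : set (C -> C) :=
  [set f | complex_measurable Omega f /\ (Lp_norm Omega mu p f < +oo)%E].

Definition holomorphic_on Omega f : Prop :=
  forall z, Omega z -> derivable (f : C^o -> C^o) z 1.

Definition bergman_space Omega mu : set (C -> C) :=
  [set f | holomorphic_on Omega f /\ Lp_space Omega mu 2 f].

(* Linear independence is that of the classes in L^2(Omega, mu). *)
Definition bergman_infinite_dim Omega mu : Prop :=
  forall n : nat, exists e : 'I_n -> C -> C,
    (forall i, bergman_space Omega mu (e i)) /\
    (forall c : 'I_n -> C,
       Lp_norm Omega mu 2 (fun z => \sum_(i < n) c i * e i z) = 0%E ->
       forall i, c i = 0).

Definition admissible Omega mu : Prop :=
  forall K : set C^o, compact K -> K `<=` Omega ->
    exists2 CK : R, 0 < CK &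
      forall f, bergman_space Omega mu f ->
        forall z, K z -> ((cmod (f z))%:E <= CK%:E * Lp_norm Omega mu 2 f)%E.

Definition L2_inner Omega mu f g : C :=
  let F := fun w => f (plane_pt w) * conjc (g (plane_pt w)) in
  Rintegral area (plane_set Omega)
    (fun w => complex.Re (F w) * mu (plane_pt w)) +i*
  Rintegral area (plane_set Omega)
    (fun w => complex.Im (F w) * mu (plane_pt w)).

Definition is_bergman_projection Omega mu f g : Prop :=
  bergman_space Omega mu g /\
  forall h, bergman_space Omega mu h ->
    L2_inner Omega mu (fun z => f z - g z) h = 0.

(* For an admissible weight and f in L^2(Omega, mu), a function satisfying
   is_bergman_projection exists, because the Bergman space is closed, and its
   values on Omega are unique, because a holomorphic function of zero norm
   vanishes on Omega; the default value 0 is then never used. *)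
Definition bergman_projection Omega mu f : C -> C :=
  xget (fun=> 0) [set g | is_bergman_projection Omega mu f g].

Definition bergman_bounded Omega mu p : Prop :=
  exists2 M : R, 0 < M &
    forall f, Lp_space Omega mu 2 f -> Lp_space Omega mu p f ->
      (Lp_norm Omega mu p (bergman_projection Omega mu f)
         <= M%:E * Lp_norm Omega mu p f)%E.

Definition unit_disc : set C := [set z | cmod z < 1].

End WeightedBergman.

Arguments unit_disc {R}.

(* Main.v *)
From HB Require Import structures.
Require Import Defs.
From mathcomp Require Import all_boot all_order all_algebra.
From mathcomp Require Import all_classical all_reals all_analysis.
From mathcomp Require Import measurable_realfun complex ring lra.
Import Order.TTheory GRing.Theory Num.Theory.
Import numFieldNormedType.Exports.

Set Implicit Arguments.
Unset Strict Implicit.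
Unset Printing Implicit Defensive.

Local Open Scope classical_set_scope.
Local Open Scope ring_scope.
Local Open Scope complex_scope.

(** The weight is [|w|^(-2-2s)] with [s = q0 / 2] in (1/2, 1). It forces functions of the
    Bergman space to vanish at 0, and its reproducing kernel is, up to a constant,
    [k(z conj(w))] with [k(x) = x / (1 - x)^2 - s x / (1 - x)]. The reproducing formula comes from
    averaging over circles: the average of [k(z conj(v)) h(v)] over [|v|^2 = t] is
    [t^(1+s)] times the derivative of [t^(-s) h(t z)].
    Since [|k(x)| <= |x| / |1 - x|^2], boundedness for [q0 < p < p0] follows from Schur's test
    with the function [|w|^m (1 - |w|^2)^(-1/(pq))], where [q] is conjugate to [p] and
    [m = min(1/p, 1/q)].
    For [f(w) = w phi(|w|^2)] the projection is a multiple of [w]. If [p <= q0], then [w] is not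
    in L^p, whereas [f] is when [phi] is the indicator of [t > 1/2]. If [p >= p0], so that
    [q <= q0], the cut-offs [phi(t) = t^((q-2)/2)] for [t > e], and 0 otherwise, have projections
    whose norms are not controlled as [e] tends to 0. *)

(** * Complex modulus and differentiability *)

Section CMod.
Variable R : realType.
Local Notation C := R[i].
Implicit Types z w : C.

(** In the variable t = |w|^2 area has constant density, so the p-th power of the norm of w is a
    multiple of the integral of t^(p/2 - 1 - s) over (0, 1). It is finite exactly for p > 2 s: this
    fixes s = q0 / 2, and s < 1 keeps w in L^2. The upper endpoint is the dual phenomenon: the
    projection of a radial multiple of w is governed by its inner product with w, which is a bounded
    functional on L^p only when w lies in L^q. The projection is only accessible through a choice
    operator. Reproduction and orthogonality force an integral formula on every function that it can
    select; the upper bound also covers the default value 0, and the lower bounds use explicit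
    projections. Complex analysis enters through a single identity, Cauchy's formula averaged over a
    circle centred at 0. It is proved along the circles zeta + t (w exp(i x) - zeta), which shrink
    to zeta: pulled back to the (t, x)-rectangle, Goursat's argument needs only integrals of
    functions of one real variable. Differentiating the formula explicitly in z yields both the
    derivative of h and its continuity, hence the fundamental theorem of calculus along rays. *)

Lemma cmod_norm z : `|z| = (cmod z)%:C.
Proof. by []. Qed.

Lemma cmod_ge0 z : 0 <= cmod z.
Proof. by case: z => a b; exact: sqrtr_ge0. Qed.

Lemma cmod0 : cmod (0 : C) = 0. Proof. exact: ComplexField.Normc.normc0. Qed.
Lemma cmod1 : cmod (1 : C) = 1. Proof. exact: ComplexField.Normc.normc1. Qed.

Lemma cmod_eq0 z : (cmod z == 0) = (z == 0).
Proof.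
apply/eqP/eqP => [|->]; last exact: cmod0.
exact: ComplexField.Normc.eq0_normc.
Qed.

Lemma cmod_gt0 z : (0 < cmod z) = (z != 0).
Proof. by rewrite lt0r cmod_ge0 cmod_eq0 andbT. Qed.

Lemma cmodM z w : cmod (z * w) = cmod z * cmod w.
Proof. exact: ComplexField.Normc.normcM. Qed.

Lemma cmodV z : cmod z^-1 = (cmod z)^-1.
Proof. exact: ComplexField.Normc.normcV. Qed.

Lemma cmodX z n : cmod (z ^+ n) = cmod z ^+ n.
Proof. by elim: n => [|n IH]; rewrite ?expr0 ?cmod1// !exprS cmodM IH. Qed.

Lemma cmodN z : cmod (- z) = cmod z.
Proof. exact: normcN. Qed.

Lemma cmod_distC z w : cmod (z - w) = cmod (w - z).
Proof. by rewrite -cmodN opprB. Qed.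

Lemma cmodD z w : cmod (z + w) <= cmod z + cmod w.
Proof. exact: le_normcD. Qed.

Lemma cmodB z w : cmod (z - w) <= cmod z + cmod w.
Proof. by rewrite -(cmodN w) cmodD. Qed.

Lemma cmod_distD z w : cmod z - cmod w <= cmod (z - w).
Proof. by rewrite lerBlDr -{1}(subrK w z) cmodD. Qed.

Lemma cmodJ z : cmod (conjc z) = cmod z.
Proof. by case: z => a b; rewrite /cmod /= sqrrN. Qed.

Lemma cmodR (x : R) : cmod x%:C = `|x|.
Proof. by rewrite /cmod /= expr0n/= addr0 sqrtr_sqr. Qed.

Lemma sqr_cmod z : cmod z ^+ 2 = complex.Re z ^+ 2 + complex.Im z ^+ 2.
Proof.
by case: z => a b; rewrite /cmod /= sqr_sqrtr// addr_ge0// sqr_ge0.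
Qed.

Lemma cmod_conjM z : z * (conjc z) = (cmod z ^+ 2)%:C.
Proof.
by rewrite sqr_cmod; case: z => a b; rewrite /=; simpc; congr (_ +i* _); ring.
Qed.

Lemma ler_Re_cmod z : `|complex.Re z| <= cmod z.
Proof.
by rewrite -(ler_pXn2r (n:=2))// ?nnegrE ?cmod_ge0// real_normK ?num_real//
   sqr_cmod lerDl sqr_ge0.
Qed.

Lemma ler_Im_cmod z : `|complex.Im z| <= cmod z.
Proof.
by rewrite -(ler_pXn2r (n:=2))// ?nnegrE ?cmod_ge0// real_normK ?num_real//
   sqr_cmod lerDr sqr_ge0.
Qed.

Lemma ler_cmod_ReIm z : cmod z <= `|complex.Re z| + `|complex.Im z|.
Proof.
rewrite -(ler_pXn2r (n:=2))// ?nnegrE ?cmod_ge0 ?addr_ge0//.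
rewrite sqr_cmod sqrrD !real_normK ?num_real//.
by rewrite -addrA lerD2l lerDr mulrn_wge0// mulr_ge0.
Qed.

Lemma cReD z w : complex.Re (z + w) = complex.Re z + complex.Re w.
Proof. by case: z; case: w. Qed.
Lemma cImD z w : complex.Im (z + w) = complex.Im z + complex.Im w.
Proof. by case: z; case: w. Qed.
Lemma cReN z : complex.Re (- z) = - complex.Re z.
Proof. by case: z. Qed.
Lemma cImN z : complex.Im (- z) = - complex.Im z.
Proof. by case: z. Qed.
Lemma cReM z w : complex.Re (z * w) =
  complex.Re z * complex.Re w - complex.Im z * complex.Im w.
Proof. by case: z; case: w. Qed.
Lemma cImM z w : complex.Im (z * w) =
  complex.Re z * complex.Im w + complex.Im z * complex.Re w.
Proof. by case: z; case: w. Qed.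

Lemma complex_eq z w : complex.Re z = complex.Re w ->
  complex.Im z = complex.Im w -> z = w.
Proof. by case: z => a b; case: w => c d /= -> ->. Qed.

Lemma cmod_small z : (forall e : R, 0 < e -> cmod z <= e) -> z = 0.
Proof.
move=> h; apply/eqP; rewrite -cmod_eq0 eq_le cmod_ge0 andbT.
by apply/ler_addgt0Pr => e e0; rewrite add0r h.
Qed.

End CMod.

Section Derivable.
Variable R : realType.
Local Notation C := R[i].

Lemma gt0_C (e : C) : 0 < e -> exists2 r : R, 0 < r & e = r%:C.
Proof.
case: e => a b; rewrite ltcE /= => /andP[/eqP -> a0].
by exists a.
Qed.

Lemma nbhs_C (z : C^o) (P : set C) :
  (exists2 d : R, 0 < d & forall w, cmod (w - z) < d -> P w) ->
  nbhs z P.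
Proof.
move=> [d d0 H]; apply/nbhs_ballP; exists d%:C => /=; first by rewrite ltcR.
move=> w; rewrite /ball /= => H1; apply: H.
by move: H1; rewrite cmod_norm ltcR cmod_distC.
Qed.

(** The limit becomes a first-order estimate with real radii and no division, valid also at [w = z];
    this is the form that Goursat's argument consumes. *)
Lemma derivable_cmodP (f : C -> C) (z : C) :
  derivable (f : C^o -> C^o) z 1 ->
  exists l : C, forall e : R, 0 < e -> exists2 d : R, 0 < d &
    forall w, cmod (w - z) < d ->
      cmod (f w - f z - l * (w - z)) <= e * cmod (w - z).
Proof.
move=> /cvg_ex[/= l /cvgrPdist_lt H]; exists l => e e0.
have e0C : 0 < (e%:C : C) by rewrite ltcR.
have /= := H _ e0C; rewrite near_withinE => /nbhs_ballP[r /= /gt0_C[d d0 ->] Hd].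
exists d => // w wz; have [->|wz0] := eqVneq w z.
  by rewrite !subrr mulr0 subr0 cmod0 mulr0.
have wz1 : w - z != 0 by rewrite subr_eq0.
have := Hd (w - z); rewrite /ball /= sub0r normrN cmod_norm ltcR => /(_ wz wz1).
rewrite /GRing.scale /= mulr1 subrK cmod_norm ltcR => /ltW H1.
have -> : f w - f z - l * (w - z) =
  - (l - (w - z)^-1 * (f w - f z)) * (w - z).
  by field.
by rewrite cmodM cmodN ler_wpM2r// cmod_ge0.
Qed.

Lemma derivable_cmod_cont (f : C -> C) (z : C) :
  derivable (f : C^o -> C^o) z 1 ->
  forall e : R, 0 < e -> exists2 d : R, 0 < d &
    forall w, cmod (w - z) < d -> cmod (f w - f z) <= e.
Proof.
move=> /derivable_cmodP[l Hl] e e0.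
have [d d0 Hd] := Hl _ (@ltr01 R).
have l0 := cmod_ge0 l.
exists (Num.min d (e / (1 + cmod l))).
  by rewrite lt_min d0 divr_gt0// ltr_wpDr.
move=> w; rewrite lt_min => /andP[wd].
rewrite ltr_pdivlMr ?ltr_wpDr// => /ltW we.
have {}Hd := Hd _ wd.
have -> : f w - f z = (f w - f z - l * (w - z)) + l * (w - z) by ring.
apply: le_trans (cmodD _ _) _; rewrite cmodM.
by lra.
Qed.

End Derivable.

(** * Integrals of complex-valued functions of a real variable *)

Section CCont.
Variable R : realType.
Local Notation C := R[i].
Local Notation Re := (@complex.Re R).
Local Notation Im := (@complex.Im R).

(** Continuity is kept componentwise because integrals are defined through real and imaginary
    parts. *)
Definition ccont (f : R -> C) (x : R) : Prop :=
  {for x, continuous (fun y => Re (f y))} /\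
  {for x, continuous (fun y => Im (f y))}.

Lemma eq_continuous_for (f g : R -> R) x : f =1 g ->
  {for x, continuous f} -> {for x, continuous g}.
Proof. by move=> /funext ->. Qed.

Lemma eq_ccont f g x : f =1 g -> ccont f x -> ccont g x.
Proof. by move=> /funext ->. Qed.

Lemma ccont_cst k x : ccont (fun=> k) x.
Proof. by split; exact: cvg_cst. Qed.

Lemma ccont_real (f : R -> R) x :
  {for x, continuous f} -> ccont (fun y => (f y)%:C) x.
Proof. by move=> cf; split => //=; exact: cvg_cst. Qed.

Lemma ccontN f x : ccont f x -> ccont (fun y => - f y) x.
Proof.
move=> [rf jf]; split.
  by apply: (eq_continuous_for (fun y => esym (cReN (f y)))); exact: cvgN.
by apply: (eq_continuous_for (fun y => esym (cImN (f y)))); exact: cvgN.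
Qed.

Lemma ccontD f g x : ccont f x -> ccont g x -> ccont (fun y => f y + g y) x.
Proof.
move=> [rf jf] [rg jg]; split.
  by apply: (eq_continuous_for (fun y => esym (cReD (f y) (g y)))); exact: cvgD.
by apply: (eq_continuous_for (fun y => esym (cImD (f y) (g y)))); exact: cvgD.
Qed.

Lemma ccontB f g x : ccont f x -> ccont g x -> ccont (fun y => f y - g y) x.
Proof. by move=> cf cg; apply: ccontD => //; exact: ccontN. Qed.

Lemma ccontM f g x : ccont f x -> ccont g x -> ccont (fun y => f y * g y) x.
Proof.
move=> [rf jf] [rg jg]; split.
  apply: (eq_continuous_for (fun y => esym (cReM (f y) (g y)))).
  by apply: cvgB; exact: cvgM.
apply: (eq_continuous_for (fun y => esym (cImM (f y) (g y)))).
by apply: cvgD; exact: cvgM.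
Qed.

Lemma cReJ (z : C) : Re (conjc z) = Re z. Proof. by case: z. Qed.
Lemma cImJ (z : C) : Im (conjc z) = - Im z. Proof. by case: z. Qed.

Lemma ccontJ f x : ccont f x -> ccont (fun y => (conjc (f y))) x.
Proof.
move=> [rf jf]; split.
  by apply: (eq_continuous_for (fun y => esym (cReJ (f y)))).
by apply: (eq_continuous_for (fun y => esym (cImJ (f y)))); exact: cvgN.
Qed.

Lemma invc_conj (z : C) : z^-1 = ((cmod z ^+ 2)^-1)%:C * (conjc z).
Proof. by rewrite invc_norm cmod_norm fmorphV rmorphXn. Qed.

Lemma ccontV f x : f x != 0 -> ccont f x -> ccont (fun y => (f y)^-1) x.
Proof.
move=> fx0 cf.
apply: (eq_ccont (fun y => esym (invc_conj (f y)))).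
apply: ccontM; last exact: ccontJ.
apply: ccont_real; apply: cvgV.
  by rewrite expf_neq0// cmod_eq0.
case: cf => rf jf; apply: (eq_continuous_for (fun y => esym (sqr_cmod (f y)))).
by apply: cvgD; exact: cvgM.
Qed.

Lemma ccont_epsP f x : (forall e : R, 0 < e -> exists2 d : R, 0 < d &
    forall y, `|y - x| < d -> cmod (f y - f x) <= e) -> ccont f x.
Proof.
move=> H; split; apply/cvgrPdist_le => /= e e0; have [d d0 Hd] := H _ e0.
  apply/nbhs_ballP; exists d => //= y; rewrite /ball/= distrC => /Hd h.
  by rewrite distrC -cReN -cReD (le_trans (ler_Re_cmod _)).
apply/nbhs_ballP; exists d => //= y; rewrite /ball/= distrC => /Hd h.
by rewrite distrC -cImN -cImD (le_trans (ler_Im_cmod _)).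
Qed.

Lemma ccont_eps f x : ccont f x -> forall e : R, 0 < e ->
  exists2 d : R, 0 < d & forall y, `|y - x| < d -> cmod (f y - f x) < e.
Proof.
move=> [/cvgrPdist_lt rf /cvgrPdist_lt jf] e e0.
have e20 : 0 < e / 2 by lra.
have /nbhs_ballP[d1 /= d10 h1] := rf _ e20.
have /nbhs_ballP[d2 /= d20 h2] := jf _ e20.
exists (Num.min d1 d2); first by rewrite lt_min d10.
move=> y; rewrite lt_min => /andP[y1 y2].
apply: le_lt_trans (ler_cmod_ReIm _) _.
have := h1 y; rewrite /ball /= distrC => /(_ y1).
have := h2 y; rewrite /ball /= distrC => /(_ y2).
by rewrite cReD cReN cImD cImN [X in X < _ -> _]distrC [X in _ -> X < _ -> _]distrC; lra.
Qed.

Lemma ccont_comp (h : C -> C) (g : R -> C) x :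
  derivable (h : C^o -> C^o) (g x) 1 -> ccont g x -> ccont (h \o g) x.
Proof.
move=> /derivable_cmod_cont dh /ccont_eps cg; apply: ccont_epsP => e e0.
have [d d0 hd] := dh _ e0; have [r r0 hr] := cg _ d0.
by exists r => // y /hr /hd.
Qed.

End CCont.

Section CInt.
Variable R : realType.
Local Notation C := R[i].
Local Notation Re := (@complex.Re R).
Local Notation Im := (@complex.Im R).
Local Notation leb := (@lebesgue_measure R).

Definition cint (a b : R) (f : R -> C) : C :=
  (\int[leb]_(x in `[a, b]) Re (f x)) +i* (\int[leb]_(x in `[a, b]) Im (f x)).

Definition ccont_on (a b : R) (f : R -> C) : Prop :=
  forall x, a <= x <= b -> ccont f x.

Lemma itv_integrable (a b : R) (f : R -> R) :
  (forall x, a <= x <= b -> {for x, continuous f}) ->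
  leb.-integrable `[a, b] (EFin \o f).
Proof.
move=> cf; apply: continuous_compact_integrable; first exact: segment_compact.
apply: continuous_in_subspaceT => x; rewrite inE/= in_itv/=; exact: cf.
Qed.

Lemma ccont_integrable a b f : ccont_on a b f ->
  leb.-integrable `[a, b] (EFin \o (fun x => Re (f x))) /\
  leb.-integrable `[a, b] (EFin \o (fun x => Im (f x))).
Proof. by move=> cf; split; apply: itv_integrable => x /cf[]. Qed.

Lemma eq_cint a b f g : (forall x, a <= x <= b -> f x = g x) ->
  cint a b f = cint a b g.
Proof.
move=> fg; rewrite /cint; congr (_ +i* _); apply: eq_Rintegral => x;
  by rewrite inE /= in_itv/= => /fg ->.
Qed.

Lemma cintD a b f g : ccont_on a b f -> ccont_on a b g ->
  cint a b (fun x => f x + g x) = cint a b f + cint a b g.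
Proof.
move=> /ccont_integrable[rf jf] /ccont_integrable[rg jg].
apply: complex_eq; rewrite /= -RintegralD//; apply: eq_Rintegral => x _.
  exact: cReD.
exact: cImD.
Qed.

Lemma cintZ a b k f : ccont_on a b f ->
  cint a b (fun x => k * f x) = k * cint a b f.
Proof.
move=> /ccont_integrable[rf jf]; case: k => k l.
have I r (g : R -> R) : leb.-integrable `[a, b] (EFin \o g) ->
    leb.-integrable `[a, b] (EFin \o (fun x => r * g x)).
  by move=> ig; apply: (integrableZl _ r ig).
apply: complex_eq; rewrite /=.
  rewrite -!RintegralZl// -RintegralB//; try exact: I.
  by apply: eq_Rintegral => x _; case: (f x).
rewrite -!RintegralZl// -RintegralD//; try exact: I.
by apply: eq_Rintegral => x _; case: (f x).
Qed.

Lemma cintN a b f : ccont_on a b f ->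
  cint a b (fun x => - f x) = - cint a b f.
Proof.
move=> cf; rewrite -mulN1r -cintZ//; apply: eq_cint => x _.
by rewrite mulN1r.
Qed.

Lemma cintB a b f g : ccont_on a b f -> ccont_on a b g ->
  cint a b (fun x => f x - g x) = cint a b f - cint a b g.
Proof.
move=> cf cg; rewrite cintD ?cintN// => x /cg; exact: ccontN.
Qed.

Lemma cint_split a m b f : a <= m -> m <= b -> ccont_on a b f ->
  cint a b f = cint a m f + cint m b f.
Proof.
move=> am mb /ccont_integrable[rf jf].
have H (g : R -> R) : leb.-integrable `[a, b] (EFin \o g) ->
    \int[leb]_(x in `[a, b]) g x =
    \int[leb]_(x in `[a, m]) g x + \int[leb]_(x in `[m, b]) g x.
  move=> ig; have := @Rintegral_itvB _ g (BLeft a) (BRight b) m ig.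
  rewrite !bnd_simp => /(_ am mb) h.
  rewrite -(@Rintegral_itv_obnd_cbnd _ m).
    by rewrite -h addrC subrK.
  apply: integrableS ig => //; apply: subset_itv; rewrite ?bnd_simp//.
by apply: complex_eq => /=; exact: H.
Qed.

Lemma cintJ a b f : ccont_on a b f ->
  cint a b (fun x => (conjc (f x))) = (conjc (cint a b f)).
Proof.
move=> /ccont_integrable[rf jf]; apply: complex_eq => /=.
  by apply: eq_Rintegral => x _; case: (f x).
rewrite -mulN1r -RintegralZl//.
by apply: eq_Rintegral => x _; rewrite mulN1r; case: (f x).
Qed.

(** The components are estimated separately, which costs a factor 2; all later uses tolerate a
    constant. *)
Lemma cint_bound a b f M : a <= b -> ccont_on a b f ->
  (forall x, a <= x <= b -> cmod (f x) <= M) ->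
  cmod (cint a b f) <= 2 * M * (b - a).
Proof.
move=> ab /ccont_integrable[rf jf] fM.
have H (g : R -> R) : leb.-integrable `[a, b] (EFin \o g) ->
    (forall x, a <= x <= b -> `|g x| <= M) ->
    `|\int[leb]_(x in `[a, b]) g x| <= M * (b - a).
  move=> ig gM; apply: le_trans (le_normr_Rintegral _ ig) _ => //.
  apply: (@le_trans _ _ (\int[leb]_(x in `[a, b]) M)).
    apply: le_Rintegral => //.
    - exact: integrable_norm.
    - apply: itv_integrable => x _; exact: cvg_cst.
  rewrite Rintegral_cst//= lebesgue_measure_itv/= lte_fin.
  case: ltP => [_|ba]; first by [].
  by have -> : a = b; [apply/eqP; rewrite eq_le ab ba|rewrite subrr].
apply: le_trans (ler_cmod_ReIm _) _ => /=.
have h1 := H _ rf (fun x hx => le_trans (ler_Re_cmod _) (fM x hx)).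
have h2 := H _ jf (fun x hx => le_trans (ler_Im_cmod _) (fM x hx)).
by rewrite -mulrA mulr_natl mulr2n lerD.
Qed.

Lemma Rintegral_FTC a b (F f : R -> R) : a <= b ->
  (forall x, a <= x <= b -> {for x, continuous f}) ->
  (forall x, a <= x <= b -> is_derive x 1 F (f x)) ->
  \int[leb]_(x in `[a, b]) f x = F b - F a.
Proof.
rewrite le_eqVlt => /predU1P[-> cf dF|ab cf dF].
  by rewrite set_itv1 Rintegral_set1 subrr.
have cF x : a <= x <= b -> {for x, continuous F}.
  move=> /dF [? _]; apply: differentiable_continuous.
  exact/derivable1_diffP.
rewrite /Rintegral (@continuous_FTC2 _ f F a b)//.
- by apply: continuous_in_subspaceT => x; rewrite inE/= in_itv/=; exact: cf.
- split.
  + move=> x; rewrite in_itv /= => /andP[ax xb].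
    by have [] // := dF x; rewrite !ltW.
  + by apply: cvg_at_right_filter; apply: cF; rewrite lexx ltW.
  + by apply: cvg_at_left_filter; apply: cF; rewrite lexx ltW.
- move=> x; rewrite in_itv /= => /andP[ax xb].
  have [|? <-] := dF x; first by rewrite !ltW.
  by rewrite derive1E.
Qed.

Lemma cint_FTC a b F f : a <= b -> ccont_on a b f ->
  (forall x, a <= x <= b -> is_derive x 1 (fun y => Re (F y)) (Re (f x))) ->
  (forall x, a <= x <= b -> is_derive x 1 (fun y => Im (F y)) (Im (f x))) ->
  cint a b f = F b - F a.
Proof.
move=> ab cf dr di; rewrite /cint.
rewrite (Rintegral_FTC (F := fun y => Re (F y)))//; last by move=> x /cf[].
rewrite (Rintegral_FTC (F := fun y => Im (F y)))//; last by move=> x /cf[].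
by apply: complex_eq; rewrite ?cReD ?cReN ?cImD ?cImN.
Qed.

Lemma cint_cst a b k : a <= b -> cint a b (fun=> k) = k * (b - a)%:C.
Proof.
move=> ab.
have -> : cint a b (fun=> k) = k * cint a b (fun=> 1).
  by rewrite -cintZ ?mulr1// => x _; exact: ccont_cst.
congr (_ * _); rewrite rmorphB /=.
apply: (@cint_FTC a b (fun x => x%:C)) => // x _ /=.
  exact: ccont_cst.
exact: is_derive_cst.
Qed.

(** The point exp(i x) of the unit circle. *)
Definition cexp (x : R) : C := cos x +i* sin x.

Lemma ccont_cexp x : ccont cexp x.
Proof. by split => /=; [exact: continuous_cos|exact: continuous_sin]. Qed.

Lemma cmod_cexp x : cmod (cexp x) = 1.
Proof. by rewrite /cmod /= cos2Dsin2 sqrtr1. Qed.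

Lemma cexp_neq0 x : cexp x != 0.
Proof. by rewrite -cmod_eq0 cmod_cexp oner_eq0. Qed.

Lemma cint_cexp a b : a <= b ->
  'i%C * cint a b cexp = cexp b - cexp a.
Proof.
move=> ab; rewrite -cintZ; last by move=> x _; exact: ccont_cexp.
apply: cint_FTC => //.
- move=> x _; apply: ccontM; first exact: ccont_cst.
  exact: ccont_cexp.
- by move=> x _ /=; rewrite mul0r mul1r sub0r; exact: is_derive_cos.
- by move=> x _ /=; rewrite mul0r mul1r add0r; exact: is_derive_sin.
Qed.

Lemma cexp_lip x y : cmod (cexp x - cexp y) <= 2 * `|x - y|.
Proof.
wlog yx : x y / y <= x.
  move=> H; have [/H//|/ltW/H] := leP y x.
  by rewrite cmod_distC distrC.
have <- := cint_cexp yx.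
have i1 : cmod ('i%C : C) = 1.
  by rewrite /cmod /= expr0n/= add0r expr1n sqrtr1.
rewrite cmodM i1 mul1r (ger0_norm (x := x - y)) ?subr_ge0//.
rewrite -[2]mulr1; apply: cint_bound => //.
  by move=> z _; exact: ccont_cexp.
by move=> z _; rewrite cmod_cexp.
Qed.

End CInt.

(** * Cauchy's theorem on circles *)

Section Bisection.
Variable R : realType.

Lemma nested_point (a : nat -> R) (l : nat -> R) :
  (forall n, 0 <= l n) ->
  (forall n, a n <= a n.+1) -> (forall n, a n.+1 + l n.+1 <= a n + l n) ->
  exists x, forall n, a n <= x <= a n + l n.
Proof.
move=> l0 ai bi.
have am n m : a n <= a (n + m)%N.
  by elim: m => [|m IH]; rewrite ?addn0// addnS (le_trans IH).
have bm n m : a (n + m)%N + l (n + m)%N <= a n + l n.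
  by elim: m => [|m IH]; rewrite ?addn0// addnS (le_trans (bi _)).
have ub n : ubound (range a) (a n + l n).
  move=> _ [m _ <-]; have [nm|mn] := leP n m.
    have := bm n (m - n)%N; rewrite subnKC//; have := l0 m; lra.
  have := am m (n - m)%N; rewrite (subnKC (ltnW mn)); have := l0 n; lra.
exists (sup (range a)) => n; apply/andP; split.
  apply: ub_le_sup; last by exists n.
  by exists (a 0%N + l 0%N).
apply: ge_sup => //; by exists (a 0%N), 0%N.
Qed.

(* Goursat's subdivision argument. *)
Lemma bisection (N : R -> R -> R -> R -> R) (a0 c0 L M : R) :
  0 < L -> 0 < M ->
  (forall a c l m, a0 <= a -> c0 <= c -> 0 < l -> 0 < m ->
    a + l <= a0 + L -> c + m <= c0 + M ->
    N a c l m <= N a c (l / 2) (m / 2) + N (a + l / 2) c (l / 2) (m / 2) +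
      N a (c + m / 2) (l / 2) (m / 2) +
      N (a + l / 2) (c + m / 2) (l / 2) (m / 2)) ->
  (forall x y, a0 <= x <= a0 + L -> c0 <= y <= c0 + M -> forall e, 0 < e ->
    exists2 d, 0 < d & forall a c r, 0 < r < d -> a0 <= a -> c0 <= c ->
      a + L * r <= a0 + L -> c + M * r <= c0 + M ->
      a <= x <= a + L * r -> c <= y <= c + M * r ->
      N a c (L * r) (M * r) <= e * r ^+ 2) ->
  N a0 c0 L M <= 0.
Proof.
move=> L0 M0 sub small; rewrite leNgt; apply/negP => N0.
pose r n : R := 2^-1 ^+ n.
have r0 n : 0 < r n by rewrite exprn_gt0// invr_gt0.
have rS n : r n.+1 = r n / 2 by rewrite /r exprS mulrC.
(* One of four quarters carries at least a quarter of [N]. As [r n ^+ 2] is 4^-n, the invariant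
   keeps this share, of the same order as the area of the rectangle. *)
pose P n (s : R * R) := [/\ a0 <= s.1, c0 <= s.2, s.1 + L * r n <= a0 + L,
  s.2 + M * r n <= c0 + M &
  N a0 c0 L M * r n ^+ 2 <= N s.1 s.2 (L * r n) (M * r n)].
have step n s : P n s -> exists s', [/\ P n.+1 s',
    s.1 <= s'.1, s.2 <= s'.2, s'.1 + L * r n.+1 <= s.1 + L * r n &
    s'.2 + M * r n.+1 <= s.2 + M * r n].
  case: s => a c [/= a1 c1 a2 c2 Nn].
  have Lr : 0 < L * r n by rewrite mulr_gt0.
  have Mr : 0 < M * r n by rewrite mulr_gt0.
  have := sub _ _ _ _ a1 c1 Lr Mr a2 c2.
  have El : L * r n / 2 = L * r n.+1 by rewrite rS mulrA.
  have Em : M * r n / 2 = M * r n.+1 by rewrite rS mulrA.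
  have El2 : L * r n = L * r n.+1 *+ 2 by rewrite -El; field.
  have Em2 : M * r n = M * r n.+1 *+ 2 by rewrite -Em; field.
  have Er : r n ^+ 2 = r n.+1 ^+ 2 *+ 4 by rewrite rS; field.
  have Lr' : 0 < L * r n.+1 by rewrite mulr_gt0.
  have Mr' : 0 < M * r n.+1 by rewrite mulr_gt0.
  rewrite El Em => Hs.
  suff [s' [/= s1 s2 H]] : exists s', [/\ s'.1 = a \/ s'.1 = a + L * r n.+1,
      s'.2 = c \/ s'.2 = c + M * r n.+1 & N a0 c0 L M * r n.+1 ^+ 2 <=
        N s'.1 s'.2 (L * r n.+1) (M * r n.+1)].
    case: s' s1 s2 H => a' c' /= s1 s2 H; exists (a', c').
    have [h1 h2] : a <= a' /\ a' + L * r n.+1 <= a + L * r n.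
      case: s1 => ->; first by rewrite lerD2l El2 mulr2n lerDl (ltW Lr').
      by rewrite El2 mulr2n addrA lerDl (ltW Lr').
    have [h3 h4] : c <= c' /\ c' + M * r n.+1 <= c + M * r n.
      case: s2 => ->; first by rewrite lerD2l Em2 mulr2n lerDl (ltW Mr').
      by rewrite Em2 mulr2n addrA lerDl (ltW Mr').
    split=> //; split=> //=; [exact: le_trans h1|exact: le_trans h3|
      exact: le_trans h2 a2|exact: le_trans h4 c2].
  have [h1|h1] := leP (N a0 c0 L M * r n.+1 ^+ 2) (N a c (L * r n.+1) (M * r n.+1)).
    by exists (a, c); split => //; left.
  have [h2|h2] := leP (N a0 c0 L M * r n.+1 ^+ 2)
      (N (a + L * r n.+1) c (L * r n.+1) (M * r n.+1)).
    by exists (a + L * r n.+1, c); split => //; [right|left].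
  have [h3|h3] := leP (N a0 c0 L M * r n.+1 ^+ 2)
      (N a (c + M * r n.+1) (L * r n.+1) (M * r n.+1)).
    by exists (a, c + M * r n.+1); split => //; [left|right].
  exists (a + L * r n.+1, c + M * r n.+1); split => /=; [by right|by right|].
  move: Nn; rewrite Er mulrnAr => Nn.
  lra.
have P0 : P 0%N (a0, c0).
  by rewrite /P /= /r expr0 !mulr1 expr1n mulr1.
(* [step] yields a successor only under [P]; elsewhere [f] is the identity, a case that the sequence
   never meets. *)
pose f n (s : R * R) : R * R :=
  if pselect (P n s) is left h then projT1 (cid (step n s h)) else s.
have fP n s : P n s -> [/\ P n.+1 (f n s), s.1 <= (f n s).1, s.2 <= (f n s).2,
    (f n s).1 + L * r n.+1 <= s.1 + L * r n &
    (f n s).2 + M * r n.+1 <= s.2 + M * r n].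
  by move=> hs; rewrite /f; case: pselect => // h; case: cid.
pose s := fix s n := if n is m.+1 then f m (s m) else (a0, c0).
have sP' n : P n (s n) by elim: n => [//|n /fP[]].
have sP n : P n (s n) /\ [/\ (s n).1 <= (s n.+1).1, (s n).2 <= (s n.+1).2,
    (s n.+1).1 + L * r n.+1 <= (s n).1 + L * r n &
    (s n.+1).2 + M * r n.+1 <= (s n).2 + M * r n].
  by split => //; have [] := fP _ _ (sP' n).
have [x Hx] := @nested_point (fun n => (s n).1) (fun n => L * r n)
  (fun n => ltW (mulr_gt0 L0 (r0 n)))
  (fun n => let: conj _ (And4 h _ _ _) := sP n in h)
  (fun n => let: conj _ (And4 _ _ h _) := sP n in h).
have [y Hy] := @nested_point (fun n => (s n).2) (fun n => M * r n)
  (fun n => ltW (mulr_gt0 M0 (r0 n)))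
  (fun n => let: conj _ (And4 _ h _ _) := sP n in h)
  (fun n => let: conj _ (And4 _ _ _ h) := sP n in h).
(* Near the common point smallness with half the original value gives
   [N <= (N a0 c0 L M / 2) * r n ^+ 2], against the invariant. *)
have N20 : 0 < N a0 c0 L M / 2 by lra.
have := Hx 0%N; have := Hy 0%N; rewrite /= /r expr0 !mulr1 => Hy0 Hx0.
have [d d0 Hd] := small _ _ Hx0 Hy0 _ N20.
have [n rn] : exists n, r n < d.
  have /cvgrPdist_lt/(_ _ d0)[n _ Hn] : (r n) @[n --> \oo] --> (0 : R).
    by apply: cvg_expr; rewrite ger0_norm; lra.
  by exists n; have := Hn n (leqnn n); rewrite /= sub0r normrN gtr0_norm.
have [[p1 p2 p3 p4 p5] _] := sP n.
have rnd : 0 < r n < d by rewrite r0.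
have := Hd _ _ _ rnd p1 p2 p3 p4 (Hx n) (Hy n).
have : 0 < N a0 c0 L M * r n ^+ 2 by rewrite mulr_gt0// exprn_gt0.
move=> h1 h2; have := le_trans p5 h2; lra.
Qed.

End Bisection.

(* [ring] is very slow on terms that contain integrals. *)
Ltac generalize_cint := repeat match goal with
  | |- context [cint ?a ?b ?f] => move: (cint a b f) => ?
  end.

Section Cauchy.
Variable R : realType.
Local Notation C := R[i].
Variables (h : C -> C) (zeta w : C).
Hypothesis hol : holomorphic_on unit_disc h.
Hypotheses (zw : cmod zeta < cmod w) (w1 : cmod w < 1).

(* [g] contracts the circle of radius [cmod w] to [zeta]. For [G = h o g], [bnd G a c l m] is the
   integral of [h(v) dv / (v - zeta)], pulled back by [g], over the boundary of the rectangle
   with sides [a, a + l] and [c, c + m]: there [dv / (v - zeta) = i q(x) dx + dt / t]. *)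
Let e x : C := w * cexp x - zeta.
Let q x : C := w * cexp x / e x.
Let g (t x : R) : C := zeta + t%:C * e x.

Let wz2 : cmod w + cmod zeta <= 2.
Proof. by rewrite ltW// -[2]/(1 + 1) ltrD// (lt_trans zw). Qed.

Let bnd (G : R -> R -> C) (a c l m : R) : C :=
  'i%C * (cint c (c + m) (fun x => G (a + l) x * q x) -
          cint c (c + m) (fun x => G a x * q x)) -
  (cint a (a + l) (fun t => G t (c + m) / t%:C) -
   cint a (a + l) (fun t => G t c / t%:C)).

Let reg (G : R -> R -> C) (a c l m : R) :=
  (forall t, a <= t <= a + l -> ccont_on c (c + m) (G t)) /\
  (forall x, c <= x <= c + m -> ccont_on a (a + l) (G ^~ x)).

Let e_lb x : cmod w - cmod zeta <= cmod (e x).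
Proof. by have := cmod_distD (w * cexp x) zeta; rewrite cmodM cmod_cexp mulr1. Qed.

Let e_neq0 x : e x != 0.
Proof. by rewrite -cmod_gt0; apply: lt_le_trans (e_lb x); rewrite subr_gt0. Qed.

Let ce x : ccont e x.
Proof.
apply: ccontB; last exact: ccont_cst.
by apply: ccontM; [exact: ccont_cst|exact: ccont_cexp].
Qed.

Let cq x : ccont q x.
Proof.
apply: ccontM; last by apply: ccontV; [exact: e_neq0|exact: ce].
by apply: ccontM; [exact: ccont_cst|exact: ccont_cexp].
Qed.

Let Q := cmod w / (cmod w - cmod zeta).

Let q_le x : cmod (q x) <= Q.
Proof.
rewrite /q cmodM cmodV cmodM cmod_cexp mulr1 ler_wpM2l ?cmod_ge0//.
rewrite lef_pV2 ?posrE ?e_lb// ?subr_gt0// cmod_gt0; exact: e_neq0.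
Qed.

Let Q_gt0 : 0 < Q.
Proof. by rewrite divr_gt0 ?subr_gt0//; apply: le_lt_trans zw; exact: cmod_ge0. Qed.

Let ccont_invt t : 0 < t -> ccont (fun s : R => (s%:C)^-1) t.
Proof.
move=> t0; apply: ccontV; last exact: ccont_real.
by rewrite -cmod_eq0 cmodR normr_eq0 gt_eqF.
Qed.

Let bndD G G' a c l m : 0 < a -> 0 < l -> 0 < m ->
  reg G a c l m -> reg G' a c l m ->
  bnd (fun t x => G t x + G' t x) a c l m = bnd G a c l m + bnd G' a c l m.
Proof.
move=> a0 l0 m0 [G1 G2] [G1' G2']; rewrite /bnd.
have [al cm] : a <= a + l /\ c <= c + m by split; lra.
have I1 t : a <= t <= a + l ->
    cint c (c + m) (fun x => (G t x + G' t x) * q x) =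
    cint c (c + m) (fun x => G t x * q x) + cint c (c + m) (fun x => G' t x * q x).
  move=> ht; rewrite -cintD; first by apply: eq_cint => x _; rewrite mulrDl.
    by move=> x hx; apply: ccontM; [exact: G1|exact: cq].
  by move=> x hx; apply: ccontM; [exact: G1'|exact: cq].
have I2 x : c <= x <= c + m ->
    cint a (a + l) (fun t => (G t x + G' t x) / t%:C) =
    cint a (a + l) (fun t => G t x / t%:C) + cint a (a + l) (fun t => G' t x / t%:C).
  move=> hx; rewrite -cintD; first by apply: eq_cint => t _; rewrite mulrDl.
    by move=> t ht; apply: ccontM; [exact: G2|apply: ccont_invt; lra].
  by move=> t ht; apply: ccontM; [exact: G2'|apply: ccont_invt; lra].
rewrite !I1 ?I2 ?lexx ?al ?cm//; ring.
Qed.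

(** In these coordinates dv / (v - zeta) splits into a part in x alone and a part in t alone, so the
    contributions of [k0] on opposite edges cancel. The term with [k1] is the integral of the exact
    form k1 dv; [cint_cexp] evaluates it. *)
Let bnd_affine k0 k1 a c l m : 0 < a -> 0 < l -> 0 < m ->
  bnd (fun t x => k0 + k1 * (t%:C * e x)) a c l m = 0.
Proof.
move=> a0 l0 m0; rewrite /bnd.
have [al cm] : a <= a + l /\ c <= c + m by split; lra.
have I1 t : cint c (c + m) (fun x => (k0 + k1 * (t%:C * e x)) * q x) =
    k0 * cint c (c + m) q + k1 * t%:C * w * cint c (c + m) (@cexp R).
  rewrite -!cintZ; last 2 first.
    by move=> x _; exact: ccont_cexp.
    by move=> x _; exact: cq.
  rewrite -cintD.
  - apply: eq_cint => x _; rewrite mulrDl; congr (_ + _).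
    by rewrite /q; have := e_neq0 x; set y := e x => y0; field.
  - by move=> x _; apply: ccontM; [exact: ccont_cst|exact: cq].
  - by move=> x _; apply: ccontM; [exact: ccont_cst|exact: ccont_cexp].
have I2 x : cint a (a + l) (fun t => (k0 + k1 * (t%:C * e x)) / t%:C) =
    k0 * cint a (a + l) (fun t => (t%:C)^-1) + k1 * e x * l%:C.
  have -> : l%:C = cint a (a + l) (fun=> 1 : C).
    by rewrite cint_cst// mul1r; congr (_%:C); ring.
  rewrite -!cintZ; last 2 first.
    by move=> t _; exact: ccont_cst.
    by move=> t ht; apply: ccont_invt; lra.
  rewrite -cintD.
  - apply: eq_cint => t ht; rewrite mulrDl; congr (_ + _).
    have t0 : t%:C != 0 :> C by rewrite -cmod_eq0 cmodR normr_eq0 gt_eqF//; lra.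
    by move: t0; set y := t%:C => y0; field.
  - move=> t ht; apply: ccontM; [exact: ccont_cst|apply: ccont_invt; lra].
  - by move=> t _; exact: ccont_cst.
rewrite !I1 !I2.
have := cint_cexp cm; rewrite /e rmorphD /= => E.
transitivity (k1 * l%:C * w * ('i%C * cint c (c + m) (@cexp R) -
  (cexp (c + m) - cexp c))); first by ring.
by rewrite E subrr mulr0.
Qed.

(** Length estimate over the four edges; [1 / a] bounds the singular factor 1 / t. *)
Let bnd_le G a c l m eta : 0 < a -> 0 < l -> 0 < m -> reg G a c l m ->
  (forall t x, a <= t <= a + l -> c <= x <= c + m -> cmod (G t x) <= eta) ->
  cmod (bnd G a c l m) <= 4 * eta * (Q * m + l / a).
Proof.
move=> a0 l0 m0 [G1 G2] Ge; rewrite /bnd.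
have [al cm] : a <= a + l /\ c <= c + m by split; lra.
have i1 : cmod ('i%C : C) = 1.
  by rewrite /cmod /= expr0n/= add0r expr1n sqrtr1.
have I1 t : a <= t <= a + l ->
    cmod (cint c (c + m) (fun x => G t x * q x)) <= 2 * (eta * Q) * m.
  move=> ht; rewrite [X in _ <= _ * X](_ : m = c + m - c); last by ring.
  apply: (cint_bound cm).
    by move=> x hx; apply: ccontM; [exact: G1|exact: cq].
  move=> x hx; rewrite cmodM; apply: ler_pM; rewrite ?cmod_ge0 ?q_le//.
  exact: Ge.
have I2 x : c <= x <= c + m ->
    cmod (cint a (a + l) (fun t => G t x / t%:C)) <= 2 * (eta / a) * l.
  move=> hx; rewrite [X in _ <= _ * X](_ : l = a + l - a); last by ring.
  apply: (cint_bound al).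
    by move=> t ht; apply: ccontM; [exact: G2|apply: ccont_invt; lra].
  move=> t ht; rewrite cmodM; apply: ler_pM; rewrite ?cmod_ge0//.
    exact: Ge.
  rewrite cmodV cmodR gtr0_norm; last by lra.
  by rewrite lef_pV2 ?posrE; lra.
have ha : a <= a <= a + l by rewrite lexx.
have hal : a <= a + l <= a + l by rewrite lexx al.
have hc : c <= c <= c + m by rewrite lexx.
have hcm : c <= c + m <= c + m by rewrite lexx cm.
apply: le_trans (cmodB _ _) _; rewrite cmodM i1 mul1r.
apply: le_trans (lerD (cmodB _ _) (cmodB _ _)) _.
apply: le_trans (lerD (lerD (I1 _ hal) (I1 _ ha)) (lerD (I2 _ hcm) (I2 _ hc))) _.
by rewrite le_eqVlt; apply/orP; left; apply/eqP; field; rewrite gt_eqF.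
Qed.

Let g_disc t x : 0 <= t <= 1 -> cmod (g t x) <= cmod w.
Proof.
move=> /andP[t0 t1].
have -> : g t x = (1 - t)%:C * zeta + t%:C * (w * cexp x).
  by rewrite /g /e rmorphB rmorph1; ring.
apply: le_trans (cmodD _ _) _; rewrite !cmodM !cmodR cmod_cexp mulr1.
rewrite (ger0_norm t0) ger0_norm ?subr_ge0//.
have : (1 - t) * cmod zeta <= (1 - t) * cmod w.
  by rewrite ler_wpM2l ?subr_ge0// ltW.
lra.
Qed.

Let g_in t x : 0 <= t <= 1 -> unit_disc (g t x).
Proof. by move=> ht; rewrite /unit_disc /=; apply: le_lt_trans w1; exact: g_disc. Qed.

Let cg1 t x : ccont (g t) x.
Proof.
by apply: ccontD; [exact: ccont_cst|apply: ccontM; [exact: ccont_cst|exact: ce]].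
Qed.

Let cg2 t x : ccont (g ^~ x) t.
Proof.
apply: ccontD; first exact: ccont_cst.
by apply: ccontM; [exact: ccont_real|exact: ccont_cst].
Qed.

Let H t x : C := h (g t x).

Let cH1 t x : 0 <= t <= 1 -> ccont (H t) x.
Proof. by move=> ht; apply: ccont_comp; [apply: hol; exact: g_in|exact: cg1]. Qed.

Let cH2 t x : 0 <= t <= 1 -> ccont (H ^~ x) t.
Proof.
move=> ht; apply: (@ccont_comp _ h (g ^~ x)); last exact: cg2.
apply: hol; exact: g_in.
Qed.

Let bnd_split a c l m : 0 < a -> 0 < l -> 0 < m -> a + l <= 1 ->
  bnd H a c l m = bnd H a c (l / 2) (m / 2) + bnd H (a + l / 2) c (l / 2) (m / 2) +
      bnd H a (c + m / 2) (l / 2) (m / 2) +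
      bnd H (a + l / 2) (c + m / 2) (l / 2) (m / 2).
Proof.
move=> a0 l0 m0 al; rewrite /bnd.
have -> : a + l / 2 + l / 2 = a + l by field.
have -> : c + m / 2 + m / 2 = c + m by field.
have S1 t : 0 <= t <= 1 -> cint c (c + m) (fun x => H t x * q x) =
    cint c (c + m / 2) (fun x => H t x * q x) +
    cint (c + m / 2) (c + m) (fun x => H t x * q x).
  move=> ht; apply: cint_split; [lra|lra|].
  by move=> x _; apply: ccontM; [exact: cH1|exact: cq].
have S2 x : cint a (a + l) (fun t => H t x / t%:C) =
    cint a (a + l / 2) (fun t => H t x / t%:C) +
    cint (a + l / 2) (a + l) (fun t => H t x / t%:C).
  apply: cint_split; [lra|lra|].
  by move=> t ht; apply: ccontM; [apply: cH2; lra|apply: ccont_invt; lra].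
rewrite !S1 ?S2; [|lra|lra].
by generalize_cint; move: ('i%C : C) => i; ring.
Qed.

(** Goursat: subtracting the affine approximation of [h] at the limit point does not change the
    boundary integral, by [bnd_affine], and the remainder is o(r) on edges of length O(r). Starting
    at [t1 > 0] keeps 1 / t bounded. *)
Let bnd_H0 (t1 : R) : 0 < t1 < 1 -> bnd H t1 (- pi) (1 - t1) (pi *+ 2) = 0.
Proof.
move=> /andP[t10 t11].
have p0 := @pi_gt0 R.
set L := 1 - t1; set M := pi *+ 2.
have L0 : 0 < L by rewrite subr_gt0.
have M0 : 0 < M by rewrite pmulrn_lgt0.
apply/eqP; rewrite -cmod_eq0 eq_le cmod_ge0 andbT.
apply: (@bisection _ (fun a c l m => cmod (bnd H a c l m))) => //.
  move=> a c l m ha hc l0 m0 al cm; rewrite bnd_split//; [|lra|rewrite /L in al; lra].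
  by do 3 (apply: le_trans (cmodD _ _) _; rewrite ?lerD2r).
move=> x y hx hy eps eps0.
have x01 : 0 <= x <= 1 by rewrite /L in hx; lra.
have [k Hk] := derivable_cmodP (hol (g_in y x01)).
(* [K * r] bounds the displacement of [g] on a rectangle of scale [r]: [2 * L] comes from
   [|e| <= 2], [2 * M] from [cexp_lip]. *)
pose K := 2 * L + 2 * M.
have K0 : 0 < K by rewrite /K; lra.
(* The constant that [bnd_le] produces at scale [r]: a remainder of relative size [eps / P] has
   boundary integral at most [eps * r ^+ 2]. *)
pose P := 4 * K * (Q * M + L / t1).
have P0 : 0 < P.
  by rewrite /P !mulr_gt0// addr_gt0// ?divr_gt0// mulr_gt0.
have e0 : 0 < eps / P by rewrite divr_gt0.
have [d d0 Hd] := Hk _ e0.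
exists (d / K); first by rewrite divr_gt0.
move=> a c r /andP[r0 rd] ha hc al cm xr yr.
have a0 : 0 < a by lra.
have Lr : 0 < L * r by rewrite mulr_gt0.
have Mr : 0 < M * r by rewrite mulr_gt0.
pose E t u := H t u - h (g x y) - k * (g t u - g x y).
have HE : H = fun t u => E t u +
    ((h (g x y) + k * (zeta - g x y)) + k * (t%:C * e u)).
  apply/funext => t; apply/funext => u; rewrite /E /H.
  have <- : g t u - zeta = t%:C * e u by rewrite /g addrC addKr.
  move: (h (g t u)) (h (g x y)) (g x y) (g t u) => ? ? ? ?; ring.
have t01 t : a <= t <= a + L * r -> 0 <= t <= 1 by rewrite /L in al *; lra.
have regE : reg E a c (L * r) (M * r).
  split=> [t ht u _|u _ t ht].
    apply: ccontB; first by apply: ccontB; [apply: cH1; exact: t01|exact: ccont_cst].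
    apply: ccontM; first exact: ccont_cst.
    by apply: ccontB; [exact: cg1|exact: ccont_cst].
  apply: ccontB; first by apply: ccontB; [apply: cH2; exact: t01|exact: ccont_cst].
  apply: ccontM; first exact: ccont_cst.
  by apply: ccontB; [exact: cg2|exact: ccont_cst].
rewrite HE (bndD a0 Lr Mr regE); last first.
  split=> [t ht u _|u _ t ht].
    apply: ccontD; first exact: ccont_cst.
    by do 2 (apply: ccontM; first exact: ccont_cst); exact: ce.
  apply: ccontD; first exact: ccont_cst.
  apply: ccontM; first exact: ccont_cst.
  by apply: ccontM; [exact: ccont_real|exact: ccont_cst].
rewrite bnd_affine// addr0.
have gK t u : a <= t <= a + L * r -> c <= u <= c + M * r ->
    cmod (g t u - g x y) <= K * r.
  move=> ht hu.
  have -> : g t u - g x y = (t - x)%:C * e u + x%:C * w * (cexp u - cexp y).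
    by rewrite /g /e rmorphB; ring.
  apply: le_trans (cmodD _ _) _; rewrite !cmodM !cmodR.
  rewrite /K mulrDl; apply: lerD.
    rewrite mulrAC mulrC -mulrA; apply: ler_pM; rewrite ?cmod_ge0//.
      have := cmodB (w * cexp u) zeta; rewrite cmodM cmod_cexp mulr1 -/(e u).
      by move=> h1; exact: le_trans h1 wz2.
    rewrite mulrC ler_norml; lra.
  apply: (@le_trans _ _ (1 * (2 * (M * r)))); last by rewrite mul1r mulrA.
  apply: ler_pM; rewrite ?cmod_ge0 ?mulr_ge0 ?cmod_ge0//.
    rewrite ger0_norm; last by lra.
    rewrite -[leRHS]mulr1; apply: ler_pM; rewrite ?cmod_ge0//; first by lra.
      by lra.
    exact: ltW.
  apply: le_trans (cexp_lip _ _) _; rewrite ler_wpM2l// ler_norml; lra.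
apply: le_trans (@bnd_le E a c (L * r) (M * r) (eps / P * (K * r)) a0 Lr Mr regE _) _.
  move=> t u ht hu; have hg := gK _ _ ht hu.
  apply: le_trans (Hd _ _) _; last first.
    by rewrite ler_wpM2l// ltW.
  by apply: le_lt_trans hg _; rewrite mulrC -ltr_pdivlMr.
have -> : eps * r ^+ 2 = 4 * (eps / P * (K * r)) * ((Q * M + L / t1) * r).
  have PE : P = 4 * K * (Q * M + L / t1) by [].
  rewrite -{1}[eps](@divfK _ P) ?gt_eqF//.
  by move: (eps / P) => u; rewrite PE; ring.
rewrite ler_wpM2l//.
  by rewrite mulr_ge0// mulr_ge0 ?(ltW e0)// mulr_ge0// ltW.
rewrite [leRHS]mulrDl [Q * (M * r)]mulrA lerD2l.
rewrite -[L * r / a]mulrA -[L / t1 * r]mulrA ler_wpM2l ?(ltW L0)//.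
rewrite [t1^-1 * r]mulrC ler_wpM2l ?(ltW r0)//.
by rewrite lef_pV2 ?posrE.
Qed.

(** The edges x = -pi and x = pi cancel by periodicity, so [bnd_H0] makes the integral over the
    circle of parameter t independent of t. As t tends to 0, that circle shrinks to [zeta]. The
    integral of [q] is evaluated later: it is immediate for [zeta = 0], and [cauchy_avg] obtains the
    general case from that one. *)
Lemma circle_cauchy : cint (- pi) pi (fun x => h (w * cexp x) * q x) =
  h zeta * cint (- pi) pi q.
Proof.
have p0 := @pi_gt0 R.
have pp : - pi <= pi :> R by lra.
have p2 : - pi + pi *+ 2 = pi :> R by rewrite mulr2n; ring.
have eper : e pi = e (- pi) by rewrite /e /cexp cosN sinN sinpi oppr0.
have H1 x : H 1 x = h (w * cexp x).
  by rewrite /H /g /e rmorph1 mul1r addrC subrK.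
have step t1 : 0 < t1 < 1 -> cint (- pi) pi (fun x => h (w * cexp x) * q x) =
    cint (- pi) pi (fun x => H t1 x * q x).
  move=> ht; have := bnd_H0 ht; rewrite /bnd p2.
  have -> : t1 + (1 - t1) = 1 by ring.
  rewrite (_ : cint t1 1 (fun t => H t pi / t%:C) =
    cint t1 1 (fun t => H t (- pi) / t%:C)); last first.
    by apply: eq_cint => t _; rewrite /H /g eper.
  rewrite subrr subr0 => /eqP; rewrite mulf_eq0 => /orP[/eqP[] /eqP|].
    by rewrite oner_eq0.
  rewrite subr_eq0 => /eqP <-; apply: eq_cint => x _.
  by rewrite H1.
apply/eqP; rewrite -subr_eq0; apply/eqP/cmod_small => eps eps0.
have zin : unit_disc zeta by exact: lt_trans zw w1.
pose K : R := 2 * Q * (pi *+ 2).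
have pi2 : 0 < pi *+ 2 :> R by rewrite pmulrn_lgt0.
have K0 : 0 < K by rewrite /K; apply: mulr_gt0 => //; apply: mulr_gt0.
have eK : 0 < eps / K by rewrite divr_gt0.
have [d d0 Hd] := derivable_cmod_cont (hol zin) eK.
(* Since [|e x| <= 2], the circle of parameter [t1] stays within [d / 2] of [zeta]. *)
pose t1 := Num.min (2^-1) (d / 4).
have t10 : 0 < t1 by rewrite lt_min; apply/andP; split; lra.
have t12 : t1 <= 2^-1 by rewrite ge_min lexx.
have t1d : t1 <= d / 4 by rewrite ge_min lexx orbT.
have t1h : 0 < t1 < 1 by lra.
have t1h' : 0 <= t1 <= 1 by lra.
rewrite (step _ t1h) -cintZ; last by move=> x _; exact: cq.
have cHq : ccont_on (- pi) pi (fun x => H t1 x * q x).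
  by move=> x _; apply: ccontM; [exact: cH1|exact: cq].
have czq : ccont_on (- pi) pi (fun x => h zeta * q x).
  by move=> x _; apply: ccontM; [exact: ccont_cst|exact: cq].
rewrite -cintB//.
apply: (@le_trans _ _ (2 * (eps / K * Q) * (pi - - pi))); last first.
  rewrite opprK -mulr2n (_ : _ * _ = eps / K * K).
    by rewrite divfK// gt_eqF.
  by rewrite [in RHS]/K; move: (eps / K) => x; ring.
apply: (cint_bound pp).
  by move=> x hx; apply: ccontB; [exact: cHq|exact: czq].
move=> x _; rewrite -mulrBl cmodM; apply: ler_pM; rewrite ?cmod_ge0//.
apply: Hd; rewrite /g addrC addKr cmodM cmodR gtr0_norm//.
have := cmodB (w * cexp x) zeta; rewrite cmodM cmod_cexp mulr1 -/(e x) => h1.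
have h2 : cmod (e x) <= 2 by exact: le_trans h1 wz2.
apply: (@le_lt_trans _ _ (d / 4 * 2)); last by lra.
by apply: ler_pM; rewrite ?cmod_ge0// ltW.
Qed.

End Cauchy.

(** * Averages over circles *)

Section CircleAverage.
Variable R : realType.
Local Notation C := R[i].
Implicit Types (h : C -> C) (z w : C).

Definition cavg (f : R -> C) : C := ((pi *+ 2)^-1)%:C * cint (- pi) pi f.

Lemma pi_range : - pi <= pi :> R.
Proof. by have := @pi_gt0 R; lra. Qed.

Lemma pi2_gt0 : 0 < pi *+ 2 :> R.
Proof. by rewrite pmulrn_lgt0// pi_gt0. Qed.

Definition cctn (f : R -> C) := forall x, ccont f x.

Lemma cavgB f g : cctn f -> cctn g ->
  cavg (fun x => f x - g x) = cavg f - cavg g.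
Proof. by move=> cf cg; rewrite /cavg cintB ?mulrBr// => x _. Qed.

Lemma cavgZ k f : cctn f -> cavg (fun x => k * f x) = k * cavg f.
Proof. by move=> cf; rewrite /cavg cintZ 1?mulrCA// => x _. Qed.

Lemma eq_cavg f g : f =1 g -> cavg f = cavg g.
Proof. by move=> /funext ->. Qed.

Lemma cavg_cst k : cavg (fun=> k) = k.
Proof.
rewrite /cavg cint_cst ?pi_range// opprK -mulr2n mulrCA -rmorphM.
by rewrite mulVf ?rmorph1 ?mulr1// gt_eqF ?pi2_gt0.
Qed.

Lemma cavgJ f : cctn f -> cavg (fun x => (conjc (f x))) = (conjc (cavg f)).
Proof.
by move=> cf; rewrite /cavg cintJ => [|x _//]; rewrite rmorphM /= oppr0.
Qed.

Lemma cavg_bound f M : cctn f -> (forall x, - pi <= x <= pi -> cmod (f x) <= M) ->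
  cmod (cavg f) <= 2 * M.
Proof.
move=> cf fM; rewrite /cavg cmodM cmodR (ger0_norm (x := _^-1)) ?invr_ge0 ?(ltW pi2_gt0)//.
rewrite ler_pdivrMl ?pi2_gt0//.
have := cint_bound pi_range (fun x _ => cf x) fM.
by rewrite opprK -mulr2n mulrC.
Qed.

Lemma ccont_circle h w x : holomorphic_on unit_disc h -> cmod w < 1 ->
  ccont (fun t => h (w * cexp t)) x.
Proof.
move=> hh w1; apply: (@ccont_comp _ h (fun t => w * cexp t)).
  by apply: hh; rewrite /unit_disc /= cmodM cmod_cexp mulr1.
by apply: ccontM; [exact: ccont_cst|exact: ccont_cexp].
Qed.

Lemma mean_value h w : holomorphic_on unit_disc h -> cmod w < 1 ->
  cavg (fun x => h (w * cexp x)) = h 0.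
Proof.
move=> hh w1; have [->|w0] := eqVneq w 0.
  by rewrite -[RHS]cavg_cst; apply: eq_cavg => x; rewrite mul0r.
have w0' : cmod (0 : C) < cmod w by rewrite cmod0 cmod_gt0.
have := circle_cauchy hh w0' w1.
have E x : w * cexp x / (w * cexp x - 0) = 1.
  by rewrite subr0 divff// mulf_neq0// cexp_neq0.
rewrite /cavg (eq_cint (g := fun x => h (w * cexp x))); last first.
  by move=> x _; rewrite E mulr1.
move=> ->; rewrite (eq_cint (f := fun x => _ / _) (g := fun=> 1)); last first.
  by move=> x _; exact: E.
rewrite mulrCA; set y := (X in _ * X); suff -> : y = 1 by rewrite mulr1.
exact: (cavg_cst 1).
Qed.

Lemma one_sub_neq0 z : cmod z < 1 -> 1 - z != 0.
Proof. by rewrite subr_eq0; apply: contraTneq => <-; rewrite cmod1 ltxx. Qed.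

Lemma cmod_one_sub z : 1 - cmod z <= cmod (1 - z).
Proof. by have := cmod_distD 1 z; rewrite cmod1. Qed.

Lemma derivable_one_sub_inv k z : 1 - k * z != 0 ->
  derivable ((fun x => (1 - k * x)^-1) : C^o -> C^o) z 1.
Proof.
move=> kz.
have -> : (fun x => (1 - k * x)^-1 : C^o) = (fun x => (1 - k * x : C^o)^-1) by [].
exact: derivableV.
Qed.

Lemma holomorphic_one_sub_inv k : cmod k <= 1 ->
  holomorphic_on unit_disc (fun x : C => (1 - k * x)^-1).
Proof.
move=> k1 z z1; apply: derivable_one_sub_inv; apply: one_sub_neq0.
rewrite cmodM; apply: le_lt_trans z1.
by rewrite -[leRHS]mul1r ler_wpM2r// cmod_ge0.
Qed.

Lemma cmod_cexpM w x : cmod (w * cexp x) = cmod w.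
Proof. by rewrite cmodM cmod_cexp mulr1. Qed.

Lemma ccont_kernel z w x : cmod z * cmod w < 1 ->
  ccont (fun t => (1 - z * (conjc (w * cexp t)))^-1) x.
Proof.
move=> zw; apply: ccontV.
  by apply: one_sub_neq0; rewrite cmodM cmodJ cmod_cexpM.
apply: ccontB; first exact: ccont_cst.
apply: ccontM; first exact: ccont_cst.
by apply: ccontJ; apply: ccontM; [exact: ccont_cst|exact: ccont_cexp].
Qed.

(** This is Cauchy's formula at zeta = z |w|^2. On the circle |v| = |w| one has |w|^2 = v conj(v),
    so v / (v - zeta) equals 1 / (1 - z conj(v)). *)
Lemma cauchy_avg h z w : holomorphic_on unit_disc h -> cmod w < 1 ->
  cmod z * cmod w < 1 ->
  cavg (fun x => h (w * cexp x) / (1 - z * (conjc (w * cexp x)))) =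
  h (z * (cmod w ^+ 2)%:C).
Proof.
move=> hh w1 zw1; have [->|w0] := eqVneq w 0.
  rewrite cmod0 expr2 mul0r mulr0 -[RHS]cavg_cst; apply: eq_cavg => x.
  by rewrite mul0r rmorph0 mulr0 subr0 divr1.
have cw0 : 0 < cmod w by rewrite cmod_gt0.
set zeta := z * _.
have zw : cmod zeta < cmod w.
  rewrite /zeta cmodM cmodR ger0_norm ?sqr_ge0// expr2 mulrA.
  by rewrite -[ltRHS]mul1r ltr_pM2r.
have E x : w * cexp x / (w * cexp x - zeta) = (1 - z * (conjc (w * cexp x)))^-1.
  rewrite /zeta -(cmod_cexpM w x) -cmod_conjM.
  set v := w * cexp x.
  have v0 : v != 0 by rewrite mulf_neq0// cexp_neq0.
  have -> : v - z * (v * (conjc v)) = v * (1 - z * (conjc v)) by ring.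
  by rewrite invfM mulrA divff// mul1r.
(* The conjugate of this kernel is a holomorphic function of v, namely 1 / (1 - conj(z) v), so its
   average is its value at 0. *)
have avg1 : cavg (fun x => (1 - z * (conjc (w * cexp x)))^-1) = 1.
  pose w' := (conjc z) * w.
  have w'1 : cmod w' < 1 by rewrite cmodM cmodJ.
  have h1 : holomorphic_on unit_disc (fun x : C => (1 - 1 * x)^-1).
    by apply: holomorphic_one_sub_inv; rewrite cmod1.
  have := mean_value h1 w'1; rewrite mulr0 subr0 invr1 => /(congr1 (@conjc R)).
  rewrite conjc1 -cavgJ; last first.
    by move=> x; exact: (ccont_circle x h1 w'1).
  move=> E1; rewrite -[RHS]E1; apply: eq_cavg => x.
  by rewrite mul1r /w' conjc_inv rmorphB rmorph1 -mulrA !rmorphM /= conjcK.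
have := circle_cauchy hh zw w1.
rewrite (eq_cint (g := fun x => h (w * cexp x) / (1 - z * (conjc (w * cexp x))))); last first.
  by move=> x _; rewrite E.
rewrite (eq_cint (f := fun x => w * cexp x / (w * cexp x - zeta)) (g := fun x => (1 - z * (conjc (w * cexp x)))^-1)); last first.
  by move=> x _; rewrite E.
by rewrite {1}/cavg => ->; rewrite mulrCA -/(cavg _) avg1 mulr1.
Qed.

Lemma ccont_kernel2 z w x : cmod z * cmod w < 1 ->
  ccont (fun t => (conjc (w * cexp t)) / (1 - z * (conjc (w * cexp t))) ^+ 2) x.
Proof.
move=> zw; apply: ccontM.
  by apply: ccontJ; apply: ccontM; [exact: ccont_cst|exact: ccont_cexp].
have := ccontM (ccont_kernel x zw) (ccont_kernel x zw).
by apply: eq_ccont => y; rewrite expr2 invfM.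
Qed.

(* The derivative in [z] of the average in [cauchy_avg]. *)
Definition cdavg h z w :=
  cavg (fun x => h (w * cexp x) *
    ((conjc (w * cexp x)) / (1 - z * (conjc (w * cexp x))) ^+ 2)).

Lemma circle_bounded h w : holomorphic_on unit_disc h -> cmod w < 1 ->
  exists2 M, 0 < M & forall x, - pi <= x <= pi -> cmod (h (w * cexp x)) <= M.
Proof.
move=> hh w1.
have cc x : {for x, continuous (fun t => `|complex.Re (h (w * cexp t))| +
    `|complex.Im (h (w * cexp t))|)}.
  have [c1 c2] := ccont_circle x hh w1.
  by apply: cvgD; apply: cvg_norm.
have [c _ Hc] := EVT_max pi_range (continuous_subspaceT cc).
exists (1 + (`|complex.Re (h (w * cexp c))| + `|complex.Im (h (w * cexp c))|)).
  by rewrite ltr_pwDl// addr_ge0.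
move=> x hx; apply: le_trans (ler_cmod_ReIm _) _.
by have := Hc x; rewrite in_itv/= => /(_ hx); lra.
Qed.

Lemma cavg_le h w M f K : holomorphic_on unit_disc h -> cmod w < 1 ->
  (forall x, - pi <= x <= pi -> cmod (h (w * cexp x)) <= M) ->
  cctn f -> (forall x, cmod (f x) <= K) ->
  cmod (cavg (fun x => h (w * cexp x) * f x)) <= 2 * (M * K).
Proof.
move=> hh w1 hM cf fK; apply: cavg_bound => [x|x hx].
  by apply: ccontM; [exact: ccont_circle|exact: cf].
by rewrite cmodM; apply: ler_pM; rewrite ?cmod_ge0// hM.
Qed.

Definition is_hderiv h z (l : C) := forall e : R, 0 < e ->
  exists2 d : R, 0 < d & forall w, cmod (w - z) < d ->
    cmod (h w - h z - l * (w - z)) <= e * cmod (w - z).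

(** The default 0 appears only where [h] has no complex derivative; elsewhere [is_hderiv_unique]
    makes the choice canonical. *)
Definition hderiv h z : C := xget 0 [set l | is_hderiv h z l].

Lemma hderivP h z : derivable (h : C^o -> C^o) z 1 -> is_hderiv h z (hderiv h z).
Proof.
move=> /derivable_cmodP[l Hl]; rewrite /hderiv.
exact: (xgetPex 0 (P := [set l | is_hderiv h z l]) (ex_intro _ l Hl)).
Qed.

Lemma is_hderiv_unique h z l l' : is_hderiv h z l -> is_hderiv h z l' -> l = l'.
Proof.
move=> H H'; apply/eqP; rewrite -subr_eq0; apply/eqP/cmod_small => e e0.
have e20 : 0 < e / 2 by lra.
have [d d0 Hd] := H _ e20; have [d' d'0 Hd'] := H' _ e20.
pose r := Num.min d d' / 2.
have r0 : 0 < r by rewrite divr_gt0// lt_min d0.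
have rd : r < d /\ r < d'.
  have m1 : Num.min d d' <= d by rewrite ge_min lexx.
  have m2 : Num.min d d' <= d' by rewrite ge_min lexx orbT.
  by rewrite /r; split; rewrite ltr_pdivrMr//; lra.
have rC : cmod (z + r%:C - z) = r by rewrite addrC addKr cmodR gtr0_norm.
have h1 := Hd (z + r%:C); have h2 := Hd' (z + r%:C).
rewrite rC in h1 h2; have {}h1 := h1 rd.1; have {}h2 := h2 rd.2.
rewrite -(ler_pM2r r0) -{1}rC -cmodM.
set u := z + r%:C in h1 h2 *.
have -> : (l - l') * (u - z) =
  (h u - h z - l' * (u - z)) - (h u - h z - l * (u - z)).
  by move: (h u) (h z) => a b; ring.
by apply: le_trans (cmodB _ _) _; lra.
Qed.

(** Both sides are the z-derivative of [cauchy_avg]. Differentiation under the average is done by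
    hand, with an exact remainder for the kernel, and the two derivatives are identified by
    uniqueness. *)
Lemma cdavg_deriv h z w : holomorphic_on unit_disc h -> cmod w < 1 ->
  cmod z * cmod w < 1 ->
  cdavg h z w = (cmod w ^+ 2)%:C * hderiv h (z * (cmod w ^+ 2)%:C).
Proof.
move=> hh w1 zw.
have [->|w0] := eqVneq w 0.
  rewrite cmod0 expr0n/= mul0r -[RHS]cavg_cst; apply: eq_cavg => x.
  by rewrite mul0r rmorph0 mul0r mulr0.
have cw0 : 0 < cmod w by rewrite cmod_gt0.
set t := cmod w ^+ 2.
have t0 : 0 < t by rewrite exprn_gt0.
have tC0 : t%:C != 0 :> C by rewrite -cmod_eq0 cmodR normr_eq0 gt_eqF.
rewrite -[LHS](mulfVK tC0) mulrC; congr (_ * _).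
have zt : unit_disc (z * t%:C).
  rewrite /unit_disc /= cmodM cmodR gtr0_norm// /t expr2 mulrA.
  rewrite -[ltRHS]mul1r; apply: ltr_pM => //; rewrite ?cmod_ge0//.
  by rewrite mulr_ge0 ?cmod_ge0.
apply: is_hderiv_unique; last by apply: hderivP; exact: hh.
move=> e e0.
have [M M0 HM] := circle_bounded hh w1.
pose dl := 1 - cmod z * cmod w.
have dl0 : 0 < dl by rewrite subr_gt0.
pose K := (4 * (M / (dl ^+ 2 * dl))).
have K0 : 0 < K by rewrite mulr_gt0// divr_gt0// mulr_gt0// exprn_gt0.
(* With [u = z' * t] and [k = z' - z], the first bound keeps [1 - |z'| |w|] above [dl / 2], and the
   second makes the remainder [K * |k|^2] at most [e * |u - z * t|]. *)
exists (Num.min (t * (dl / 2)) (e * t * t / K)).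
  by rewrite lt_min mulr_gt0 ?divr_gt0//= ?mulr_gt0.
move=> u; rewrite lt_min => /andP[u1 u2].
pose z' := u / t%:C.
have uz' : u = z' * t%:C by rewrite /z' mulfVK.
pose k := z' - z.
have uk : u - z * t%:C = k * t%:C by rewrite uz' /k mulrBl.
have cuk : cmod (u - z * t%:C) = t * cmod k.
  by rewrite uk cmodM cmodR gtr0_norm// mulrC.
move: u1 u2; rewrite cuk; rewrite ltr_pM2l// => k1.
rewrite ltr_pdivlMr// => k2'.
have k2 : K * cmod k <= e * t.
  by rewrite -(ler_pM2r t0) (_ : K * cmod k * t = t * cmod k * K) ?ltW//; ring.
have z'w : cmod z' * cmod w <= 1 - dl / 2.
  have -> : z' = z + k by rewrite /k; ring.
  have := cmodD z k => h1.
  have h2 : cmod (z + k) * cmod w <= (cmod z + cmod k) * cmod w.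
    by rewrite ler_wpM2r// cmod_ge0.
  have h3 : cmod k * cmod w <= cmod k * 1 by rewrite ler_wpM2l ?cmod_ge0// ltW.
  by rewrite /dl in k1 *; lra.
have z'w1 : cmod z' * cmod w < 1 by apply: le_lt_trans z'w _; lra.
have lb y x : cmod y * cmod w <= 1 - x -> 0 < x -> forall s,
    cmod (1 - y * (conjc (w * cexp s)))^-1 <= x^-1.
  move=> hy x0 s; rewrite cmodV lef_pV2 ?posrE//.
    apply: le_trans (cmod_one_sub _); rewrite cmodM cmodJ cmod_cexpM; lra.
  apply: lt_le_trans (cmod_one_sub _); rewrite cmodM cmodJ cmod_cexpM; lra.
have lbz := lb z dl; have {}lbz := lbz (ltac:(rewrite /dl; lra)) dl0.
have lbz' := lb z' (dl / 2) z'w; have {}lbz' := lbz' (ltac:(lra)).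
rewrite {1}uz' -(cauchy_avg hh w1 z'w1) -(cauchy_avg hh w1 zw).
have -> : cdavg h z w / t%:C * (u - z * t%:C) = k * cdavg h z w.
  by rewrite uk; move: (cdavg h z w) => x; field.
have c0 : cctn (fun x => h (w * cexp x)) by move=> x; exact: ccont_circle.
have c1 : cctn (fun x => h (w * cexp x) / (1 - z' * (conjc (w * cexp x)))).
  by move=> x; apply: ccontM; [exact: c0|exact: ccont_kernel].
have c2 : cctn (fun x => h (w * cexp x) / (1 - z * (conjc (w * cexp x)))).
  by move=> x; apply: ccontM; [exact: c0|exact: ccont_kernel].
have c3 : cctn (fun x => h (w * cexp x) *
    ((conjc (w * cexp x)) / (1 - z * (conjc (w * cexp x))) ^+ 2)).
  by move=> x; apply: ccontM; [exact: c0|exact: ccont_kernel2].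
rewrite /cdavg -(cavgB c1 c2) -(cavgZ k c3) -cavgB; last 2 first.
  by move=> x; apply: ccontB; [exact: c1|exact: c2].
  by move=> x; apply: ccontM; [exact: ccont_cst|exact: c3].
(* With c = conj(v), this is 1/(1 - z' c) - 1/(1 - z c) - k c/(1 - z c)^2 in closed form, visibly
   quadratic in [k]. *)
pose ker x := (1 - z * (conjc (w * cexp x)))^-1 ^+ 2 * (1 - z' * (conjc (w * cexp x)))^-1 *
  ((conjc (w * cexp x)) ^+ 2 * k ^+ 2).
rewrite (@eq_cavg _ (fun x => h (w * cexp x) * ker x)); last first.
  move=> x; rewrite /ker.
  have n1 : 1 - z * (conjc (w * cexp x)) != 0.
    by apply: one_sub_neq0; rewrite cmodM cmodJ cmod_cexpM.
  have n2 : 1 - z' * (conjc (w * cexp x)) != 0.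
    by apply: one_sub_neq0; rewrite cmodM cmodJ cmod_cexpM.
  rewrite /k; move: (h _) ((conjc (w * cexp x))) n1 n2 => a b n1 n2; field.
  by rewrite n1 n2.
have kerle x : cmod (ker x) <= dl^-1 ^+ 2 * (dl / 2)^-1 * (1 * cmod k ^+ 2).
  rewrite /ker (cmodM (_ / _)) (cmodM (_ ^+ 2) (_^-1)) (cmodM (_ ^+ 2) (k ^+ 2)) !cmodX; apply: ler_pM; rewrite ?mulr_ge0 ?exprn_ge0 ?cmod_ge0//.
    apply: ler_pM; rewrite ?exprn_ge0 ?cmod_ge0//.
    by apply: lerXn2r; rewrite ?nnegrE ?cmod_ge0 ?invr_ge0 ?(ltW dl0).
  rewrite ler_wpM2r ?exprn_ge0 ?cmod_ge0// cmodJ cmod_cexpM.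
  by rewrite exprn_ile1 ?cmod_ge0// ltW.
have cker : cctn ker.
  move=> x; rewrite /ker; apply: ccontM; last first.
    apply: ccontM; last exact: ccont_cst.
    by apply: ccontM; apply: ccontJ; apply: ccontM;
      [exact: ccont_cst|exact: ccont_cexp|exact: ccont_cst|exact: ccont_cexp].
  apply: ccontM; last exact: ccont_kernel.
  by apply: ccontM; exact: ccont_kernel.
apply: le_trans (cavg_le hh w1 HM cker kerle) _.
have -> : 2 * (M * (dl^-1 ^+ 2 * (dl / 2)^-1 * (1 * cmod k ^+ 2))) =
    (K * cmod k) * cmod k.
  by rewrite /K; field; rewrite gt_eqF.
rewrite mulrA ler_wpM2r ?cmod_ge0//.
Qed.

(** The derivative is represented by [cdavg] on a fixed circle of radius [r] between [|z|] and 1,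
    where its kernel is Lipschitz in the point. Continuity is what integrating the derivative along
    a ray requires. *)
Lemma hderiv_cont h z : holomorphic_on unit_disc h -> cmod z < 1 ->
  forall e, 0 < e -> exists2 d : R, 0 < d &
    forall u, cmod (u - z) < d -> cmod (hderiv h u - hderiv h z) <= e.
Proof.
move=> hh z1 e e0.
pose r := (1 + cmod z) / 2.
have z0 := cmod_ge0 z.
have [r0 r1 zr] : [/\ 0 < r, r < 1 & cmod z < r] by rewrite /r; split; lra.
pose w : C := r%:C.
have cw : cmod w = r by rewrite /w cmodR gtr0_norm.
have w1 : cmod w < 1 by rewrite cw.
have [M M0 HM] := circle_bounded hh w1.
pose t := r ^+ 2.
have t0 : 0 < t by rewrite exprn_gt0.
have tC0 : t%:C != 0 :> C by rewrite -cmod_eq0 cmodR normr_eq0 gt_eqF.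
have D u : cmod u < r -> hderiv h u = (t%:C)^-1 * cdavg h (u / t%:C) w.
  move=> ur; rewrite cdavg_deriv// ?cw ?mulfVK// ?mulKf//.
  rewrite cmodM cmodV cmodR gtr0_norm// /t.
  have -> : cmod u / r ^+ 2 * r = cmod u / r by field; rewrite gt_eqF.
  by rewrite ltr_pdivrMr// mul1r.
pose dl := (r - cmod z) / 2.
have dl0 : 0 < dl by rewrite /dl; lra.
pose K := 2 * (M * (2 * (dl / r)^-1 * (dl / r)^-1 ^+ 2 / t)) / t.
have dlr : 0 < dl / r by rewrite divr_gt0.
have K0 : 0 < K.
  have x0 : 0 < (dl / r)^-1 by rewrite invr_gt0.
  by rewrite /K divr_gt0// mulr_gt0// mulr_gt0// divr_gt0// mulr_gt0// ?exprn_gt0// mulr_gt0.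
exists (Num.min dl (e / K)); first by rewrite lt_min dl0 divr_gt0.
move=> u; rewrite lt_min => /andP[u1]; rewrite ltr_pdivlMr// => u2.
have ur : cmod u <= r - dl.
  have := cmodD z (u - z); rewrite addrC subrK => h1.
  by rewrite /dl in u1 *; lra.
have lb y : cmod y <= r - dl -> forall s,
    cmod (1 - y / t%:C * (conjc (w * cexp s)))^-1 <= (dl / r)^-1.
  move=> hy s.
  have E : cmod (y / t%:C * (conjc (w * cexp s))) <= 1 - dl / r.
    rewrite !cmodM cmodJ cmod_cexpM cmodV cmodR gtr0_norm// cw /t.
    have -> : 1 - dl / r = (r - dl) / r ^+ 2 * r by field; rewrite gt_eqF.
    by rewrite ler_pM2r// ler_pM2r// invr_gt0 exprn_gt0.
  rewrite cmodV lef_pV2 ?posrE//; have := cmod_one_sub (y / t%:C * (conjc (w * cexp s))); lra.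
have zd : cmod z <= r - dl by rewrite /dl; lra.
have kle y : cmod y <= r - dl -> cmod (y / t%:C) * cmod w < 1.
  move=> hy; rewrite cmodM cmodV cmodR gtr0_norm// cw /t.
  have -> : cmod y / r ^+ 2 * r = cmod y / r by field; rewrite gt_eqF.
  by rewrite ltr_pdivrMr//; lra.
rewrite !D//; [|lra..].
rewrite -mulrBr /cdavg -cavgB; last 2 first.
  by move=> x; apply: ccontM; [exact: ccont_circle|apply: ccont_kernel2; exact: kle].
  by move=> x; apply: ccontM; [exact: ccont_circle|apply: ccont_kernel2; exact: kle].
pose a x := (1 - u / t%:C * (conjc (w * cexp x)))^-1.
pose b x := (1 - z / t%:C * (conjc (w * cexp x)))^-1.
(* The difference c a^2 - c b^2 of the two kernels, with c = conj(v), factored through a - b = c a b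
   (u - z) / t. *)
pose ker x := (conjc (w * cexp x)) * (a x + b x) *
  ((conjc (w * cexp x)) * (a x * b x) * ((u - z) / t%:C)).
rewrite (@eq_cavg _ (fun x => h (w * cexp x) * ker x)); last first.
  move=> x; rewrite /ker /a /b.
  have n1 : 1 - u / t%:C * (conjc (w * cexp x)) != 0.
    by apply: one_sub_neq0; rewrite cmodM cmodJ cmod_cexpM kle.
  have n2 : 1 - z / t%:C * (conjc (w * cexp x)) != 0.
    by apply: one_sub_neq0; rewrite cmodM cmodJ cmod_cexpM kle.
  have -> : (u - z) / t%:C = u / t%:C - z / t%:C by rewrite mulrBl.
  move: (h _) (u / t%:C) (z / t%:C) ((conjc (w * cexp x))) n1 n2 => c u' v' d n1 n2; field.
  by rewrite n1 n2.
have ca : cctn a by move=> x; apply: ccont_kernel; exact: kle.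
have cb : cctn b by move=> x; apply: ccont_kernel; exact: kle.
have cc : cctn (fun x => (conjc (w * cexp x))).
  by move=> x; apply: ccontJ; apply: ccontM; [exact: ccont_cst|exact: ccont_cexp].
have cker : cctn ker.
  move=> x; apply: ccontM.
    by apply: ccontM; [exact: cc|apply: ccontD; [exact: ca|exact: cb]].
  apply: ccontM; last exact: ccont_cst.
  by apply: ccontM; [exact: cc|apply: ccontM; [exact: ca|exact: cb]].
have kerle x : cmod (ker x) <= 1 * (2 * (dl / r)^-1) *
    (1 * ((dl / r)^-1 * (dl / r)^-1) * (cmod (u - z) / t)).
  have ha : cmod (a x) <= (dl / r)^-1 by exact: lb.
  have hb : cmod (b x) <= (dl / r)^-1 by exact: lb.
  have hc : cmod (conjc (w * cexp x)) <= 1 by rewrite cmodJ cmod_cexpM ltW.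
  rewrite /ker !cmodM cmodV cmodR gtr0_norm//.
  apply: ler_pM; rewrite ?mulr_ge0 ?cmod_ge0 ?invr_ge0 ?(ltW t0)//.
    apply: ler_pM; rewrite ?cmod_ge0//.
    by apply: le_trans (cmodD _ _) _; lra.
  apply: ler_pM; rewrite ?mulr_ge0 ?cmod_ge0 ?invr_ge0 ?(ltW t0)//.
  apply: ler_pM; rewrite ?mulr_ge0 ?cmod_ge0//.
  by apply: ler_pM; rewrite ?cmod_ge0.
rewrite cmodM cmodV cmodR gtr0_norm//.
apply: (@le_trans _ _ (K * cmod (u - z))); last by rewrite mulrC ltW.
have := cavg_le hh w1 HM cker kerle.
have tV : 0 <= t^-1 by rewrite invr_ge0 ltW.
move=> /(ler_wpM2l tV) h1; apply: le_trans h1 _.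
rewrite /K le_eqVlt; apply/orP; left; apply/eqP.
by move: (dl / r)^-1 => x; field; rewrite gt_eqF.
Qed.

Lemma is_derive_eps (f : R -> R) (x l : R) :
  (forall e, 0 < e -> exists2 d, 0 < d & forall y, `|y - x| < d ->
     `|f y - f x - l * (y - x)| <= e * `|y - x|) -> is_derive x 1 f l.
Proof.
move=> H.
have C1 : h^-1 *: (f (h *: 1 + x) - f x) @[h --> 0^'] --> l.
  apply/cvgrPdist_le => e e0; have [d d0 Hd] := H _ e0.
  near=> y.
  have y0 : y != 0 by near: y; exact: nbhs_dnbhs_neq.
  have yd : `|y| < d.
    near: y; apply: dnbhs0_lt; exact: d0.
  have := Hd (y + x); rewrite addrK => /(_ yd).
  rewrite /GRing.scale /= mulr1 => h1.
  have -> : l - y^-1 * (f (y + x) - f x) = - ((f (y + x) - f x - l * y) / y).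
    by field.
  by rewrite normrN normrM normrV ?unitfE// ler_pdivrMr ?normr_gt0.
by apply: DeriveDef; [apply/cvg_ex; exists l|exact/cvg_lim].
Unshelve. all: by end_near. Qed.

Lemma cReMr z (r : R) : complex.Re (z * r%:C) = complex.Re z * r.
Proof. by rewrite cReM /=; ring. Qed.

Lemma cImMr z (r : R) : complex.Im (z * r%:C) = complex.Im z * r.
Proof. by rewrite cImM /=; ring. Qed.

Lemma is_derive_ray h z t : holomorphic_on unit_disc h -> cmod (z * t%:C) < 1 ->
  is_derive t 1 (fun s : R => complex.Re (h (z * s%:C)))
    (complex.Re (z * hderiv h (z * t%:C))) /\
  is_derive t 1 (fun s : R => complex.Im (h (z * s%:C)))
    (complex.Im (z * hderiv h (z * t%:C))).
Proof.
move=> hh zt.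
have E e : 0 < e -> exists2 d : R, 0 < d & forall y, `|y - t| < d ->
    cmod (h (z * y%:C) - h (z * t%:C) - z * hderiv h (z * t%:C) * (y - t)%:C)
    <= e * `|y - t|.
  move=> e0; have c0 := cmod_ge0 z.
  have e1 : 0 < e / (1 + cmod z) by rewrite divr_gt0// ltr_wpDr.
  have [d d0 Hd] := hderivP (hh _ zt) e1.
  exists (d / (1 + cmod z)); first by rewrite divr_gt0// ltr_wpDr.
  move=> y; rewrite ltr_pdivlMr ?ltr_wpDr// => yd.
  have yt : z * y%:C - z * t%:C = z * (y - t)%:C by rewrite rmorphB mulrBr.
  have n0 := normr_ge0 (y - t).
  have le1 : cmod (z * y%:C - z * t%:C) <= `|y - t| * (1 + cmod z).
    by rewrite yt cmodM cmodR mulrC ler_wpM2l//; lra.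
  have := Hd (z * y%:C) (le_lt_trans le1 yd).
  rewrite {1}yt [hderiv h _ * _]mulrA [hderiv _ _ * z]mulrC => h1.
  apply: le_trans h1 _.
  apply: (@le_trans _ _ (e / (1 + cmod z) * (`|y - t| * (1 + cmod z)))).
    by rewrite ler_wpM2l// ltW.
  by rewrite le_eqVlt; apply/orP; left; apply/eqP; field; rewrite gt_eqF// ltr_wpDr.
move: E; set D := z * hderiv h _ => E.
split; apply: is_derive_eps => e /E[d d0 Hd]; exists d => // y /Hd h1;
  apply: le_trans h1.
- apply: le_trans (ler_Re_cmod _); by rewrite !cReD !cReN cReMr.
- apply: le_trans (ler_Im_cmod _); by rewrite !cImD !cImN cImMr.
Qed.

Lemma ccont_hderiv_ray h z (t : R) : holomorphic_on unit_disc h ->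
  cmod (z * t%:C) < 1 -> ccont (fun s : R => hderiv h (z * s%:C)) t.
Proof.
move=> hh zt; apply: ccont_epsP => e e0.
have [d d0 Hd] := hderiv_cont hh zt e0.
have c : ccont (fun s : R => z * s%:C) t.
  by apply: ccontM; [exact: ccont_cst|exact: ccont_real].
have [r r0 Hr] := ccont_eps c d0.
by exists r => // y /Hr /Hd.
Qed.

End CircleAverage.

(** * Area measure in polar coordinates *)

Section Area.
Variable R : realType.
Local Notation mR := (measurableTypeR R).
Local Notation plane := (mR * mR)%type.
Local Notation leb := (@lebesgue_measure R).
Local Notation area := (leb \x leb)%E.

(** Hides the construction behind the values of the measure, so that scalings of it can be passed to
    uniqueness theorems without unfolding. *)
Lemma pushforward_measure d1 d2 (T1 : measurableType d1) (T2 : measurableType d2)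
    (m : {measure set T1 -> \bar R}) (f : T1 -> T2) : measurable_fun setT f ->
  exists nu : {measure set T2 -> \bar R}, forall A, nu A = m (f @^-1` A).
Proof. by move=> mf; unshelve eexists (pushforward m f). Qed.

Lemma measurable_shift (c : R) :
  measurable_fun setT ((fun x => x + c) : mR -> mR).
Proof. exact: measurable_funD. Qed.

Lemma lebesgue_shift (c : R) (A : set mR) : measurable A ->
  leb ((fun x => x + c) @^-1` A) = leb A.
Proof.
move=> mA.
have mf := @measurable_shift c.
suff H : forall X, ocitv X -> leb X = pushforward leb (fun x : mR => x + c : mR) X.
  exact/esym/(@lebesgue_measure_unique R (pushforward leb (fun x : mR => x + c : mR)) H).
move=> _ [[a b] _ <-]; rewrite /pushforward /=.
have -> : (fun x : R => x + c) @^-1` `]a, b] = `]a - c, b - c]%classic.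
  apply/seteqP; split => x /=; rewrite !in_itv/=.
    by rewrite ltrBlDr lerBrDr.
  by rewrite ltrBlDr lerBrDr.
rewrite !lebesgue_measure_itv/= !lte_fin ltrD2r.
by case: ifPn => // _; rewrite -!EFinD; congr _%:E; ring.
Qed.

Lemma lebesgue_scale (k : R) (A : set mR) : 0 < k -> measurable A ->
  leb A = (k%:E * leb ((fun x => (k * x)%R) @^-1` A))%E.
Proof.
move=> k0 mA.
have mf : measurable_fun setT ((fun x => k * x) : mR -> mR).
  exact: measurable_funM.
have [nu0 nu0E] := pushforward_measure leb mf.
pose nu := mscale (NngNum (ltW k0)) nu0.
have nuE B : nu B = (k%:E * leb ((fun x => (k * x)%R) @^-1` B))%E by rewrite -nu0E.
suff H : forall X, ocitv X -> leb X = nu X.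
  by rewrite -nuE (@lebesgue_measure_unique R nu H).
move=> _ [[a b] _ <-]; rewrite nuE.
have -> : (fun x : R => k * x) @^-1` `]a, b] = `]a / k, b / k]%classic.
  by apply/seteqP; split => x /=; rewrite !in_itv/= ltr_pdivrMr// ler_pdivlMr// mulrC.
rewrite !lebesgue_measure_itv/= !lte_fin ltr_pM2r ?invr_gt0//.
case: ifPn => // _; last by rewrite mule0.
by rewrite -!EFinD -EFinM; congr _%:E; field; rewrite gt_eqF.
Qed.

Lemma measurable_affine (a b : R) :
  measurable_fun setT (fun w : plane => a * w.1 + b * w.2).
Proof.
apply: measurable_funD.
  by apply: measurable_funM => //; exact: measurable_fst.
by apply: measurable_funM => //; exact: measurable_snd.
Qed.

Definition lin (a b c d : R) (w : plane) : plane :=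
  (a * w.1 + b * w.2, c * w.1 + d * w.2).

Lemma measurable_lin a b c d : measurable_fun setT (lin a b c d).
Proof. by apply: measurable_fun_pair; exact: measurable_affine. Qed.

Lemma measurable_preimage d1 d2 (T1 : measurableType d1) (T2 : measurableType d2)
  (f : T1 -> T2) (A : set T2) : measurable_fun setT f -> measurable A ->
  measurable (f @^-1` A).
Proof. by move=> mf mA; rewrite -[_ @^-1` _]setTI; exact: mf. Qed.

Lemma area_shear_y m (A : set plane) : measurable A ->
  area (lin 1 0 m 1 @^-1` A) = area A.
Proof.
move=> mA; apply: eq_integral => x _ /=.
have -> : xsection (lin 1 0 m 1 @^-1` A) x =
    (fun y => y + m * x) @^-1` xsection A x.
  apply/seteqP; split => y; rewrite /xsection /= !inE /lin /=.
    by rewrite !mul1r mul0r addr0 addrC.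
  by rewrite !mul1r mul0r addr0 addrC.
by rewrite lebesgue_shift//; exact: measurable_xsection.
Qed.

Lemma area_swap (A : set plane) : measurable A -> area A = (leb \x^ leb)%E A.
Proof.
by move=> mA; apply: product_measure_unique => // B C mB mC; exact: product_measure2E.
Qed.

Lemma area_shear_x m (A : set plane) : measurable A ->
  area (lin 1 m 0 1 @^-1` A) = area A.
Proof.
move=> mA; rewrite !area_swap//; last first.
  by apply: measurable_preimage => //; exact: measurable_lin.
apply: eq_integral => y _ /=.
have -> : ysection (lin 1 m 0 1 @^-1` A) y =
    (fun x => x + m * y) @^-1` ysection A y.
  by apply/seteqP; split => x; rewrite /ysection /= !inE /lin /=;
    rewrite !mul1r mul0r add0r.
by rewrite lebesgue_shift//; exact: measurable_ysection.
Qed.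

Lemma lin_comp a b c d a' b' c' d' w : lin a b c d (lin a' b' c' d' w) =
  lin (a * a' + b * c') (a * b' + b * d') (c * a' + d * c') (c * b' + d * d') w.
Proof. by rewrite /lin /=; congr pair; ring. Qed.

Lemma area_lin_comp a b c d a' b' c' d' (A : set plane) : measurable A ->
  (forall B, measurable B -> area (lin a b c d @^-1` B) = area B) ->
  (forall B, measurable B -> area (lin a' b' c' d' @^-1` B) = area B) ->
  area (lin (a * a' + b * c') (a * b' + b * d') (c * a' + d * c') (c * b' + d * d')
    @^-1` A) = area A.
Proof.
move=> mA h1 h2; have mB : measurable (lin a b c d @^-1` A).
  by apply: measurable_preimage => //; exact: measurable_lin.
rewrite -[RHS](h1 _ mA) -[RHS](h2 _ mB).
congr area; apply/seteqP; split => w /=; by rewrite lin_comp.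
Qed.

(** A rotation is a product of three shears, horizontal, vertical and horizontal, and a shear
    translates each section. The horizontal slope [m] is minus the tangent of half the angle, which
    excludes the half-turn; that one is the square of the quarter-turn. *)
Lemma area_rot c s (A : set plane) : c ^+ 2 + s ^+ 2 = 1 -> measurable A ->
  area (lin c (- s) s c @^-1` A) = area A.
Proof.
have gen c' s' (B : set plane) : 1 + c' != 0 -> c' ^+ 2 + s' ^+ 2 = 1 ->
    measurable B -> area (lin c' (- s') s' c' @^-1` B) = area B.
  move=> c1 cs mB; pose m := - (s' / (1 + c')).
  have := @area_lin_comp _ _ _ _ _ _ _ _ B mB (@area_shear_x m)
     (fun X mX => @area_lin_comp _ _ _ _ _ _ _ _ X mX (@area_shear_y s') (@area_shear_x m)).
  have s2 : s' ^+ 2 = (1 - c') * (1 + c') by rewrite -(addrK (c' ^+ 2) (s' ^+ 2)) [_ + c' ^+ 2]addrC cs; ring.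
  have e1 : 1 + s' * m = c'.
    rewrite /m mulrN mulrA -expr2 s2 mulfK//; ring.
  rewrite !(mul0r, mul1r, mulr0, mulr1, addr0, add0r).
  have -> : 1 + m * s' = c' by rewrite mulrC.
  rewrite [s' * m + 1]addrC e1.
  suff -> : m + m * c' = - s' by [].
  by rewrite -{1}[m]mulr1 -mulrDr /m mulNr divfK.
move=> cs mA; have [c1|] := eqVneq (1 + c) 0; last by move=> c1; exact: gen.
have cE : c = -1 by rewrite -[c](addKr 1) c1 addr0.
have s0 : s = 0.
  by apply/eqP; rewrite -sqrf_eq0 -(addrK (c ^+ 2) (s ^+ 2)) [_ + c ^+ 2]addrC cs cE sqrrN expr1n subrr.
have q (B : set plane) : measurable B -> area (lin 0 (- 1) 1 0 @^-1` B) = area B.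
  by apply: gen; rewrite ?addr0 ?oner_eq0// expr0n/= add0r expr1n.
have := @area_lin_comp _ _ _ _ _ _ _ _ A mA q q.
by rewrite s0 cE oppr0 !(mul0r, mul1r, mulr0, mulr1, addr0, add0r).
Qed.

Lemma area_scale (k : R) (A : set plane) : 0 < k -> measurable A ->
  area A = ((k ^+ 2)%:E * area (lin k 0 0 k @^-1` A))%E.
Proof.
move=> k0 mA.
have mf := measurable_lin k 0 0 k.
have k20 : 0 <= k ^+ 2 by rewrite sqr_ge0.
have [nu0 nu0E] := pushforward_measure area mf.
pose nu := mscale (NngNum k20) nu0.
have nuE B : nu B = ((k ^+ 2)%:E * area (lin k 0 0 k @^-1` B))%E by rewrite -nu0E.
suff H : forall B C, measurable B -> measurable C -> nu (B `*` C) = (leb B * leb C)%E.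
  rewrite -nuE; exact: (product_measure_unique (m' := nu) H).
move=> B C mB mC; rewrite nuE.
have -> : lin k 0 0 k @^-1` (B `*` C) =
    ((fun x => k * x) @^-1` B) `*` ((fun x => k * x) @^-1` C).
  by apply/seteqP; split => -[x y] /=; rewrite /lin /= !mul0r addr0 add0r.
have mk : measurable_fun setT ((fun x => k * x) : mR -> mR).
  exact: measurable_funM.
rewrite product_measure1E; try exact: measurable_preimage.
rewrite [leb B](lebesgue_scale k0)// [leb C](lebesgue_scale k0)//.
by rewrite muleACA -EFinM -expr2.
Qed.

Definition sqn (w : plane) : R := w.1 ^+ 2 + w.2 ^+ 2.

Lemma measurable_sqn : measurable_fun setT (sqn : plane -> mR).
Proof.
apply: measurable_funD; apply: measurable_funX.
  exact: measurable_fst.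
exact: measurable_snd.
Qed.

Lemma sqn_ge0 w : 0 <= sqn w.
Proof. by rewrite addr_ge0// sqr_ge0. Qed.

Lemma measurable_sqn_itv (i : interval R) : measurable (sqn @^-1` [set` i]).
Proof. by apply: measurable_preimage => //; exact: measurable_sqn. Qed.

(** This number is pi; the factor [kap^-1] in [bergman_kernel] cancels it. *)
Definition disc_area : R := fine (area (sqn @^-1` `]-oo, 1])).

Lemma disc_areaE : area (sqn @^-1` `]-oo, 1]) = disc_area%:E.
Proof.
rewrite /disc_area fineK// ge0_fin_numE//.
apply: (@le_lt_trans _ _ (area (`[-1, 1] `*` `[-1, 1]))).
  apply: le_measure; rewrite ?inE.
  - exact: measurable_sqn_itv.
  - exact: measurableX.
  - move=> [x y] /=; rewrite /sqn /= !in_itv/= => h; rewrite -!ler_norml.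
    have y2 := sqr_ge0 y; have x2 := sqr_ge0 x.
    by split; rewrite -(ler_pXn2r (n:=2))// ?nnegrE// expr1n real_normK ?num_real//; lra.
rewrite product_measure1E//= lebesgue_measure_itv/= lte_fin.
by case: ifPn => _; rewrite ?mule0// -EFinD -EFinM ltry.
Qed.

Lemma disc_area_gt0 : 0 < disc_area.
Proof.
rewrite -lte_fin -disc_areaE.
apply: (@lt_le_trans _ _ (area (`[0, 2^-1] `*` `[0, 2^-1]))).
  rewrite product_measure1E//= lebesgue_measure_itv/= lte_fin invr_gt0 ltr0n.
  by rewrite -EFinD -EFinM lte_fin subr0 mulr_gt0// invr_gt0.
apply: le_measure; rewrite ?inE.
- exact: measurableX.
- exact: measurable_sqn_itv.
- move=> [x y] /=; rewrite /sqn /= !in_itv/= => -[/andP[x0 x1] /andP[y0 y1]].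
  nra.
Qed.

Lemma area_disc_le t : 0 < t -> area (sqn @^-1` `]-oo, t]) = (disc_area * t)%:E.
Proof.
move=> t0.
have s0 : 0 < Num.sqrt t by rewrite sqrtr_gt0.
rewrite (area_scale s0); last exact: measurable_sqn_itv.
rewrite sqr_sqrtr ?(ltW t0)// mulrC EFinM -disc_areaE; congr (_ * area _)%E.
apply/seteqP; split => -[x y] /=; rewrite !in_itv/= /sqn /lin /=;
  rewrite !mul0r addr0 add0r !exprMn -mulrDr sqr_sqrtr ?(ltW t0)// ger_pMr//.
Qed.

Lemma area_disc0 : area (sqn @^-1` `]-oo, 0]) = 0%E.
Proof.
apply/eqP; rewrite eq_le measure_ge0 andbT; apply/lee_addgt0Pr => e e0.
rewrite add0e.
have c0 := disc_area_gt0.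
have d0 : 0 < e / disc_area by rewrite divr_gt0.
apply: (@le_trans _ _ (area (sqn @^-1` `]-oo, e / disc_area]))).
  apply: le_measure; rewrite ?inE; try exact: measurable_sqn_itv.
  by move=> w /=; rewrite !in_itv/= => /le_trans; apply; exact: ltW.
by rewrite area_disc_le// lee_fin mulrCA divff ?mulr1// gt_eqF.
Qed.

Lemma area_annulus a b : 0 <= a -> a <= b ->
  area (sqn @^-1` `]a, b]) = (disc_area * (b - a))%:E.
Proof.
move=> a0 ab.
have le0 t : 0 <= t -> area (sqn @^-1` `]-oo, t]) = (disc_area * t)%:E.
  rewrite le_eqVlt => /predU1P[<-|]; first by rewrite area_disc0 mulr0.
  exact: area_disc_le.
have -> : sqn @^-1` `]a, b] = (sqn @^-1` `]-oo, b]) `\` (sqn @^-1` `]-oo, a]).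
  apply/seteqP; split => w /=; rewrite !in_itv/=.
    by move=> /andP[h1 h2]; split => //; apply/negP; rewrite -ltNge.
  by move=> [-> /negP]; rewrite -ltNge => ->.
have bfin : (area (sqn @^-1` `]-oo, b]) < +oo)%E by rewrite le0 ?ltry// (le_trans a0).
have -> : area ((sqn @^-1` `]-oo, b]) `\` (sqn @^-1` `]-oo, a])) =
    (area (sqn @^-1` `]-oo, b]) -
     area ((sqn @^-1` `]-oo, b]) `&` (sqn @^-1` `]-oo, a])))%E.
  by apply: measureD => //; exact: measurable_sqn_itv.
rewrite setIC (_ : _ `&` _ = sqn @^-1` `]-oo, a]); last first.
  apply/seteqP; split => w /=; rewrite !in_itv/=; first by case.
  by move=> h; split => //; exact: le_trans ab.
by rewrite !le0// ?(le_trans a0)// -EFinB mulrBr.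
Qed.

(** By scaling, the area of an annulus is proportional to its length in the variable |w|^2;
    uniqueness of Lebesgue measure extends this to Borel sets. *)
Lemma area_radial (A : set mR) : measurable A -> A `<=` `]0, +oo[ ->
  area (sqn @^-1` A) = (disc_area%:E * leb A)%E.
Proof.
move=> mA A0; have c0 := disc_area_gt0.
have cV0 : 0 <= disc_area^-1 by rewrite invr_ge0 ltW.
have mf := measurable_sqn.
have mN : measurable (`]-oo, 0]%classic : set mR) by [].
have [nu0 nu0E] := pushforward_measure area mf.
(* Uniqueness concerns measures on the whole line, whereas the pushforward under [sqn] lives on the
   nonnegative half; Lebesgue measure on the other half is added. *)
pose nu := measure_add (mscale (NngNum cV0) nu0) (mrestr leb mN).
have nuE B : nu B = ((disc_area^-1)%:E * area (sqn @^-1` B) +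
    leb (B `&` `]-oo, 0%R]))%E.
  by rewrite -nu0E; exact: measure_addE.
suff H : forall X, ocitv X -> leb X = nu X.
  have E : leb A = nu A by exact: (@lebesgue_measure_unique R nu H).
  rewrite E nuE.
  have -> : A `&` `]-oo, 0] = set0.
    apply/seteqP; split => x //= [/A0 /=]; rewrite !in_itv/= andbT => h1 h2.
    by move: (lt_le_trans h1 h2); rewrite ltxx.
  by rewrite measure0 adde0 muleA -EFinM divff ?gt_eqF// mul1e.
move=> _ [[a b] _ <-]; rewrite nuE.
have I x y : `]x, y] `&` `]-oo, 0] = `]x, Num.min y 0]%classic :> set R.
  by apply/seteqP; split => u /=; rewrite !in_itv/= le_min; [move=> [/andP[-> ->] ->]|
    move=> /andP[-> /andP[-> ->]]].
rewrite I !lebesgue_measure_itv/= !lte_fin.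
have [ba|ab] := leP b a.
  rewrite set_itv_ge ?bnd_simp -?leNgt// preimage_set0 measure0 mule0 add0e.
  by rewrite ltNge ge_min ba.
have [b0|b0] := leP b 0.
  rewrite ab (_ : area _ = 0%E) ?mule0 ?add0e//.
  apply/eqP; rewrite eq_le measure_ge0 andbT -area_disc0.
  apply: le_measure; rewrite ?inE; try exact: measurable_sqn_itv.
  by move=> w /=; rewrite !in_itv/= => /andP[_ /le_trans]; apply.
have [a0|a0] := leP 0 a.
  rewrite adde0 area_annulus ?(ltW ab)// -EFinM mulrA mulVf ?mul1r ?gt_eqF//.
rewrite (_ : sqn @^-1` `]a, b] = sqn @^-1` `]-oo, b]); last first.
  apply/seteqP; split => w /=; rewrite !in_itv/=; first by case/andP.
  by move=> ->; rewrite andbT (lt_le_trans a0)// sqn_ge0.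
rewrite area_disc_le// -EFinM mulrA mulVf ?gt_eqF// mul1r -!EFinD.
by congr _%:E; ring.
Qed.

End Area.

Section PlaneMeasure.
Variable R : realType.
Local Notation mR := (measurableTypeR R).
Local Notation plane := (mR * mR)%type.
Local Notation leb := (@lebesgue_measure R).

(** A separate name to which a sigma-finite structure is attached, so that the plane can be a factor
    in Fubini's theorem. *)
Definition plane_measure : set plane -> \bar R := (leb \x leb)%E.

HB.instance Definition _ := Measure.copy plane_measure (leb \x leb)%E.

Let plane_measure_sigma_finite : sigma_finite setT plane_measure.
Proof.
exists (fun n => @sqn R @^-1` `]-oo, n.+1%:R]).
  apply/seteqP; split => // w _; exists (Num.trunc (sqn w)) => //=.
  by rewrite in_itv/= ltW// truncnS_gt.
move=> n; split; first exact: measurable_sqn_itv.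
by rewrite /plane_measure area_disc_le ?ltry.
Qed.

HB.instance Definition _ := Measure_isSigmaFinite.Build _ _ _ plane_measure
  plane_measure_sigma_finite.

End PlaneMeasure.

(** * Averaging over rotations *)

Section Polar.
Variable R : realType.
Local Notation mR := (measurableTypeR R).
Local Notation plane := (mR * mR)%type.
Local Notation leb := (@lebesgue_measure R).
Local Notation area := (leb \x leb)%E.
Local Notation I2pi := (`[- pi, pi]%classic : set mR).

Definition plane_rot (x : R) : plane -> plane := lin (cos x) (- sin x) (sin x) (cos x).

Lemma sqn_rot x w : sqn (plane_rot x w) = sqn w.
Proof.
rewrite /sqn /plane_rot /lin /=.
have := cos2Dsin2 x; set c := cos x; set s := sin x => E.
transitivity ((c ^+ 2 + s ^+ 2) * (w.1 ^+ 2 + w.2 ^+ 2)); first by ring.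
by rewrite E mul1r.
Qed.

Lemma measurable_rot x : measurable_fun setT (plane_rot x).
Proof. exact: measurable_lin. Qed.

Lemma integral_rot_ge0 x (F : plane -> \bar R) : measurable_fun setT F ->
  (forall w, (0 <= F w)%E) ->
  (\int[area]_w F (plane_rot x w) = \int[area]_w F w)%E.
Proof.
move=> mF F0.
have mr := @measurable_rot x.
have := @ge0_integral_pushforward _ _ _ _ R (plane_rot x) mr area setT F measurableT mF (fun w _ => F0 w).
rewrite preimage_setT => <-; apply: eq_measure_integral => A mA _.
by apply: area_rot => //; exact: cos2Dsin2.
Qed.

Lemma measurable_joint_rot :
  measurable_fun setT (fun p : mR * plane => plane_rot p.1 p.2).
Proof.
have mc : measurable_fun setT (fun p : mR * plane => cos p.1 : mR).
  apply: (@measurableT_comp _ _ _ _ _ _ (cos : mR -> mR)); last exact: measurable_fst.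
  by apply: continuous_measurable_fun; exact: continuous_cos.
have ms : measurable_fun setT (fun p : mR * plane => sin p.1 : mR).
  apply: (@measurableT_comp _ _ _ _ _ _ (sin : mR -> mR)); last exact: measurable_fst.
  by apply: continuous_measurable_fun; exact: continuous_sin.
have m1 : measurable_fun setT (fun p : mR * plane => p.2.1 : mR).
  by apply: (measurableT_comp (f := fst)); [exact: measurable_fst|exact: measurable_snd].
have m2 : measurable_fun setT (fun p : mR * plane => p.2.2 : mR).
  by apply: (measurableT_comp (f := snd)); [exact: measurable_snd|exact: measurable_snd].
apply: measurable_fun_pair => /=.
  apply: measurable_funD; apply: measurable_funM => //.
  exact: measurableT_comp.
by apply: measurable_funD; apply: measurable_funM.
Qed.

Lemma leb_I2pi : leb I2pi = (pi *+ 2)%:E.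
Proof.
rewrite lebesgue_measure_itv/= lte_fin.
have p0 := @pi_gt0 R.
case: ifPn => [_|/negP]; last by case; lra.
by rewrite -EFinD opprK mulr2n.
Qed.

Lemma integral_indic_I2pi : (\int[leb]_x (\1_I2pi x)%:E = (pi *+ 2)%:E)%E.
Proof. by rewrite integral_indic// setIT; exact: leb_I2pi. Qed.

Lemma measurable_indic_fst :
  measurable_fun setT (fun p : mR * plane => (\1_I2pi p.1)%:E : \bar R).
Proof.
apply/measurable_EFinP.
have h : measurable_fun setT (\1_I2pi : mR -> mR) by exact: measurable_indic.
exact: (measurableT_comp h (@measurable_fst _ _ mR plane)).
Qed.

Lemma integrable_rot x (F : plane -> \bar R) : area.-integrable setT F ->
  area.-integrable setT (fun w => F (plane_rot x w)).
Proof.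
move=> /integrableP[mF iF]; apply/integrableP; split.
  by apply: measurableT_comp => //; exact: measurable_rot.
by rewrite (@integral_rot_ge0 x (fun w => `|F w|%E))//; exact: measurableT_comp.
Qed.

Lemma integral_rot x (F : plane -> \bar R) : area.-integrable setT F ->
  (\int[area]_w F (plane_rot x w) = \int[area]_w F w)%E.
Proof.
move=> iF; rewrite [LHS]integralE [RHS]integralE.
have mF := measurable_int _ iF.
congr (_ - _)%E.
  rewrite -[RHS](@integral_rot_ge0 x (F^\+)%E)//; last exact: measurable_funepos.
  by apply: eq_integral => w _; rewrite !funeposE.
rewrite -[RHS](@integral_rot_ge0 x (F^\-)%E)//; last exact: measurable_funeneg.
by apply: eq_integral => w _; rewrite !funenegE.
Qed.

(** Every rotated integral equals the original one; integrating over the angle and exchanging the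
    order moves the angular average inside. *)
Lemma average_rot_ge0 (F : plane -> \bar R) : measurable_fun setT F ->
  (forall w, (0 <= F w)%E) ->
  ((pi *+ 2)%:E * \int[area]_w F w =
   \int[area]_w \int[leb]_(x in I2pi) F (plane_rot x w))%E.
Proof.
move=> mF F0.
pose f (p : mR * plane) : \bar R := ((\1_I2pi p.1)%:E * F (plane_rot p.1 p.2))%E.
have mf : measurable_fun setT f.
  apply: emeasurable_funM.
    exact: measurable_indic_fst.
  by apply: measurableT_comp => //; exact: measurable_joint_rot.
have f0 p : (0 <= f p)%E by rewrite mule_ge0// lee_fin.
have := @fubini_tonelli _ _ _ _ R leb (@plane_measure R) f mf f0.
rewrite /f /= => E.
transitivity (\int[leb]_x \int[area]_y ((\1_I2pi x)%:E * F (plane_rot x y)))%E.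
  under [RHS]eq_integral => x _.
    rewrite ge0_integralZl//; last first.
      by apply: measurableT_comp => //; exact: measurable_rot.
    rewrite integral_rot_ge0//.
    over.
  rewrite ge0_integralZr//; last first.
    by apply: integral_ge0 => w _; exact: F0.
    by apply/measurable_EFinP; exact: measurable_indic.
  by congr (_ * _)%E; exact/esym/integral_indic_I2pi.
rewrite E; apply: eq_integral => w _.
rewrite [RHS]integral_mkcond; apply: eq_integral => x _.
rewrite patchE indicE; case: ifPn => _; by rewrite ?mul1e ?mul0e.
Qed.

Lemma average_rot (F : plane -> R) : area.-integrable setT (EFin \o F) ->
  ((pi *+ 2)%:E * \int[area]_w (F w)%:E =
   \int[area]_w \int[leb]_(x in I2pi) (F (plane_rot x w))%:E)%E.
Proof.
move=> iF; have mF := measurable_int _ iF.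
pose f (p : mR * plane) : \bar R := ((\1_I2pi p.1)%:E * (F (plane_rot p.1 p.2))%:E)%E.
have mf : measurable_fun setT f.
  apply: emeasurable_funM.
    exact: measurable_indic_fst.
  by apply: (measurableT_comp (f := EFin \o F)) => //; exact: measurable_joint_rot.
have fi : (leb \x (@plane_measure R))%E.-integrable setT f.
  apply/(integrable12ltyP leb (@plane_measure R) mf).
  rewrite (_ : (\int[leb]_x _)%E = ((pi *+ 2)%:E * \int[area]_w `|(F w)%:E|)%E).
    by rewrite lte_mul_pinfty ?lee_fin ?(ltW (pi2_gt0 R))//; have /integrableP[] := iF.
  under eq_integral => x _.
    under eq_integral => y _ do rewrite /f abseM /= ger0_norm//.
    rewrite ge0_integralZl//; last first.
      have h : measurable_fun setT (fun y : plane => F (plane_rot x y)).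
        by apply: measurableT_comp; [exact/measurable_EFinP|exact: measurable_rot].
      apply/(@measurable_EFinP _ _ _ setT (fun y : plane => `|F (plane_rot x y)|)).
      exact: measurableT_comp.
    rewrite (@integral_rot_ge0 x (fun w => `|(F w)%:E|%E))//; last first.
      exact: measurableT_comp.
    over.
  rewrite ge0_integralZr//; last first.
    by apply: integral_ge0.
    by apply/measurable_EFinP; exact: measurable_indic.
  by congr (_ * _)%E; exact: integral_indic_I2pi.
have := @Fubini _ _ _ _ R leb (@plane_measure R) f fi.
rewrite /f /= => E.
transitivity (\int[leb]_x \int[area]_y ((\1_I2pi x)%:E * (F (plane_rot x y))%:E))%E.
  have fF : (\int[area]_w (F w)%:E)%E \is a fin_num by exact: integrable_fin_num iF.
  under [RHS]eq_integral => x _.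
    rewrite integralZl//; last exact: (integrable_rot x iF).
    rewrite (integral_rot x iF).
    over.
  rewrite -(fineK fF) integralZr//; last first.
    apply/integrableP; split; first by apply/measurable_EFinP; exact: measurable_indic.
    under eq_integral do rewrite /= ger0_norm//.
    by rewrite integral_indic_I2pi ltry.
  by congr (_ * _)%E; exact/esym/integral_indic_I2pi.
rewrite E; apply: eq_integral => w _.
rewrite [RHS]integral_mkcond; apply: eq_integral => x _.
rewrite patchE indicE; case: ifPn => _; by rewrite ?mul1e ?mul0e.
Qed.

Local Notation kap := (disc_area R).

Lemma radial_ge0 (D : set mR) (Psi : R -> \bar R) : measurable D ->
  D `<=` `]0, +oo[ -> measurable_fun D Psi -> (forall t, D t -> 0 <= Psi t)%E ->
  (\int[area]_(w in @sqn R @^-1` D) Psi (sqn w) =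
   kap%:E * \int[leb]_(t in D) Psi t)%E.
Proof.
move=> mD D0 mP P0; have ms := @measurable_sqn R.
rewrite -(@ge0_integral_pushforward _ _ _ _ R (@sqn R : plane -> mR) ms area D Psi)//; last first.
  by move=> t; rewrite inE; exact: P0.
pose k : {nonneg R} := NngNum (ltW (disc_area_gt0 R)).
transitivity (\int[mscale k leb]_(t in D) Psi t)%E; last exact: ge0_integral_mscale.
apply: eq_measure_integral => A mA AD.
by apply: area_radial => // x /AD /D0.
Qed.

Lemma measurable_comp_sqn (D : set mR) (Psi : R -> \bar R) : measurable D ->
  measurable_fun D Psi ->
  measurable_fun (@sqn R @^-1` D) (fun w : plane => Psi (sqn w)).
Proof.
move=> mD mP; apply: (measurable_comp (F := D)) => //; last first.
  by apply: measurable_funS (@measurable_sqn R).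
by move=> _ [w Dw <-].
Qed.

(** Polar coordinates without a change of variables: the rotation average replaces [F] by its circle
    mean, a function of [sqn], and [radial_ge0] applies. Circle means are supplied in the shape that
    [cavg] computes. *)
Lemma polar_ge0 (D : set mR) (F : plane -> R) (Psi : R -> R) : measurable D ->
  D `<=` `]0, +oo[ -> measurable_fun (@sqn R @^-1` D) F ->
  (forall w, D (sqn w) -> 0 <= F w) ->
  measurable_fun D Psi -> (forall t, D t -> 0 <= Psi t) ->
  (forall w, D (sqn w) ->
    \int[leb]_(x in I2pi) (F (plane_rot x w))%:E = ((pi *+ 2) * Psi (sqn w))%:E)%E ->
  (\int[area]_(w in @sqn R @^-1` D) (F w)%:E =
   kap%:E * \int[leb]_(t in D) (Psi t)%:E)%E.
Proof.
move=> mD D0 mF F0 mP P0 avg.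
have msD : measurable (@sqn R @^-1` D).
  by apply: measurable_preimage => //; exact: measurable_sqn.
rewrite -(radial_ge0 (Psi := fun t => (Psi t)%:E) mD D0)//; last first.
  exact/measurable_EFinP.
pose F' := F \_ (@sqn R @^-1` D).
have mF' : measurable_fun setT (EFin \o F').
  by apply/measurable_EFinP; apply/(measurable_restrictT _ msD).
have := average_rot_ge0 mF'.
have F'0 w : (0 <= (EFin \o F') w)%E.
  by rewrite /= lee_fin /F' patchE; case: ifPn => //; rewrite inE => /F0.
move=> /(_ F'0).
rewrite (_ : (\int[area]_w (EFin \o F') w)%E = (\int[area]_(w in @sqn R @^-1` D) (F w)%:E)%E); last first.
  by rewrite [RHS]integral_mkcond restrict_EFin.
rewrite (_ : (\int[area]_w \int[leb]_(x in I2pi) _)%E =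
    ((pi *+ 2)%:E * \int[area]_(w in @sqn R @^-1` D) (Psi (sqn w))%:E)%E); last first.
  rewrite -ge0_integralZl//; last 3 first.
  - by apply: (@measurable_comp_sqn D (fun t => (Psi t)%:E)) => //; exact/measurable_EFinP.
  - by move=> w Dw; rewrite lee_fin P0.
  - by rewrite lee_fin (ltW (pi2_gt0 R)).
  rewrite [RHS]integral_mkcond; apply: eq_integral => w _.
  rewrite patchE; case: ifPn => [|/negP]; rewrite inE => Dw.
    rewrite -EFinM -avg//; apply: eq_integral => x _ /=.
    by rewrite /F' patchE mem_set//= /preimage /= sqn_rot.
  apply: integral0_eq => x _ /=.
  by rewrite /F' patchE memNset//= /preimage /= sqn_rot.
move=> /(congr1 (fun u => ((pi *+ 2)^-1%:E * u)%E)).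
rewrite !muleA -!EFinM mulVf ?gt_eqF ?pi2_gt0// !mul1e.
by [].
Qed.

Lemma integrable_comp_sqn (D : set mR) (Psi : R -> \bar R) : measurable D ->
  D `<=` `]0, +oo[ -> leb.-integrable D Psi ->
  area.-integrable (@sqn R @^-1` D) (fun w : plane => Psi (sqn w)).
Proof.
move=> mD D0 /integrableP[mP iP]; apply/integrableP; split.
  exact: measurable_comp_sqn.
rewrite (@radial_ge0 D (fun t => `|Psi t|%E))//; last exact: measurableT_comp.
by rewrite lte_mul_pinfty// lee_fin ltW// disc_area_gt0.
Qed.

Lemma radial_int (D : set mR) (Psi : R -> \bar R) : measurable D ->
  D `<=` `]0, +oo[ -> leb.-integrable D Psi ->
  (\int[area]_(w in @sqn R @^-1` D) Psi (sqn w) =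
   kap%:E * \int[leb]_(t in D) Psi t)%E.
Proof.
move=> mD D0 iP; have mP := measurable_int _ iP.
rewrite [LHS]integralE [in RHS]integralE muleBr//; last first.
  by apply: fin_num_adde_defr; exact: (integrable_pos_fin_num mD iP).
congr (_ - _)%E.
  rewrite -radial_ge0//; [by apply: eq_integral => w _; rewrite !funeposE|exact: measurable_funepos].
rewrite -radial_ge0//; [by apply: eq_integral => w _; rewrite !funenegE|exact: measurable_funeneg].
Qed.

Lemma polar_int (D : set mR) (F : plane -> R) (Psi : R -> R) : measurable D ->
  D `<=` `]0, +oo[ -> area.-integrable (@sqn R @^-1` D) (EFin \o F) ->
  leb.-integrable D (EFin \o Psi) ->
  (forall w, D (sqn w) ->
    \int[leb]_(x in I2pi) (F (plane_rot x w))%:E = ((pi *+ 2) * Psi (sqn w))%:E)%E ->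
  (\int[area]_(w in @sqn R @^-1` D) (F w)%:E =
   kap%:E * \int[leb]_(t in D) (Psi t)%:E)%E.
Proof.
move=> mD D0 iF iP avg.
have msD : measurable (@sqn R @^-1` D).
  by apply: measurable_preimage => //; exact: measurable_sqn.
rewrite -(radial_int (Psi := fun t => (Psi t)%:E) mD D0)//.
pose F' := F \_ (@sqn R @^-1` D).
have iF' : area.-integrable setT (EFin \o F').
  by rewrite /F' -restrict_EFin -integrable_mkcond.
have := average_rot iF'.
rewrite (_ : (\int[area]_w (F' w)%:E)%E = (\int[area]_(w in @sqn R @^-1` D) (F w)%:E)%E); last first.
  by rewrite [RHS]integral_mkcond restrict_EFin.
rewrite (_ : (\int[area]_w \int[leb]_(x in I2pi) _)%E =
    ((pi *+ 2)%:E * \int[area]_(w in @sqn R @^-1` D) (Psi (sqn w))%:E)%E); last first.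
  rewrite -integralZl//; last exact: (@integrable_comp_sqn D (fun t => (Psi t)%:E)).
  rewrite [RHS]integral_mkcond; apply: eq_integral => w _.
  rewrite patchE; case: ifPn => [|/negP]; rewrite inE => Dw.
    rewrite -EFinM -avg//; apply: eq_integral => x _ /=.
    by rewrite /F' patchE mem_set//= /preimage /= sqn_rot.
  apply: integral0_eq => x _ /=.
  by rewrite /F' patchE memNset//= /preimage /= sqn_rot.
move=> /(congr1 (fun u => ((pi *+ 2)^-1%:E * u)%E)).
rewrite !muleA -!EFinM mulVf ?gt_eqF ?pi2_gt0// !mul1e.
by [].
Qed.

End Polar.

(** * One-dimensional integrals *)

Section OneDim.
Variable R : realType.
Local Notation leb := (@lebesgue_measure R).

Lemma powR1r (r : R) : 1 `^ r = 1.
Proof. by rewrite powR1. Qed.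

Lemma integral_FTC (a b : R) (F f : R -> R) : a <= b ->
  (forall x, a <= x <= b -> {for x, continuous f}) ->
  (forall x, a <= x <= b -> is_derive x 1 F (f x)) ->
  (\int[leb]_(x in `[a, b]) (f x)%:E = (F b - F a)%:E)%E.
Proof.
move=> ab cf dF; rewrite -(Rintegral_FTC ab cf dF) /Rintegral fineK//.
by apply: integrable_fin_num => //; exact: itv_integrable.
Qed.

(** Monotone convergence along closed subintervals: endpoint singularities are then handled by
    primitives on compact intervals. *)
Lemma integral_oo_le (a b M : R) (f : R -> R) : a < b ->
  measurable_fun `]a, b[ f -> (forall x, a < x < b -> 0 <= f x) ->
  (forall u v, a < u -> u <= v -> v < b ->
    (\int[leb]_(x in `[u, v]) (f x)%:E <= M%:E)%E) ->
  (\int[leb]_(x in `]a, b[) (f x)%:E <= M%:E)%E.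
Proof.
move=> ab mf f0 H.
(* The denominator starts at 2 so that [e n <= (b - a) / 2] and each subinterval has ordered
   ends. *)
pose e n : R := (b - a) / n.+2%:R.
have e0 n : 0 < e n by rewrite divr_gt0// subr_gt0.
have e2 n : e n <= (b - a) / 2.
  by rewrite /e ler_pM2l ?subr_gt0// lef_pV2 ?posrE// ler_nat.
pose F n : set (measurableTypeR R) := `[a + e n, b - e n]%classic.
have FE : \bigcup_n F n = `]a, b[%classic.
  apply/seteqP; split => x /=.
    by move=> [n _]; rewrite /F /= !in_itv/=; have := e0 n; lra.
  rewrite in_itv/= => /andP[ax xb].
  pose d := Num.min (x - a) (b - x).
  have d0 : 0 < d by rewrite lt_min !subr_gt0 ax.
  have [n en] : exists n, e n < d.
    exists (Num.trunc ((b - a) / d)); rewrite /e ltr_pdivrMr//.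
    rewrite mulrC -ltr_pdivrMr//; apply: lt_trans (truncnS_gt _) _.
    by rewrite ltr_nat.
  exists n => //; rewrite /F /= in_itv/=; move: en; rewrite lt_min => /andP[]; lra.
have FS n : F n `<=` `]a, b[ by rewrite -FE => x Fx; exists n.
have mF n : measurable (F n) by rewrite /F.
have mfF n : measurable_fun (F n) (EFin \o f).
  by apply/measurable_EFinP; apply: measurable_funS mf.
have fF n x : F n x -> (0 <= (EFin \o f) x)%E.
  by move=> /FS; rewrite /= in_itv/= lee_fin; exact: f0.
have ndF : {homo F : n m / (n <= m)%N >-> (n <= m)%O}.
  move=> n m nm; apply/subsetPset => x; rewrite /F /= !in_itv/=.
  suff : e m <= e n by lra.
  by rewrite /e ler_pM2l ?subr_gt0// lef_pV2 ?posrE// ler_nat.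
have := @ge0_nondecreasing_set_cvg_integral _ _ R F (EFin \o f) leb ndF mF mfF fF.
rewrite FE => /cvg_lim <- //.
apply: lime_le; last first.
  by near=> n; apply: H; have := e0 n; have := e2 n; lra.
apply: ereal_nondecreasing_is_cvgn.
exact: ge0_nondecreasing_set_nondecreasing_integral.
Unshelve. all: by end_near. Qed.

Lemma is_derive_cont (F : R -> R) (x l : R) : is_derive x 1 F l ->
  {for x, continuous F}.
Proof.
by move=> [? _]; apply: differentiable_continuous; exact/derivable1_diffP.
Qed.

Lemma powR_cont (b x : R) : 0 < x -> {for x, continuous (fun t : R => t `^ b)}.
Proof. by move=> x0; exact: (is_derive_cont (is_derive1_powR b x0)). Qed.

Lemma is_derive_powR_div (b x : R) : b + 1 != 0 -> 0 < x ->
  is_derive x 1 (fun t : R => (b + 1)^-1 * t `^ (b + 1)) (x `^ b).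
Proof.
move=> b1 x0.
have := @is_deriveZ _ _ _ (fun t : R => t `^ (b + 1)) (b + 1)^-1 x 1 _ (is_derive1_powR (b + 1) x0).
by rewrite addrK /GRing.scale /= mulKf.
Qed.

Lemma is_derive_sub1 (x : R) : is_derive x 1 (fun t : R => 1 - t) (- 1).
Proof.
have := is_deriveB (is_derive_cst (1 : R) x (1 : R)) (is_derive_id x (1 : R)).
by rewrite sub0r.
Qed.

Lemma is_derive_powR_sub (b x : R) : b + 1 != 0 -> x < 1 ->
  is_derive x 1 (fun t : R => - ((b + 1)^-1 * (1 - t) `^ (b + 1))) ((1 - x) `^ b).
Proof.
move=> b1 x1.
have x0 : 0 < 1 - x by rewrite subr_gt0.
have := is_deriveN (@is_derive1_comp _ (fun t : R => (b + 1)^-1 * t `^ (b + 1))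
  (fun t : R => 1 - t) x _ _ (is_derive_powR_div b1 x0) (is_derive_sub1 x)).
by rewrite mulrN1 opprK.
Qed.

Lemma powR_sub_cont (b x : R) : x < 1 ->
  {for x, continuous (fun t : R => (1 - t) `^ b)}.
Proof.
move=> x1; have x0 : 0 < 1 - x by rewrite subr_gt0.
exact: is_derive_cont (@is_derive1_comp _ (fun t : R => t `^ b)
  (fun t : R => 1 - t) x _ _ (is_derive1_powR b x0) (is_derive_sub1 x)).
Qed.

Lemma measurable_powR_on (D : set (measurableTypeR R)) (b : R) : measurable D ->
  measurable_fun D (fun t : R => t `^ b).
Proof. by move=> mD; apply: measurable_funTS; exact: measurable_powR. Qed.

Lemma measurable_powR_sub (D : set (measurableTypeR R)) (b : R) : measurable D ->
  measurable_fun D (fun t : R => (1 - t) `^ b).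
Proof.
move=> mD; apply: measurable_funTS.
apply: (measurableT_comp (f := fun t : R => t `^ b)); first exact: measurable_powR.
exact: measurable_funB.
Qed.

Lemma integral_powR_itv (b u v : R) : b + 1 != 0 -> 0 < u -> u <= v ->
  (\int[leb]_(t in `[u, v]) (t `^ b)%:E =
   ((b + 1)^-1 * (v `^ (b + 1) - u `^ (b + 1)))%:E)%E.
Proof.
move=> b1 u0 uv.
have dF x : u <= x <= v ->
    is_derive x 1 (fun t : R => (b + 1)^-1 * t `^ (b + 1)) (x `^ b).
  by move=> hx; apply: is_derive_powR_div => //; lra.
rewrite (integral_FTC uv _ dF); first by rewrite mulrBr.
by move=> x hx; apply: powR_cont; lra.
Qed.

Lemma integral_powR_sub_itv (b u v : R) : b + 1 != 0 -> u <= v -> v < 1 ->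
  (\int[leb]_(t in `[u, v]) ((1 - t) `^ b)%:E =
   ((b + 1)^-1 * ((1 - u) `^ (b + 1) - (1 - v) `^ (b + 1)))%:E)%E.
Proof.
move=> b1 uv v1.
have dF x : u <= x <= v ->
    is_derive x 1 (fun t : R => - ((b + 1)^-1 * (1 - t) `^ (b + 1))) ((1 - x) `^ b).
  by move=> hx; apply: is_derive_powR_sub => //; lra.
rewrite (integral_FTC uv _ dF); first by congr _%:E; ring.
by move=> x hx; apply: powR_sub_cont; lra.
Qed.

Lemma integral_powR_le (b : R) : - 1 < b ->
  (\int[leb]_(t in `]0%R, 1%R[) (t `^ b)%:E <= (b + 1)^-1%:E)%E.
Proof.
move=> b1; have b10 : 0 < b + 1 by lra.
apply: integral_oo_le => //; first exact: measurable_powR_on.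
  by move=> x _; exact: powR_ge0.
move=> u v u0 uv v1.
rewrite integral_powR_itv ?gt_eqF// lee_fin -[leRHS]mulr1 ler_wpM2l ?invr_ge0 ?(ltW b10)//.
have h1 : v `^ (b + 1) <= 1.
  rewrite -[leRHS](powR1r (b + 1)); apply: ge0_ler_powR; rewrite ?nnegrE//; lra.
have := powR_ge0 u (b + 1); lra.
Qed.

Lemma powRD_gt0 (x r s : R) : 0 < x -> x `^ (r + s) = x `^ r * x `^ s.
Proof. by move=> x0; rewrite powRD// (gt_eqF x0) implybT. Qed.

Lemma powR_anti (x b c : R) : 0 < x -> x <= 1 -> b <= c -> x `^ c <= x `^ b.
Proof.
move=> x0 x1 bc; have [/eqP b0|b0] := boolP (b == c); first by rewrite b0.
have -> : c = b + (c - b) by ring.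
rewrite powRD_gt0//.
rewrite -[leRHS]mulr1 ler_wpM2l ?powR_ge0//.
rewrite -[leRHS](powR1r (c - b)); apply: ge0_ler_powR; rewrite ?nnegrE//; lra.
Qed.

Lemma integral_powR_pinfty (b d : R) : b <= - 1 -> 0 < d -> d <= 1 ->
  (\int[leb]_(t in `]0%R, d[) (t `^ b)%:E = +oo)%E.
Proof.
move=> b1 d0 d1; apply/eqyP => M M0.
(* The power dominates 1 / t on (0, 1], and the integral of 1 / t from [u] to [v] is exactly [M]. *)
pose v := d / 2; pose u := v * expR (- M).
have v0 : 0 < v by rewrite divr_gt0.
have vd : v < d by rewrite /v; lra.
have u0 : 0 < u by rewrite mulr_gt0// expR_gt0.
have uv : u <= v by rewrite /u ger_pMr// -expR0 ler_expR; lra.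
apply: (@le_trans _ _ (\int[leb]_(t in `[u, v]) (t^-1)%:E)%E).
  have dF x : u <= x <= v -> is_derive x 1 (@ln R) (x^-1).
    by move=> hx; apply: is_derive1_ln; lra.
  rewrite (integral_FTC uv _ dF).
    by rewrite lee_fin /u lnM ?posrE ?expR_gt0// expRK; lra.
  move=> x hx; apply: continuousV; last exact: cvg_id.
  by rewrite gt_eqF//; lra.
have mV : measurable_fun (`[u, v] : set (measurableTypeR R)) (fun t : R => t `^ b).
  exact: measurable_powR_on.
apply: (@le_trans _ _ (\int[leb]_(t in `[u, v]) (t `^ b)%:E)%E).
  apply: ge0_le_integral => //.
  - move=> x /=; rewrite in_itv/= lee_fin invr_ge0 => hx; lra.
  - apply/measurable_EFinP.
    have : measurable_fun (`[u, v] : set (measurableTypeR R)) (fun t : R => t `^ (- 1)).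
      exact: measurable_powR_on.
    apply: eq_measurable_fun => x; rewrite inE /= in_itv/= => hx.
    by rewrite powR_inv1//; lra.
  - exact/measurable_EFinP.
  - move=> x /=; rewrite in_itv/= lee_fin => hx.
    by rewrite -powR_inv1; [apply: powR_anti; lra|lra].
apply: ge0_subset_integral => //.
- by apply/measurable_EFinP; exact: measurable_powR_on.
- by move=> x _; rewrite lee_fin powR_ge0.
- by move=> x /=; rewrite !in_itv/=; lra.
Qed.

(** Split at t = x. For t >= x use 1 - x t >= 1 - x, which gives the term with 1 / (1 - b); for t <=
    x use 1 - x t >= 1 - t, which gives the term with 1 / b. *)
Lemma integral_hardy_le (b x : R) : 0 < b -> b < 1 -> 0 <= x -> x < 1 ->
  (\int[leb]_(t in `]0%R, 1%R[) ((1 - t) `^ (- b) / (1 - x * t))%:E <=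
   ((b^-1 + (1 - b)^-1) * (1 - x) `^ (- b))%:E)%E.
Proof.
move=> b0 b1 x0 x1.
have x10 : 0 < 1 - x by lra.
have xt t : 0 < t < 1 -> 0 < 1 - x * t.
  move=> /andP[t0 t1]; have : x * t <= 1 * t by rewrite ler_pM2r// ltW.
  lra.
have mg : measurable_fun (`]0%R, 1%R[ : set (measurableTypeR R))
    (fun t : R => (1 - t) `^ (- b) / (1 - x * t)).
  apply: measurable_funM; first exact: measurable_powR_sub.
  have : measurable_fun (`]0%R, 1%R[ : set (measurableTypeR R))
      (fun t : R => (1 - x * t) `^ (- 1)).
    apply: measurable_funTS.
    apply: (measurableT_comp (f := fun t : R => t `^ (- 1))); first exact: measurable_powR.
    by apply: measurable_funB => //; exact: measurable_funM.
  apply: eq_measurable_fun => t; rewrite inE /= in_itv/= => ht.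
  by rewrite powR_inv1//; exact/ltW/xt.
have g0 t : 0 < t < 1 -> 0 <= (1 - t) `^ (- b) / (1 - x * t).
  by move=> ht; rewrite mulr_ge0 ?powR_ge0// invr_ge0 ltW// xt.
apply: integral_oo_le => //.
have bn : - b + 1 != 0 by rewrite gt_eqF//; lra.
have bn2 : - b - 1 + 1 != 0 by rewrite subrK oppr_eq0 gt_eqF.
have mgS u v : 0 < u -> v < 1 -> measurable_fun (`[u, v] : set (measurableTypeR R))
    (fun t : R => (1 - t) `^ (- b) / (1 - x * t)).
  move=> u0 v1; apply: measurable_funS mg => //.
  by move=> t /=; rewrite !in_itv/=; lra.
have I1 u v : 0 < u -> u <= v -> v < 1 -> x <= u ->
    (\int[leb]_(t in `[u, v]) ((1 - t) `^ (- b) / (1 - x * t))%:E <=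
     ((1 - b)^-1 * (1 - x) `^ (- b))%:E)%E.
  move=> u0 uv v1 xu.
  have ms : measurable_fun (`[u, v] : set (measurableTypeR R)) (fun t : R => (1 - t) `^ (- b)).
    exact: measurable_powR_sub.
  apply: (@le_trans _ _ (\int[leb]_(t in `[u, v]) ((1 - x)^-1%:E * ((1 - t) `^ (- b))%:E))%E).
    apply: ge0_le_integral => //.
    - by move=> t /=; rewrite in_itv/= lee_fin => ht; apply: g0; lra.
    - by apply/measurable_EFinP; exact: mgS.
    - by apply: emeasurable_funM => //; exact/measurable_EFinP.
    - move=> t /=; rewrite in_itv/= -EFinM lee_fin => ht.
      rewrite mulrC ler_wpM2r ?powR_ge0// lef_pV2 ?posrE ?xt//; last by lra.
      have : x * t <= x * 1 by rewrite ler_wpM2l//; lra.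
      lra.
  rewrite ge0_integralZl//; last 3 first.
  - exact/measurable_EFinP.
  - by move=> t _; rewrite lee_fin powR_ge0.
  - by rewrite lee_fin invr_ge0 ltW.
  rewrite integral_powR_sub_itv// -EFinM lee_fin.
  have h1 : 0 <= (1 - v) `^ (- b + 1) by exact: powR_ge0.
  have h2 : (1 - u) `^ (- b + 1) <= (1 - x) `^ (- b + 1).
    by apply: ge0_ler_powR; rewrite ?nnegrE; lra.
  have -> : (1 - x) `^ (- b) = (1 - x)^-1 * (1 - x) `^ (- b + 1).
    by rewrite powRD_gt0// powRr1 ?(ltW x10)// mulrCA mulVf ?mulr1// gt_eqF.
  rewrite [leRHS]mulrCA [- b + 1]addrC ler_wpM2l ?invr_ge0 ?(ltW x10)//.
  rewrite ler_wpM2l ?invr_ge0//; first by lra.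
  by rewrite [1 - b]addrC; lra.
have I2 u v : 0 < u -> u <= v -> v < 1 -> v <= x ->
    (\int[leb]_(t in `[u, v]) ((1 - t) `^ (- b) / (1 - x * t))%:E <=
     (b^-1 * (1 - x) `^ (- b))%:E)%E.
  move=> u0 uv v1 vx.
  apply: (@le_trans _ _ (\int[leb]_(t in `[u, v]) ((1 - t) `^ (- b - 1))%:E)%E).
    apply: ge0_le_integral => //.
    - by move=> t /=; rewrite in_itv/= lee_fin => ht; apply: g0; lra.
    - by apply/measurable_EFinP; exact: mgS.
    - by apply/measurable_EFinP; exact: measurable_powR_sub.
    - move=> t /=; rewrite in_itv/= lee_fin => ht.
      have t1 : 0 < 1 - t by lra.
      rewrite powRD_gt0// powR_inv1 ?(ltW t1)//.
      rewrite ler_wpM2l ?powR_ge0// lef_pV2 ?posrE ?xt//; last by lra.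
      have : x * t <= 1 * t by rewrite ler_wpM2r//; lra.
      lra.
  rewrite integral_powR_sub_itv// lee_fin subrK invrN mulNr -mulrN opprB.
  rewrite ler_wpM2l ?invr_ge0 ?(ltW b0)//.
  have h1 := powR_ge0 (1 - u) (- b).
  have h2 : (1 - v) `^ (- b) <= (1 - x) `^ (- b).
    rewrite !powRN lef_pV2 ?posrE ?powR_gt0//; last by lra.
    by apply: ge0_ler_powR; rewrite ?nnegrE; lra.
  lra.
have c1 : 0 <= b^-1 * (1 - x) `^ (- b) by rewrite mulr_ge0 ?powR_ge0// invr_ge0 ltW.
have c2 : 0 <= (1 - b)^-1 * (1 - x) `^ (- b).
  by rewrite mulr_ge0 ?powR_ge0// invr_ge0; lra.
move=> u v u0 uv v1.
have [xu|ux] := leP x u.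
  by apply: le_trans (I1 _ _ u0 uv v1 xu) _; rewrite lee_fin mulrDl; lra.
have [vx|xv] := leP v x.
  by apply: le_trans (I2 _ _ u0 uv v1 vx) _; rewrite lee_fin mulrDl; lra.
have SE : `[u, v]%classic = `[u, x]%classic `|` `]x, v]%classic :> set (measurableTypeR R).
  by rewrite -itv_bndbnd_setU// ?bnd_simp// ltW.
rewrite SE ge0_integral_setU//.
- rewrite mulrDl EFinD; apply: leeD; first by apply: I2 => //; lra.
  apply: (@le_trans _ _ (\int[leb]_(t in `[x, v]) ((1 - t) `^ (- b) / (1 - x * t))%:E)%E); last first.
    by apply: I1 => //; lra.
  apply: ge0_subset_integral => //.
  + by apply/measurable_EFinP; apply: mgS => //; lra.
  + by move=> t /=; rewrite in_itv/= lee_fin => ht; apply: g0; lra.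
  + by apply: subset_itv; rewrite ?bnd_simp.
- by rewrite -SE; apply/measurable_EFinP; exact: mgS.
- by move=> t; rewrite -SE /= in_itv/= lee_fin => ht; apply: g0; lra.
- apply/disj_setPS => t [] /=; rewrite !in_itv/=; lra.
Qed.

(* [t `^ e] is the factor with a possible singularity at 0, [(1 - t) `^ (- b)] the one at 1. *)
Lemma integral_kernel_le (e b x : R) : - 1 < e -> 0 < b -> b < 1 ->
  0 <= x -> x < 1 ->
  (\int[leb]_(t in `]0%R, 1%R[) (t `^ e * (1 - t) `^ (- b) / (1 - x * t))%:E <=
   ((4 / (e + 1) + 2 * (b^-1 + (1 - b)^-1)) * (1 - x) `^ (- b))%:E)%E.
Proof.
move=> e1 b0 b1 x0 x1.
have x10 : 0 < 1 - x by lra.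
have e10 : 0 < e + 1 by lra.
have xt t : 0 < t < 1 -> 0 < 1 - x * t.
  move=> /andP[t0 t1]; have : x * t <= 1 * t by rewrite ler_pM2r// ltW.
  lra.
have mg : measurable_fun (`]0%R, 1%R[ : set (measurableTypeR R))
    (fun t : R => (1 - t) `^ (- b) / (1 - x * t)).
  apply: measurable_funM; first exact: measurable_powR_sub.
  have : measurable_fun (`]0%R, 1%R[ : set (measurableTypeR R))
      (fun t : R => (1 - x * t) `^ (- 1)).
    apply: measurable_funTS.
    apply: (measurableT_comp (f := fun t : R => t `^ (- 1))); first exact: measurable_powR.
    by apply: measurable_funB => //; exact: measurable_funM.
  apply: eq_measurable_fun => t; rewrite inE /= in_itv/= => ht.
  by rewrite powR_inv1//; exact/ltW/xt.
have me : measurable_fun (`]0%R, 1%R[ : set (measurableTypeR R)) (fun t : R => t `^ e).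
  exact: measurable_powR_on.
have g0 t : 0 < t < 1 -> 0 <= (1 - t) `^ (- b) / (1 - x * t).
  by move=> ht; rewrite mulr_ge0 ?powR_ge0// invr_ge0 ltW// xt.
apply: (@le_trans _ _ (\int[leb]_(t in `]0%R, 1%R[) (4%:E * (t `^ e)%:E +
    2%:E * ((1 - t) `^ (- b) / (1 - x * t))%:E))%E).
  apply: ge0_le_integral => //.
  - move=> t /=; rewrite in_itv/= lee_fin => ht.
    by rewrite -mulrA mulr_ge0 ?powR_ge0// g0.
  - apply/measurable_EFinP; have := measurable_funM me mg.
    by apply: eq_measurable_fun => t _; rewrite /= mulrA.
  - apply: emeasurable_funD; apply: emeasurable_funM => //; exact/measurable_EFinP.
  - move=> t /=; rewrite in_itv/= -!EFinM -EFinD lee_fin => ht.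
    have te0 := powR_ge0 t e; have gt0 := g0 t ht.
    have [t2|t2] := leP t (2^-1).
      apply: (@le_trans _ _ (4 * t `^ e)); last by rewrite lerDl mulr_ge0.
      rewrite -mulrA mulrC ler_wpM2r//.
      have -> : 4 = 2 * 2 :> R by ring.
      apply: ler_pM; rewrite ?powR_ge0 ?invr_ge0 ?(ltW (xt _ ht))//.
        apply: (@le_trans _ _ ((1 - t) `^ (- 1))).
          apply: powR_anti; lra.
        rewrite powR_inv1; last by lra.
        rewrite -[leRHS]invrK lef_pV2 ?posrE; lra.
      rewrite -[leRHS]invrK lef_pV2 ?posrE ?xt//.
      have : x * t <= 1 * t by rewrite ler_wpM2r//; lra.
      lra.
    apply: (@le_trans _ _ (2 * ((1 - t) `^ (- b) / (1 - x * t)))); last first.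
      by rewrite lerDr mulr_ge0.
    rewrite -mulrA ler_wpM2r//.
    apply: (@le_trans _ _ (t `^ (- 1))); first by apply: powR_anti; lra.
    rewrite powR_inv1; last by lra.
    rewrite -[leRHS]invrK lef_pV2 ?posrE; lra.
rewrite ge0_integralD//=; last 4 first.
- by move=> t _; rewrite -EFinM lee_fin mulr_ge0 ?powR_ge0.
- by apply: emeasurable_funM => //; exact/measurable_EFinP.
- by move=> t /=; rewrite in_itv/= => ht; rewrite -EFinM lee_fin mulr_ge0// g0.
- by apply: emeasurable_funM => //; exact/measurable_EFinP.
have me' : measurable_fun (`]0%R, 1%R[ : set (measurableTypeR R)) (fun t : R => (t `^ e)%:E).
  exact/measurable_EFinP.
have mg' : measurable_fun (`]0%R, 1%R[ : set (measurableTypeR R))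
    (fun t : R => ((1 - t) `^ (- b) / (1 - x * t))%:E).
  exact/measurable_EFinP.
rewrite (@ge0_integralZl _ _ _ leb _ _ (fun t : R => (t `^ e)%:E))//; last first.
  by move=> t _; rewrite lee_fin powR_ge0.
rewrite (@ge0_integralZl _ _ _ leb _ _ (fun t : R => ((1 - t) `^ (- b) / (1 - x * t))%:E))//.
have -> : (4 / (e + 1) + 2 * (b^-1 + (1 - b)^-1)) * (1 - x) `^ (- b) =
    4 / (e + 1) * (1 - x) `^ (- b) + 2 * ((b^-1 + (1 - b)^-1) * (1 - x) `^ (- b)).
  by rewrite mulrDl [in RHS]mulrA.
have A : (4%:E * \int[leb]_(t in `]0%R, 1%R[) (t `^ e)%:E <=
    (4 / (e + 1) * (1 - x) `^ (- b))%:E)%E.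
  apply: (@le_trans _ _ (4%:E * ((e + 1)^-1)%:E)%E).
    by rewrite lee_wpmul2l ?lee_fin// integral_powR_le.
  rewrite -EFinM lee_fin ler_peMr//; first by rewrite divr_ge0// ltW.
  rewrite powRN -[leLHS]invr1 lef_pV2 ?posrE ?powR_gt0//.
  rewrite -[leRHS](powR1r b); apply: ge0_ler_powR; rewrite ?nnegrE; lra.
have B : (2%:E * \int[leb]_(t in `]0%R, 1%R[) ((1 - t) `^ (- b) / (1 - x * t))%:E <=
    (2 * ((b^-1 + (1 - b)^-1) * (1 - x) `^ (- b)))%:E)%E.
  by rewrite EFinM lee_wpmul2l ?lee_fin//; exact: integral_hardy_le.
by rewrite EFinD; exact: leeD A B.
Qed.

End OneDim.

(** * The weight and its kernel *)

Section CMeas.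
Context d (T : measurableType d) (R : realType) (D : set T).
Local Notation C := R[i].
Implicit Types f g : T -> C.

Definition cmeas f := measurable_fun D (fun x => complex.Re (f x)) /\
  measurable_fun D (fun x => complex.Im (f x)).

Lemma eq_cmeas f g : {in D, f =1 g} -> cmeas f -> cmeas g.
Proof.
move=> fg [rf jf]; split; [apply: eq_measurable_fun rf|apply: eq_measurable_fun jf];
  by move=> x Dx; rewrite fg.
Qed.

Lemma cmeas_cst k : cmeas (fun=> k).
Proof. by split; exact: measurable_cst. Qed.

Lemma cmeas_real (f : T -> R) : measurable_fun D f -> cmeas (fun x => (f x)%:C).
Proof. by move=> mf; split => //; exact: measurable_cst. Qed.

Lemma cmeasD f g : cmeas f -> cmeas g -> cmeas (fun x => f x + g x).
Proof.
move=> [rf jf] [rg jg]; split.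
  have := measurable_funD rf rg; apply: eq_measurable_fun => x _; by rewrite cReD.
have := measurable_funD jf jg; apply: eq_measurable_fun => x _; by rewrite cImD.
Qed.

Lemma cmeasM f g : cmeas f -> cmeas g -> cmeas (fun x => f x * g x).
Proof.
move=> [rf jf] [rg jg]; split.
  have := measurable_funB (measurable_funM rf rg) (measurable_funM jf jg).
  by apply: eq_measurable_fun => x _; rewrite cReM.
have := measurable_funD (measurable_funM rf jg) (measurable_funM jf rg).
by apply: eq_measurable_fun => x _; rewrite cImM.
Qed.

Lemma cmeasN f : cmeas f -> cmeas (fun x => - f x).
Proof.
move=> cf; apply: (@eq_cmeas (fun x => -1 * f x)); first by move=> x _; rewrite mulN1r.
by apply: cmeasM => //; exact: cmeas_cst.
Qed.

Lemma cmeasB f g : cmeas f -> cmeas g -> cmeas (fun x => f x - g x).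
Proof. by move=> cf cg; apply: cmeasD => //; exact: cmeasN. Qed.

Lemma cmeasJ f : cmeas f -> cmeas (fun x => conjc (f x)).
Proof.
move=> [rf jf]; split.
  by apply: eq_measurable_fun rf => x _; rewrite cReJ.
have := measurable_funM (measurable_cst (-1 : R)) jf.
by apply: eq_measurable_fun => x _; rewrite cImJ /= mulN1r.
Qed.

Lemma measurable_sqr_cmod f : cmeas f -> measurable_fun D (fun x => cmod (f x) ^+ 2).
Proof.
move=> [rf jf]; have := measurable_funD (measurable_funX 2 rf) (measurable_funX 2 jf).
by apply: eq_measurable_fun => x _; rewrite sqr_cmod.
Qed.

Lemma measurable_cmod f : cmeas f -> measurable_fun D (fun x => cmod (f x)).
Proof.
move=> cf; have := measurable_sqr_cmod cf => m2.
have ms : measurable_fun setT (Num.sqrt : R -> R).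
  by apply: continuous_measurable_fun; exact: sqrt_continuous.
have := measurableT_comp ms m2.
apply: eq_measurable_fun => x _ /=.
by rewrite sqrtr_sqr ger0_norm ?cmod_ge0.
Qed.

Lemma measurable_inv (f : T -> R) : measurable_fun D f -> (forall x, 0 <= f x) ->
  measurable_fun D (fun x => (f x)^-1).
Proof.
move=> mf f0; have := measurableT_comp (measurable_powR (-1 : R)) mf.
by apply: eq_measurable_fun => x _ /=; rewrite powR_inv1.
Qed.

Lemma cmeasV f : cmeas f -> cmeas (fun x => (f x)^-1).
Proof.
move=> cf; apply: (@eq_cmeas (fun x => ((cmod (f x) ^+ 2)^-1)%:C * conjc (f x))).
  by move=> x _; rewrite invc_conj.
apply: cmeasM; last exact: cmeasJ.
apply: cmeas_real; apply: measurable_inv; first exact: measurable_sqr_cmod.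
by move=> x; rewrite exprn_ge0// cmod_ge0.
Qed.

End CMeas.

(** * Norms on the punctured disc and circle averages of the kernel *)

Section Setup.
Variable R : realType.
Local Notation C := R[i].
Local Notation mR := (measurableTypeR R).
Local Notation plane := (mR * mR)%type.
Local Notation leb := (@lebesgue_measure R).
Local Notation area := (leb \x leb)%E.
Local Notation kap := (disc_area R).
Local Notation pt := (@plane_pt R).

(** The disc without its centre: there [sqn] is positive, so real powers of it multiply freely.
    Integrals against the weight do not change, since the weight is 0 at 0. *)
Definition pdisc : set plane := @sqn R @^-1` `]0, 1[.

Lemma cmod_pt w : cmod (pt w) ^+ 2 = sqn w.
Proof. by rewrite sqr_cmod. Qed.

Lemma measurable_pdisc : measurable pdisc.
Proof. exact: measurable_sqn_itv. Qed.

Lemma cmod_pt_lt1 w : (cmod (pt w) < 1) = (sqn w < 1).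
Proof. by rewrite -cmod_pt expr_lt1// cmod_ge0. Qed.

Lemma plane_set_disc : plane_set unit_disc = @sqn R @^-1` `]-oo, 1[.
Proof.
by apply/seteqP; split => w; rewrite /plane_set /unit_disc /= in_itv/= cmod_pt_lt1.
Qed.

Lemma measurable_plane_disc : measurable (plane_set (@unit_disc R) : set plane).
Proof. by rewrite plane_set_disc; exact: measurable_sqn_itv. Qed.

Lemma pdiscP w : pdisc w -> 0 < sqn w /\ sqn w < 1.
Proof. by rewrite /pdisc /= in_itv/= => /andP[]. Qed.

Lemma pdisc_sub : pdisc `<=` plane_set (@unit_disc R).
Proof.
by move=> w /pdiscP[_]; rewrite plane_set_disc /= in_itv.
Qed.

Lemma pdisc_unit w : pdisc w -> unit_disc (pt w).
Proof. exact: pdisc_sub. Qed.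

Lemma sqn_eq0 (w : plane) : sqn w = 0 -> w = (0, 0).
Proof.
case: w => x y; rewrite /sqn /= => /eqP.
by rewrite paddr_eq0 ?sqr_ge0// !sqrf_eq0 => /andP[/eqP -> /eqP ->].
Qed.

Lemma integral_plane_disc (F : plane -> \bar R) : F (0, 0) = 0%E ->
  (\int[area]_(w in plane_set (@unit_disc R)) F w = \int[area]_(w in pdisc) F w)%E.
Proof.
move=> F0; rewrite integral_mkcond [RHS]integral_mkcond; congr integral.
apply/funext => w; rewrite !patchE plane_set_disc.
have [w0|w0] := eqVneq (sqn w) 0.
  by rewrite (sqn_eq0 w0) F0; case: ifP; case: ifP.
have -> : (w \in pdisc) = (w \in (@sqn R @^-1` `]-oo, 1[ : set plane)); last by [].
apply/idP/idP; rewrite !inE /pdisc /= !in_itv/=; first by case/andP.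
by move=> ->; rewrite andbT lt0r w0 sqn_ge0.
Qed.

Variable s : R.
Hypotheses (s_gt : 2^-1 < s) (s_lt : s < 1).

(* The value at 0 is 0, because [0 `^ r = 0] for [r != 0]. *)
Definition disc_weight (z : C) : R := (cmod z ^+ 2) `^ (- (1 + s)).
Definition plane_weight (w : plane) : R := sqn w `^ (- (1 + s)).

Lemma disc_weight_pt w : disc_weight (pt w) = plane_weight w.
Proof. by rewrite /disc_weight cmod_pt. Qed.

Lemma plane_weight_ge0 w : 0 <= plane_weight w. Proof. exact: powR_ge0. Qed.

Let s1_neq0 : - (1 + s) != 0.
Proof. by rewrite oppr_eq0 gt_eqF//; have := s_gt; lra. Qed.

Lemma plane_weight0 : plane_weight (0, 0) = 0.
Proof. by rewrite /plane_weight /sqn /= expr0n/= addr0 powR0. Qed.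

Lemma measurable_plane_weight (D : set plane) : measurable D -> measurable_fun D plane_weight.
Proof.
move=> mD; apply: measurable_funTS.
by apply: (measurableT_comp (measurable_powR (- (1 + s)))); exact: measurable_sqn.
Qed.

Lemma disc_weight_weight : weight unit_disc disc_weight.
Proof.
split; first by move=> z _; exact: powR_ge0.
rewrite /real_measurable.
have := measurable_plane_weight measurable_plane_disc; apply: eq_measurable_fun => w _.
by rewrite /= disc_weight_pt.
Qed.

(** The p-th power of the norm, without the root. *)
Definition pnorm (p : R) (f : C -> C) : \bar R :=
  (\int[area]_(w in pdisc) (cmod (f (pt w)) `^ p * plane_weight w)%:E)%E.

Lemma Lp_normE p f : Lp_norm unit_disc disc_weight p f = (pnorm p f `^ p^-1)%E.
Proof.
have E : (\int[area]_(w in plane_set (@unit_disc R))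
    (cmod (f (pt w)) `^ p * disc_weight (pt w))%:E = pnorm p f)%E.
  rewrite /pnorm -(integral_plane_disc (F := fun w => (cmod (f (pt w)) `^ p * plane_weight w)%:E)).
    by apply: eq_integral => w _; rewrite disc_weight_pt.
  by rewrite plane_weight0 mulr0.
exact: (congr1 (fun x => (x `^ p^-1)%E) E).
Qed.

Lemma pnorm_ge0 p f : (0 <= pnorm p f)%E.
Proof. by apply: integral_ge0 => w _; rewrite lee_fin mulr_ge0 ?powR_ge0. Qed.

Lemma cmeasP (f : C -> C) : complex_measurable unit_disc f ->
  cmeas pdisc (fun w => f (pt w)).
Proof.
by move=> [rf jf]; split; [apply: measurable_funS rf|apply: measurable_funS jf] => //;
  [exact: measurable_plane_disc|exact: pdisc_sub|exact: measurable_plane_disc|exact: pdisc_sub].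
Qed.

Lemma Lp_spaceP p f : 0 < p -> Lp_space unit_disc disc_weight p f <->
  complex_measurable unit_disc f /\ (pnorm p f < +oo)%E.
Proof.
move=> p0; rewrite /Lp_space /= Lp_normE; split => -[cf h]; split => //.
  by apply: lty_poweRy h; rewrite invr_eq0 gt_eqF.
exact: poweR_lty.
Qed.

Lemma cmeas_pt (D : set plane) : measurable D -> cmeas D pt.
Proof.
by move=> mD; split; apply: measurable_funTS;
  [exact: measurable_fst|exact: measurable_snd].
Qed.

(* The sum of [(n - s) x^n] over [n >= 1]; the squared norm of [w^n] is proportional to
   [1 / (n - s)]. *)
Definition kern (x : C) : C := x / (1 - x) ^+ 2 - s%:C * (x / (1 - x)).

(** Over the common denominator the numerator is x times the convex combination (1 - s) + s x, of
    modulus at most 1. *)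
Lemma kern_le x : cmod x < 1 -> cmod (kern x) <= cmod x / cmod (1 - x) ^+ 2.
Proof.
move=> x1; have n0 := one_sub_neq0 x1.
have -> : kern x = x * ((1 - s)%:C + s%:C * x) / (1 - x) ^+ 2.
  by rewrite /kern rmorphB rmorph1; field.
rewrite !cmodM cmodV cmodX ler_wpM2r ?invr_ge0 ?exprn_ge0 ?cmod_ge0//.
rewrite -[leRHS]mulr1 ler_wpM2l ?cmod_ge0//.
apply: le_trans (cmodD _ _) _; rewrite cmodM !cmodR.
have s0 := s_gt; have s1 := s_lt; have c0 := cmod_ge0 x.
rewrite !ger0_norm; [|lra|lra].
have : s * cmod x <= s * 1 by rewrite ler_wpM2l; lra.
lra.
Qed.

Lemma kernJ x : conjc (kern x) = kern (conjc x).
Proof.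
by rewrite /kern !(rmorphB, rmorphM, rmorphXn, rmorph1)/= oppr0 !conjc_inv
  !(rmorphB, rmorphXn, rmorph1).
Qed.

Definition bergman_kernel (z w : C) : C := kap^-1%:C * kern (z * conjc w).

Lemma cmeas_bergman_kernel (D : set plane) z : measurable D -> cmeas D (fun w => bergman_kernel z (pt w)).
Proof.
move=> mD; apply: cmeasM; first exact: cmeas_cst.
have m1 : cmeas D (fun w => z * conjc (pt w)).
  by apply: cmeasM; [exact: cmeas_cst|apply: cmeasJ; exact: cmeas_pt].
have m2 : cmeas D (fun w => (1 - z * conjc (pt w))^-1).
  by apply: cmeasV; apply: cmeasB => //; exact: cmeas_cst.
apply: cmeasB.
  apply: cmeasM => //; have := cmeasM m2 m2; apply: eq_cmeas => w _.
  by rewrite -expr2 exprVn.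
by apply: cmeasM; [exact: cmeas_cst|exact: cmeasM].
Qed.

Lemma bergman_kernel_le z w : cmod z < 1 -> cmod w < 1 ->
  cmod (bergman_kernel z w) <= kap^-1 * (cmod z * cmod w / cmod (1 - z * conjc w) ^+ 2).
Proof.
move=> z1 w1; have k0 := disc_area_gt0 R.
rewrite /bergman_kernel cmodM cmodR ger0_norm ?invr_ge0 ?(ltW k0)//.
rewrite ler_wpM2l ?invr_ge0 ?(ltW k0)//.
have zw : cmod (z * conjc w) = cmod z * cmod w by rewrite cmodM cmodJ.
rewrite -zw; apply: kern_le; rewrite zw.
apply: le_lt_trans z1; rewrite -[leRHS]mulr1 ler_wpM2l ?cmod_ge0//; exact: ltW.
Qed.

Lemma pt_rot x w : pt (plane_rot x w) = pt w * cexp x.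
Proof. by rewrite /plane_pt /plane_rot /lin /cexp /=; simpc; congr (_ +i* _); ring. Qed.

(** Writing x / (1 - x) as 1 / (1 - x) - 1 reduces the kernel to those of [cdavg] and [cauchy_avg]
    plus a constant; the constant averages [h] to [h 0 = 0]. *)
Lemma bergman_kernel_avg h z w : holomorphic_on unit_disc h -> h 0 = 0 ->
  cmod z < 1 -> cmod w < 1 ->
  cavg (fun x => bergman_kernel z (w * cexp x) * h (w * cexp x)) =
  kap^-1%:C * (z * (cmod w ^+ 2)%:C * hderiv h (z * (cmod w ^+ 2)%:C) -
    s%:C * h (z * (cmod w ^+ 2)%:C)).
Proof.
move=> hh h0 z1 w1.
have zw : cmod z * cmod w < 1.
  by apply: le_lt_trans z1; rewrite -[leRHS]mulr1 ler_wpM2l ?cmod_ge0// ltW.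
have c0 : cctn (fun x => h (w * cexp x)) by move=> x; exact: ccont_circle.
have c1 : cctn (fun x => h (w * cexp x) / (1 - z * conjc (w * cexp x))).
  by move=> x; apply: ccontM; [exact: c0|exact: ccont_kernel].
have c2 : cctn (fun x => h (w * cexp x) *
    (conjc (w * cexp x) / (1 - z * conjc (w * cexp x)) ^+ 2)).
  by move=> x; apply: ccontM; [exact: c0|exact: ccont_kernel2].
have E x : bergman_kernel z (w * cexp x) * h (w * cexp x) = kap^-1%:C *
    (z * (h (w * cexp x) * (conjc (w * cexp x) / (1 - z * conjc (w * cexp x)) ^+ 2)) -
     s%:C * (h (w * cexp x) / (1 - z * conjc (w * cexp x)) - h (w * cexp x))).
  have n1 : 1 - z * conjc (w * cexp x) != 0.
    by apply: one_sub_neq0; rewrite cmodM cmodJ cmod_cexpM.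
  rewrite /bergman_kernel /kern; move: (h _) (conjc _) n1 (kap^-1%:C) => a b n1 k.
  by field.
rewrite (eq_cavg E) cavgZ; last first.
  move=> x; apply: ccontB; first by apply: ccontM; [exact: ccont_cst|exact: c2].
  by apply: ccontM; [exact: ccont_cst|apply: ccontB; [exact: c1|exact: c0]].
rewrite cavgB; last 2 first.
  by move=> x; apply: ccontM; [exact: ccont_cst|exact: c2].
  move=> x; apply: ccontM; first exact: ccont_cst.
  by apply: ccontB; [exact: c1|exact: c0].
rewrite !cavgZ//; last by move=> x; apply: ccontB; [exact: c1|exact: c0].
rewrite cavgB// cauchy_avg// mean_value// h0 subr0.
by rewrite -/(cdavg h z w) cdavg_deriv// !mulrA.
Qed.

End Setup.

(** * Weighted integrals over the disc *)

Section Hoelder.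
Context d (T : measurableType d) (R : realType) (mu : {measure set T -> \bar R}).

Lemma ge0_hoelder (D : set T) (u v : T -> R) (p q : R) : measurable D ->
  measurable_fun D u -> measurable_fun D v ->
  (forall x, D x -> 0 <= u x) -> (forall x, D x -> 0 <= v x) ->
  0 < p -> 0 < q -> p^-1 + q^-1 = 1 ->
  (\int[mu]_(x in D) (u x * v x)%:E <=
   (\int[mu]_(x in D) (u x `^ p)%:E) `^ p^-1 *
   (\int[mu]_(x in D) (v x `^ q)%:E) `^ q^-1)%E.
Proof.
move=> mD mu' mv u0 v0 p0 q0 pq.
have mU : measurable_fun setT (u \_ D) by apply/(measurable_restrictT _ mD).
have mV : measurable_fun setT (v \_ D) by apply/(measurable_restrictT _ mD).
have N r (f : T -> R) : 0 < r -> (forall x, D x -> 0 <= f x) ->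
    ('N[mu]_(r%:E)[EFin \o (f \_ D)] = (\int[mu]_(x in D) (f x `^ r)%:E) `^ r^-1)%E.
  move=> r0 f0; rewrite unlock /=; apply: (congr1 (fun x => (x `^ r^-1)%E)).
  rewrite [RHS]integral_mkcond; apply: eq_integral => x _.
  rewrite /= !patchE; case: ifPn => [/set_mem/f0 fx|_].
    by rewrite ger0_norm.
  by rewrite -[point]/(0 : R) normr0 powR0// gt_eqF.
have := hoelder mu mU mV p0 q0 pq.
rewrite !N//; apply: le_trans; rewrite unlock /= invr1 poweRe1; last first.
  by apply: integral_ge0 => x _; rewrite lee_fin powR_ge0.
rewrite integral_mkcond le_eqVlt; apply/orP; left; apply/eqP/eq_integral => x _.
rewrite powRr1// !patchE; case: ifPn => [/set_mem Dx|_].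
  by rewrite ger0_norm// mulr_ge0 ?u0 ?v0.
by rewrite -[LHS]/(0%:E) -[X in `|X * _|]/(0 : R) mul0r normr0.
Qed.

End Hoelder.

(** * Square-integrable functions for the weight *)

Section Inner.
Variable R : realType.
Local Notation C := R[i].
Local Notation mR := (measurableTypeR R).
Local Notation plane := (mR * mR)%type.
Local Notation leb := (@lebesgue_measure R).
Local Notation area := (leb \x leb)%E.
Local Notation pt := (@plane_pt R).
Local Notation pdisc := (@pdisc R).
Variable s : R.
Hypotheses (s_gt : 2^-1 < s) (s_lt : s < 1).
Local Notation pw := (plane_weight s).
Local Notation mw := (disc_weight s).
Implicit Types F G : plane -> C.

Definition sqnorm F : \bar R := (\int[area]_(w in pdisc) (cmod (F w) ^+ 2 * pw w)%:E)%E.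

Definition sqint F : Prop := cmeas pdisc F /\ (sqnorm F < +oo)%E.

Let md := @measurable_pdisc R.

Lemma measurable_sqnorm F : cmeas pdisc F ->
  measurable_fun pdisc (fun w => cmod (F w) ^+ 2 * pw w).
Proof.
by move=> cF; apply: measurable_funM; [exact: measurable_sqr_cmod|exact: measurable_plane_weight].
Qed.

Lemma sqint_integrable F : sqint F ->
  area.-integrable pdisc (fun w => (cmod (F w) ^+ 2 * pw w)%:E).
Proof.
move=> [mF iF]; apply/integrableP; split.
  by apply/measurable_EFinP; exact: measurable_sqnorm.
apply: le_lt_trans iF; rewrite le_eqVlt; apply/orP; left; apply/eqP/eq_integral => w _.
by rewrite gee0_abs// lee_fin mulr_ge0 ?plane_weight_ge0 ?sqr_ge0.
Qed.

Lemma sqint_dom F G (u : plane -> R) : sqint F -> sqint G ->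
  measurable_fun pdisc u -> (forall w, pdisc w -> `|u w| <= cmod (F w) * cmod (G w)) ->
  area.-integrable pdisc (fun w => (u w * pw w)%:E).
Proof.
move=> iF iG mu uFG.
have iH : area.-integrable pdisc
    (fun w => ((cmod (F w) ^+ 2 + cmod (G w) ^+ 2) * pw w)%:E).
  have := integrableD md (sqint_integrable iF) (sqint_integrable iG).
  by apply: eq_integrable => // w _; rewrite mulrDl EFinD.
apply: (le_integrable _ _ _ iH) => //.
  by apply/measurable_EFinP; apply: measurable_funM => //; exact: measurable_plane_weight.
move=> w Dw; rewrite /= lee_fin normrM [leRHS]normrM (ger0_norm (plane_weight_ge0 _ _)).
rewrite ler_wpM2r ?plane_weight_ge0//.
rewrite [leRHS]ger0_norm ?addr_ge0 ?sqr_ge0//.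
apply: le_trans (uFG _ Dw) _.
have := sqr_ge0 (cmod (F w) - cmod (G w)).
have := sqr_ge0 (cmod (F w)); have := sqr_ge0 (cmod (G w)); nra.
Qed.

Definition cintegrable F := cmeas pdisc F /\
  area.-integrable pdisc (fun w => (cmod (F w) * pw w)%:E).

Lemma sqintM F G : sqint F -> sqint G -> cintegrable (fun w => F w * G w).
Proof.
move=> iF iG; have [mF _] := iF; have [mG _] := iG.
split; first exact: cmeasM.
apply: (sqint_dom iF iG); first by apply: measurable_cmod; exact: cmeasM.
by move=> w _; rewrite ger0_norm ?cmod_ge0// cmodM.
Qed.

Lemma sqintJ F : sqint F -> sqint (fun w => conjc (F w)).
Proof.
move=> [mF iF]; split; first exact: cmeasJ.
by apply: le_lt_trans iF; rewrite le_eqVlt; apply/orP; left; apply/eqP/eq_integral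
  => w _; rewrite cmodJ.
Qed.

Lemma cintegrable_dom F (u : plane -> R) : cintegrable F -> measurable_fun pdisc u ->
  (forall w, pdisc w -> `|u w| <= cmod (F w)) ->
  area.-integrable pdisc (fun w => (u w * pw w)%:E).
Proof.
move=> [mF iF] mu uF; apply: (le_integrable _ _ _ iF) => //.
  by apply/measurable_EFinP; apply: measurable_funM => //; exact: measurable_plane_weight.
move=> w Dw; rewrite /= lee_fin !normrM (ger0_norm (plane_weight_ge0 _ _)) ler_wpM2r ?plane_weight_ge0//.
by rewrite (ger0_norm (cmod_ge0 _)) uF.
Qed.

Lemma cintegrable_ReIm F : cintegrable F ->
  area.-integrable pdisc (fun w => (complex.Re (F w) * pw w)%:E) /\
  area.-integrable pdisc (fun w => (complex.Im (F w) * pw w)%:E).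
Proof.
move=> iF; have [[mr mj] _] := iF; split; apply: (cintegrable_dom iF) => // w _.
  exact: ler_Re_cmod.
exact: ler_Im_cmod.
Qed.

Definition wint F : C :=
  Rintegral area pdisc (fun w => complex.Re (F w) * pw w) +i*
  Rintegral area pdisc (fun w => complex.Im (F w) * pw w).

Lemma L2_innerE f g :
  L2_inner unit_disc mw f g = wint (fun w => f (pt w) * conjc (g (pt w))).
Proof.
have E (u : plane -> R) : Rintegral area (plane_set (@unit_disc R))
    (fun w => u w * mw (pt w)) = Rintegral area pdisc (fun w => u w * pw w).
  rewrite /Rintegral; apply: (congr1 fine).
  rewrite -(integral_plane_disc (F := fun w => (u w * pw w)%:E)); last first.
    by rewrite plane_weight0 ?mulr0.
  by apply: eq_integral => w _; rewrite disc_weight_pt.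
exact: (congr2 (@Complex R) (E _) (E _)).
Qed.

Lemma eq_wint F G : {in pdisc, F =1 G} -> wint F = wint G.
Proof.
by move=> FG; rewrite /wint; congr (_ +i* _); apply: eq_Rintegral => w Dw; rewrite FG.
Qed.

Lemma wintB F G : cintegrable F -> cintegrable G ->
  wint (fun w => F w - G w) = wint F - wint G.
Proof.
move=> /cintegrable_ReIm[rF jF] /cintegrable_ReIm[rG jG].
apply: complex_eq; rewrite /= -RintegralB//; apply: eq_Rintegral => w _.
  by rewrite cReD cReN mulrBl.
by rewrite cImD cImN mulrBl.
Qed.

Lemma wintZ k F : cintegrable F -> wint (fun w => k * F w) = k * wint F.
Proof.
move=> /cintegrable_ReIm[rF jF]; case: k => k l.
have I r (u : plane -> R) : area.-integrable pdisc (EFin \o u) ->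
    area.-integrable pdisc (EFin \o (fun w => r * u w)).
  by move=> iu; have := integrableZl md r iu; apply: eq_integrable.
apply: complex_eq; rewrite /= ?(cReM, cImM) /=.
  rewrite -!RintegralZl// -RintegralB//; [|exact: I|exact: I].
  by apply: eq_Rintegral => w _; rewrite cReM /= mulrBl !mulrA.
rewrite -!RintegralZl// -RintegralD//; [|exact: I|exact: I].
by apply: eq_Rintegral => w _; rewrite cImM /= mulrDl !mulrA.
Qed.

Lemma wint_le F : cintegrable F ->
  ((cmod (wint F))%:E <= 2%:E * \int[area]_(w in pdisc) (cmod (F w) * pw w)%:E)%E.
Proof.
move=> iF; have [rF jF] := cintegrable_ReIm iF; have [_ nF] := iF.
have H (u : plane -> R) : (forall w, `|u w| <= cmod (F w)) ->
    area.-integrable pdisc (fun w => (u w * pw w)%:E) ->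
    (`|Rintegral area pdisc (fun w => u w * pw w)|%:E <=
     \int[area]_(w in pdisc) (cmod (F w) * pw w)%:E)%E.
  move=> uF iu; have fu := integrable_fin_num md iu.
  rewrite -abse_EFin /Rintegral fineK//.
  apply: le_trans (le_abse_integral _ md (measurable_int _ iu)) _.
  apply: ge0_le_integral => //.
  - by apply: measurableT_comp => //; exact: (measurable_int _ iu).
  - exact: (measurable_int _ nF).
  - by move=> w Dw; rewrite /= lee_fin normrM (ger0_norm (plane_weight_ge0 _ _)) ler_wpM2r ?plane_weight_ge0.
apply: (@le_trans _ _ ((`|complex.Re (wint F)| + `|complex.Im (wint F)|)%:E)).
  by rewrite lee_fin ler_cmod_ReIm.
have -> : (2%:E * \int[area]_(w in pdisc) (cmod (F w) * pw w)%:E =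
    \int[area]_(w in pdisc) (cmod (F w) * pw w)%:E +
    \int[area]_(w in pdisc) (cmod (F w) * pw w)%:E)%E 
  by rewrite (_ : 2%:E = 1 + 1)%E// ge0_muleDl// !mul1e.
rewrite EFinD; apply: leeD; apply: H => // w; [exact: ler_Re_cmod|exact: ler_Im_cmod].
Qed.

(** Hoelder's inequality with exponent 2, after giving each factor the square root of the weight. *)
Lemma cauchy_schwarz F G : cmeas pdisc F -> cmeas pdisc G ->
  (\int[area]_(w in pdisc) (cmod (F w * G w) * pw w)%:E <=
   sqnorm F `^ 2^-1 * sqnorm G `^ 2^-1)%E.
Proof.
move=> mF mG.
have m F' : cmeas pdisc F' -> measurable_fun pdisc (fun w => cmod (F' w) * pw w `^ 2^-1).
  move=> cF'; apply: measurable_funM; first exact: measurable_cmod.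
  by apply: (measurableT_comp (measurable_powR _)); exact: measurable_plane_weight.
have h0 F' w : pdisc w -> 0 <= cmod (F' w) * pw w `^ 2^-1.
  by move=> _; rewrite mulr_ge0 ?cmod_ge0 ?powR_ge0.
have pp w : pw w `^ 2^-1 * pw w `^ 2^-1 = pw w.
  by rewrite -expr2 -powR_mulrn ?powR_ge0// -powRrM mulVf// powRr1// plane_weight_ge0.
have h2 : (2^-1 + 2^-1 : R) = 1 by lra.
have := ge0_hoelder area md (m _ mF) (m _ mG) (h0 F) (h0 G) (ltr0n _ 2) (ltr0n _ 2) h2.
have E F' : (\int[area]_(w in pdisc) ((cmod (F' w) * pw w `^ 2^-1) `^ 2)%:E = sqnorm F')%E.
  apply: eq_integral => w _.
  by rewrite powR_mulrn ?mulr_ge0 ?cmod_ge0 ?powR_ge0// exprMn [X in _ * X]expr2 pp.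
rewrite !E; apply: le_trans; rewrite le_eqVlt; apply/orP; left; apply/eqP/eq_integral => w _.
by rewrite cmodM mulrACA pp.
Qed.

(** Here s < 1 enters: |w|^2 times the weight is t^(-s) in the variable t = |w|^2, integrable at 0.
    Kernels, monomials and test functions are all covered by this bound. *)
Lemma sqint_lin F (c : R) : cmeas pdisc F -> 
  (forall w, pdisc w -> cmod (F w) <= c * cmod (pt w)) -> sqint F.
Proof.
move=> mF Fc; split=> //.
have mP : measurable_fun (`]0%R, 1%R[ : set mR) (fun t : R => (t `^ (- s))%:E).
  by apply/measurable_EFinP; exact: measurable_powR_on.
have D0 : (`]0%R, 1%R[ : set mR) `<=` `]0, +oo[.
  by move=> t /=; rewrite !in_itv/= => /andP[->].
have H := radial_ge0 (measurable_itv _) D0 mP (fun t _ => powR_ge0 _ _ : (0 <= (t `^ (- s))%:E)%E).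
apply: (@le_lt_trans _ _ ((c ^+ 2)%:E * \int[area]_(w in pdisc) (sqn w `^ (- s))%:E)%E).
  rewrite -ge0_integralZl//; last 3 first.
    exact: (measurable_comp_sqn (measurable_itv _) mP).
    by move=> w _; rewrite lee_fin powR_ge0.
    by rewrite lee_fin sqr_ge0.
  apply: ge0_le_integral => //.
  - by move=> w _; rewrite lee_fin mulr_ge0 ?plane_weight_ge0 ?sqr_ge0.
  - by apply/measurable_EFinP; exact: measurable_sqnorm.
  - by apply: emeasurable_funM => //; exact: (measurable_comp_sqn (measurable_itv _) mP).
  - move=> w Dw; rewrite -EFinM lee_fin.
    have [w0 _] := pdiscP Dw.
    have -> : sqn w `^ (- s) = sqn w * pw w.
      rewrite /plane_weight -{2}(powRr1 (ltW w0)) -powRD_gt0//; congr (_ `^ _); ring.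
    rewrite mulrA ler_wpM2r ?plane_weight_ge0// -cmod_pt -exprMn.
    by rewrite lerXn2r ?nnegrE ?cmod_ge0 ?Fc//; apply: le_trans (Fc _ Dw); exact: cmod_ge0.
rewrite H; apply: lte_mul_pinfty; rewrite ?lee_fin ?sqr_ge0//.
apply: lte_mul_pinfty; rewrite ?lee_fin ?(ltW (disc_area_gt0 R))//.
apply: le_lt_trans (ltry ((- s + 1)^-1)).
by apply: integral_powR_le; have := s_lt; lra.
Qed.

End Inner.

(** * The reproducing formula *)

Section Repro.
Variable R : realType.
Local Notation C := R[i].
Local Notation mR := (measurableTypeR R).
Local Notation plane := (mR * mR)%type.
Local Notation leb := (@lebesgue_measure R).
Local Notation area := (leb \x leb)%E.
Local Notation kap := (disc_area R).
Local Notation pt := (@plane_pt R).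
Local Notation pdisc := (@pdisc R).
Local Notation I2pi := (`[- pi, pi]%classic : set mR).
Variable s : R.
Hypotheses (s_gt : 2^-1 < s) (s_lt : s < 1).
Local Notation pw := (plane_weight s).
Local Notation mw := (disc_weight s).
Local Notation bker := (bergman_kernel s).
Implicit Types h : C -> C.

Let md := @measurable_pdisc R.

Lemma integral_Re_cavg (g : R -> C) : cctn g ->
  (\int[leb]_(x in I2pi) (complex.Re (g x))%:E =
   ((pi *+ 2) * complex.Re (cavg g))%:E)%E.
Proof.
move=> cg; have [rg _] := @ccont_integrable _ (- pi) pi g (fun x _ => cg x).
rewrite /cavg [X in complex.Re X]mulrC cReMr /cint /= mulrC mulfVK ?gt_eqF ?pi2_gt0//.
by rewrite /Rintegral fineK//; exact: integrable_fin_num.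
Qed.

(** Otherwise [|h|] stays above [|h 0| / 2] near 0, and the norm dominates the divergent integral of
    t^(-1-s). *)
Lemma bergman_at0 h : holomorphic_on unit_disc h ->
  sqint s (fun w => h (pt w)) -> h 0 = 0.
Proof.
move=> hh [mh ih]; apply/eqP/negPn/negP; rewrite -cmod_gt0 => m0.
have d0 : derivable (h : C^o -> C^o) 0 1.
  have u0 : cmod (0 : C) < 1 by rewrite cmod0.
  exact: hh u0.
have e0 : 0 < cmod (h 0) / 2 by lra.
have [d dp Hd] := derivable_cmod_cont d0 e0.
pose r := Num.min (d ^+ 2) 1.
have r0 : 0 < r by rewrite lt_min exprn_gt0//=.
have r1 : r <= 1 by rewrite ge_min lexx orbT.
have rd : r <= d ^+ 2 by rewrite ge_min lexx.
pose D : set mR := `]0%R, r[%classic.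
have D0 : D `<=` `]0, +oo[ by move=> t; rewrite /D /= !in_itv/= => /andP[->].
have mD : measurable D by exact: measurable_itv.
pose Psi (t : R) := ((cmod (h 0) ^+ 2 / 4)%:E * (t `^ (- (1 + s)))%:E)%E.
have mP : measurable_fun D Psi.
  apply: emeasurable_funM => //; apply/measurable_EFinP; exact: measurable_powR_on.
have P0 t : D t -> (0 <= Psi t)%E.
  by move=> _; rewrite mule_ge0// lee_fin ?powR_ge0// divr_ge0 ?sqr_ge0.
have EI : (\int[leb]_(t in D) Psi t = +oo)%E.
  rewrite /Psi ge0_integralZl//; last 3 first.
  - by apply/measurable_EFinP; exact: measurable_powR_on.
  - by move=> t _; rewrite lee_fin powR_ge0.
  - by rewrite lee_fin divr_ge0 ?sqr_ge0.
  rewrite integral_powR_pinfty//; last by have := s_gt; lra.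
  by rewrite gt0_muley// lte_fin divr_gt0 ?exprn_gt0.
have E := radial_ge0 mD D0 mP P0; rewrite EI gt0_muley ?lte_fin ?disc_area_gt0// in E.
suff : (+oo <= sqnorm s (fun w => h (pt w)))%E by rewrite leNgt ih.
rewrite -E.
have sD : @sqn R @^-1` D `<=` pdisc.
  move=> w; rewrite /D /pdisc /preimage /= !in_itv/= => /andP[h1 h2].
  by rewrite h1 (lt_le_trans h2 r1).
have msD : measurable (@sqn R @^-1` D : set plane) by exact: measurable_sqn_itv.
have mq : measurable_fun pdisc (fun w => (cmod (h (pt w)) ^+ 2 * pw w)%:E).
  by apply/measurable_EFinP; exact: measurable_sqnorm.
apply: (@le_trans _ _ (\int[area]_(w in @sqn R @^-1` D) (cmod (h (pt w)) ^+ 2 * pw w)%:E)%E).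
  apply: ge0_le_integral => //.
  - by move=> w Dw; exact: (P0 (sqn w) Dw).
  - exact: (measurable_comp_sqn mD mP).
  - exact: measurable_funS mq.
  - move=> w Dw; rewrite /Psi -EFinM lee_fin ler_wpM2r ?powR_ge0//.
    have : cmod (h (pt w) - h 0) <= cmod (h 0) / 2.
      apply: Hd; rewrite subr0 -(ltr_pXn2r (n := 2)) ?nnegrE ?cmod_ge0 ?(ltW dp)//.
      rewrite cmod_pt; apply: lt_le_trans rd; move: Dw; rewrite /D /= in_itv/=.
      by case/andP.
    have := cmod_distD (h 0) (h (pt w)); rewrite cmod_distC.
    move: (cmod (h 0)) (cmod (h (pt w))) (cmod (_ - _)) m0 (cmod_ge0 (h (pt w))) => a b c a0 b0 h1 h2.
    have : a / 2 <= b by lra.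
    nra.
apply: ge0_subset_integral => //.
by move=> w _; rewrite lee_fin mulr_ge0 ?sqr_ge0 ?plane_weight_ge0.
Qed.

Lemma bergman_kernel_lin z w : cmod z < 1 -> cmod w < 1 ->
  cmod (bker z w) <= kap^-1 / (1 - cmod z) ^+ 2 * cmod w.
Proof.
move=> z1 w1; apply: le_trans (bergman_kernel_le _ _ z1 w1) _ => //.
have k0 := disc_area_gt0 R; have z0 := cmod_ge0 z; have w0 := cmod_ge0 w.
rewrite -[leRHS]mulrA ler_wpM2l ?invr_ge0 ?(ltW k0)// mulrC ler_pM ?invr_ge0 ?exprn_ge0 ?mulr_ge0 ?cmod_ge0//.
  rewrite lef_pV2 ?posrE ?exprn_gt0 ?subr_gt0//; last first.
    rewrite cmod_gt0; apply: one_sub_neq0; rewrite cmodM cmodJ; nra.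
  rewrite ler_pXn2r ?nnegrE ?cmod_ge0 ?subr_ge0 ?(ltW z1)//.
  apply: le_trans (cmod_one_sub _); rewrite cmodM cmodJ; nra.
by rewrite -[leRHS]mul1r ler_wpM2r// ltW.
Qed.

Lemma bergman_kernel_sqint z : cmod z < 1 -> sqint s (fun w => bker z (pt w)).
Proof.
move=> z1; apply: (sqint_lin s_lt (c := kap^-1 / (1 - cmod z) ^+ 2)).
  by apply: cmeas_bergman_kernel.
by move=> w Dw; apply: bergman_kernel_lin => //; exact: pdisc_unit.
Qed.

(** In polar form the integrand is the derivative of t^(-s) h(t z), and the integral is its
    increment from [d] to 1. The end t = 1 is harmless because [|z| < 1] keeps t z inside the disc;
    the cut at [d] avoids the singularity at 0. *)
Lemma repro_annulus h z (d : R) : holomorphic_on unit_disc h -> sqint s (fun w => h (pt w)) ->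
  cmod z < 1 -> 0 < d -> d < 1 ->
  (\int[area]_(w in @sqn R @^-1` `]d, 1%R[)
     (complex.Re (bker z (pt w) * h (pt w)) * pw w)%:E =
   (complex.Re (h z) - d `^ (- s) * complex.Re (h (z * d%:C)))%:E)%E.
Proof.
move=> hh ih z1 d0 d1.
have h0 := bergman_at0 hh ih.
have zt t : d <= t <= 1 -> cmod (z * t%:C) < 1.
  move=> /andP[td t1]; rewrite cmodM cmodR ger0_norm; last by lra.
  by have := cmod_ge0 z; nra.
pose psi t := complex.Re (z * hderiv h (z * t%:C)) * t - s * complex.Re (h (z * t%:C)).
pose Psi t := kap^-1 * (psi t * t `^ (- (1 + s))).
have cI t : d <= t <= 1 -> ccont (fun u : R => h (z * u%:C)) t.
  move=> dt; apply: (@ccont_comp _ h (fun u => z * u%:C)).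
    by apply: hh; exact: zt.
  apply: ccontM; first exact: ccont_cst.
  by apply: ccont_real; exact: cvg_id.
have cH t : d <= t <= 1 -> ccont (fun u : R => z * hderiv h (z * u%:C)) t.
  by move=> dt; apply: ccontM; [exact: ccont_cst|apply: ccont_hderiv_ray => //; exact: zt].
have cpsi t : d <= t <= 1 -> {for t, continuous (fun u => psi u * u `^ (- (1 + s)))}.
  move=> dt; have [? _] := cI t dt; have [? _] := cH t dt.
  apply: cvgM; last by apply: powR_cont; lra.
  by apply: cvgB; apply: cvgM => //; first [exact: cvg_id|exact: cvg_cst].
have cPsi t : d <= t <= 1 -> {for t, continuous Psi}.
  by move=> dt; apply: cvgM; [exact: cvg_cst|exact: cpsi].
have mD : measurable (`]d, 1[ : set mR) by exact: measurable_itv.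
have D0 : (`]d, 1[ : set mR) `<=` `]0, +oo[.
  by move=> t /=; rewrite !in_itv/= => /andP[dt _]; rewrite andbT; lra.
have sub : @sqn R @^-1` `]d, 1[ `<=` pdisc.
  by move=> w /=; rewrite /pdisc /= !in_itv/= => /andP[dt ->]; rewrite andbT; lra.
have iF : area.-integrable pdisc
    (fun w => (complex.Re (bker z (pt w) * h (pt w)) * pw w)%:E).
  by have [] := cintegrable_ReIm (sqintM (bergman_kernel_sqint z1) ih).
have iP := itv_integrable cPsi.
rewrite (polar_int mD D0 (Psi := Psi)).
- have -> : (\int[leb]_(t in `]d, 1%R[) (Psi t)%:E = (kap^-1)%:E *
      \int[leb]_(t in `[d, 1%R]) (psi t * t `^ (- (1 + s)))%:E)%E.
    rewrite -integralZl//; last exact: itv_integrable.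
    rewrite -(@integral_itv_bndoo R d 1 (EFin \o Psi) true false); last first.
      apply: measurable_funS (measurable_int _ iP) => //.
      by move=> t /=; rewrite !in_itv/= => /andP[h1 h2]; rewrite !ltW.
    by apply: eq_integral => t _; rewrite EFinM.
  rewrite muleA -EFinM mulfV ?gt_eqF ?disc_area_gt0// mul1e.
  pose G t := t `^ (- s) * complex.Re (h (z * t%:C)).
  have dG t : d <= t <= 1 -> is_derive t 1 G (psi t * t `^ (- (1 + s))).
    move=> dt; have [dr _] := is_derive_ray hh (zt t dt).
    have t0 : 0 < t by lra.
    have dm : is_derive t 1 G _ := is_deriveM (is_derive1_powR (- s) t0) dr.
    apply: (is_derive_eq dm).
    rewrite /psi -[_ *: _]/(_ * _) -[X in _ + X]/(_ * _).
    have -> : t `^ (- s) = t * t `^ (- (1 + s)).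
      rewrite -[X in X * _](powRr1 (ltW t0)) -powRD_gt0//; congr (_ `^ _); ring.
    have -> : - s - 1 = - (1 + s) by ring.
    ring.
  rewrite (integral_FTC (ltW d1) cpsi dG) /G powR1r mul1r.
  by rewrite rmorph1 mulr1.
- by apply: integrableS iF => //; exact: measurable_sqn_itv.
- apply: (integrableS _ _ _ iP) => //.
  by move=> t /=; rewrite !in_itv/= => /andP[h1 h2]; rewrite !ltW.
- move=> w Dw; have [_ w1] := pdiscP (sub _ Dw).
  have cw1 : cmod (pt w) < 1 by rewrite cmod_pt_lt1.
  pose g x := bker z (pt w * cexp x) * h (pt w * cexp x).
  have cg : cctn g.
    move=> x; apply: ccontM; last exact: ccont_circle.
    apply: ccontM; first exact: ccont_cst.
    have zw : cmod z * cmod (pt w) < 1 by have := cmod_ge0 z; have := cmod_ge0 (pt w); nra.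
    have c1 : ccont (fun x => z * conjc (pt w * cexp x)) x.
      apply: ccontM; first exact: ccont_cst.
      by apply: ccontJ; apply: ccontM; [exact: ccont_cst|exact: ccont_cexp].
    have c2 := ccont_kernel x zw.
    have c3 := ccontM c1 (ccontM c2 c2).
    apply: ccontB; last by apply: ccontM; [exact: ccont_cst|exact: ccontM].
    by apply: eq_ccont c3 => y; rewrite -expr2 exprVn.
  under eq_integral do rewrite pt_rot /plane_weight sqn_rot mulrC EFinM.
  rewrite integralZl//; last first.
    by have [] := @ccont_integrable _ (- pi) pi g (fun x _ => cg x).
  rewrite (integral_Re_cavg cg) /g bergman_kernel_avg// -EFinM; congr (_%:E).
  rewrite cmod_pt /Psi /psi mulrCA; congr (_ * _).
  rewrite mulrC [in RHS]mulrA; congr (_ * _).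
  rewrite [in LHS]mulrC cReMr mulrC; congr (_ * _).
  rewrite cReD cReN [s%:C * _]mulrC cReMr mulrAC cReMr.
  by rewrite [s * _]mulrC.
Qed.

Lemma holomorphic_linear_at0 h : holomorphic_on unit_disc h -> h 0 = 0 ->
  exists c r : R, [/\ 0 <= c, 0 < r &
    forall w, cmod w < r -> cmod (h w) <= c * cmod w].
Proof.
move=> hh h0; have u0 : cmod (0 : C) < 1 by rewrite cmod0.
have [d d0 Hd] := hderivP (hh _ u0) ltr01.
exists (cmod (hderiv h 0) + 1), d; split => //; first by rewrite addr_ge0 ?cmod_ge0.
move=> w; have := Hd w; rewrite h0 !subr0 => H /H; rewrite mul1r => H'.
have := cmod_distD (h w) (hderiv h 0 * w); rewrite mulrDl mul1r -cmodM cmod_distC.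
have := cmodD (h w - hderiv h 0 * w) (hderiv h 0 * w); rewrite subrK.
lra.
Qed.

Lemma holomorphicZ k h : holomorphic_on unit_disc h ->
  holomorphic_on unit_disc (fun w => k * h w).
Proof.
by move=> hh z z1; exact: (@derivableZ C C^o C^o h k z 1 (hh z z1)).
Qed.

Lemma sqintZ k F : sqint s F -> sqint s (fun w : plane => k * F w).
Proof.
move=> [mF iF]; split; first by apply: cmeasM => //; exact: cmeas_cst.
rewrite /sqnorm (eq_integral (fun w => (cmod k ^+ 2)%:E * (cmod (F w) ^+ 2 * pw w)%:E)%E);
  last by move=> w _; rewrite cmodM exprMn -mulrA EFinM.
rewrite ge0_integralZl//; last 3 first.
- by apply/measurable_EFinP; exact: measurable_sqnorm.
- by move=> w _; rewrite lee_fin mulr_ge0 ?sqr_ge0 ?plane_weight_ge0.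
- by rewrite lee_fin sqr_ge0.
by apply: lte_mul_pinfty => //; rewrite lee_fin sqr_ge0.
Qed.

(** Let the inner radius tend to 0 in [repro_annulus], by dominated convergence. Since [h 0 = 0],
    the boundary term d^(-s) h(d z) is O(d^(1-s)). *)
Lemma repro_Re h z : holomorphic_on unit_disc h -> sqint s (fun w => h (pt w)) ->
  cmod z < 1 ->
  (\int[area]_(w in pdisc) (complex.Re (bker z (pt w) * h (pt w)) * pw w)%:E =
   (complex.Re (h z))%:E)%E.
Proof.
move=> hh ih z1; have h0 := bergman_at0 hh ih.
have s1 : 0 < 1 - s by have := s_lt; lra.
pose e n := n.+2%:R^-1 : R.
have e0 n : 0 < e n by rewrite invr_gt0 ltr0n.
have e1 n : e n < 1 by rewrite invf_lt1 ?ltr0n// ltr1n.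
have ce : e n @[n --> \oo] --> 0.
  have := @cvg_harmonic R; rewrite -cvg_shiftS; exact.
pose d n := e n `^ (1 - s)^-1.
have d0 n : 0 < d n by rewrite powR_gt0.
have de n : d n <= e n.
  rewrite -[leRHS](powRr1 (ltW (e0 n))); apply: powR_anti => //; first exact: ltW.
  rewrite -[leLHS]invr1 lef_pV2 ?posrE//; by have := s_gt; lra.
have d1 n : d n < 1 := le_lt_trans (de n) (e1 n).
have ds n : d n `^ (1 - s) = e n.
  by rewrite /d -powRrM mulVf ?gt_eqF// powRr1// ltW.
pose F w := complex.Re (bker z (pt w) * h (pt w)) * pw w.
have iF : area.-integrable pdisc (EFin \o F).
  by have [] := cintegrable_ReIm (sqintM (bergman_kernel_sqint z1) ih).
pose A n : set plane := @sqn R @^-1` `]d n, 1%R[.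
have mA n : measurable (A n) by exact: measurable_sqn_itv.
have sA n : pdisc `&` A n = A n.
  apply/setIidPr => w; rewrite /A /pdisc /preimage /= !in_itv/= => /andP[h1 h2].
  by rewrite h2 andbT (lt_trans (d0 n)).
have mf := measurable_int _ iF.
have mfA n : measurable_fun pdisc ((EFin \o F) \_ (A n)).
  by apply/(measurable_restrict _ (mA n) md); exact: measurable_funS mf.
have cA : {ae area, forall w, pdisc w ->
    ((EFin \o F) \_ (A n)) w @[n --> \oo] --> (EFin \o F) w}.
  apply: aeW => w /pdiscP[w0 w1]; apply: cvg_near_cst.
  have : \forall n \near \oo, e n < sqn w.
    by have /cvgr_lt := ce; apply.
  apply: filterS => n nw; rewrite patchE mem_set//.
  by rewrite /A /preimage /= in_itv/= w1 andbT; exact: le_lt_trans nw.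
have bA : {ae area, forall w n, pdisc w ->
    (`|((EFin \o F) \_ (A n)) w| <= (abse \o (EFin \o F)) w)%E}.
  apply: aeW => w n _; rewrite patchE; case: ifPn => // _.
  by rewrite -[point]/(0 : \bar R) abse0; exact: abse_ge0.
have [_ _] := dominated_convergence md mfA mf cA (integrable_abse iF) bA.
under eq_fun do rewrite -integral_mkcondr sA repro_annulus//.
move=> H1.
have H2 : (complex.Re (h z) - d n `^ (- s) * complex.Re (h (z * (d n)%:C)))%:E
    @[n --> \oo] --> (complex.Re (h z))%:E.
  apply: cvg_EFin; first by apply: nearW.
  rewrite /comp /= -[X in _ --> X]subr0; apply: cvgB; first exact: cvg_cst.
  have [c [r [c0 r0 Hc]]] := holomorphic_linear_at0 hh h0.
  have H : c * e n @[n --> \oo] --> 0.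
    by rewrite -(mulr0 c); apply: cvgM => //; exact: cvg_cst.
  apply: (@squeeze_cvgr _ _ _ _ (fun n => - (c * e n)) (fun n => c * e n)) => //;
    last by rewrite -oppr0; exact: cvgN.
  have : \forall n \near \oo, e n < r by have /cvgr_lt := ce; apply.
  apply: filterS => n nr; rewrite -ler_norml normrM ger0_norm ?powR_ge0//.
  have zd : cmod (z * (d n)%:C) <= d n.
    rewrite cmodM cmodR ger0_norm ?(ltW (d0 n))//.
    by rewrite -[leRHS]mul1r ler_wpM2r// ltW.
  have hd : cmod (h (z * (d n)%:C)) <= c * d n.
    apply: le_trans (Hc _ _) _; last by rewrite ler_wpM2l.
    by apply: le_lt_trans zd _; exact: le_lt_trans nr.
  apply: (@le_trans _ _ (d n `^ (- s) * (c * d n))).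
    by rewrite ler_wpM2l ?powR_ge0//; apply: le_trans hd; exact: ler_Re_cmod.
  rewrite mulrCA -[X in _ * (_ * X)](powRr1 (ltW (d0 n))) -powRD_gt0//.
  by rewrite [- s + 1]addrC ds.
exact: (cvg_unique _ H1 H2).
Qed.

(** The imaginary part is the real part for -i h. *)
Lemma repro h z : holomorphic_on unit_disc h -> sqint s (fun w => h (pt w)) ->
  cmod z < 1 -> wint s (fun w => bker z (pt w) * h (pt w)) = h z.
Proof.
move=> hh ih z1; apply: complex_eq; rewrite /wint /= /Rintegral.
  by rewrite repro_Re.
have hi := holomorphicZ (k := - 'i%C) hh.
have E u : complex.Re (- 'i%C * u) = complex.Im u :> R by case: u => a b; simpc.
have := repro_Re hi (sqintZ (- 'i%C) ih) z1.
rewrite E => /(congr1 fine) /= <-; congr fine; apply: eq_integral => w _.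
by rewrite mulrCA E.
Qed.

End Repro.

(** * The Bergman space and its projection *)

Section Bergman.
Variable R : realType.
Local Notation C := R[i].
Local Notation mR := (measurableTypeR R).
Local Notation plane := (mR * mR)%type.
Local Notation kap := (disc_area R).
Local Notation pt := (@plane_pt R).
Local Notation pdisc := (@pdisc R).
Variable s : R.
Hypotheses (s_gt : 2^-1 < s) (s_lt : s < 1).
Local Notation pw := (plane_weight s).
Local Notation mw := (disc_weight s).
Local Notation bker := (bergman_kernel s).
Implicit Types f g h : C -> C.

Let md := @measurable_pdisc R.

Lemma pnorm2 f : pnorm s 2 f = sqnorm s (fun w => f (pt w)).
Proof. by apply: eq_integral => w _; rewrite powR_mulrn ?cmod_ge0. Qed.

Lemma L2_sqint f : Lp_space unit_disc mw 2 f -> sqint s (fun w => f (pt w)).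
Proof.
move=> /(Lp_spaceP s_gt f (ltr0n R 2))[cf]; rewrite pnorm2 => nf.
by split => //; exact: cmeasP.
Qed.

Lemma bergmanP f : bergman_space unit_disc mw f <->
  [/\ holomorphic_on unit_disc f, complex_measurable unit_disc f &
      sqint s (fun w => f (pt w))].
Proof.
split=> [[hf lf]|[hf cf [_ nf]]].
  by split => //; [by case: lf|exact: L2_sqint].
by split => //; apply/(Lp_spaceP s_gt f (ltr0n R 2)); rewrite pnorm2.
Qed.

Lemma holomorphicM f g : holomorphic_on unit_disc f -> holomorphic_on unit_disc g ->
  holomorphic_on unit_disc (fun w => f w * g w).
Proof.
by move=> hf hg z z1; exact: (@derivableM C C^o f g z 1 (hf z z1) (hg z z1)).
Qed.

Lemma holomorphicB f g : holomorphic_on unit_disc f -> holomorphic_on unit_disc g ->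
  holomorphic_on unit_disc (fun w => f w - g w).
Proof.
by move=> hf hg z z1; exact: (@derivableB C C^o C^o f g z 1 (hf z z1) (hg z z1)).
Qed.

Lemma holomorphic_id : holomorphic_on unit_disc (fun w : C => w).
Proof. by move=> z _; exact: derivable_id. Qed.

Lemma holomorphicX n : holomorphic_on unit_disc (fun w : C => w ^+ n).
Proof.
elim: n => [|n IH].
  by move=> z _; rewrite (_ : (fun w : C => w ^+ 0) = cst 1)//; exact: derivable_cst.
have := holomorphicM holomorphic_id IH.
by rewrite (_ : (fun w : C => w * w ^+ n) = (fun w => w ^+ n.+1))//; apply/funext => w; rewrite exprS.
Qed.

Lemma bergman_kernel_bergman z : cmod z < 1 ->
  bergman_space unit_disc mw (fun w => conjc (bker z w)).
Proof.
move=> z1; apply/bergmanP; split.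
- have -> : (fun w => conjc (bker z w)) = (fun w => kap^-1%:C *
      (conjc z * (w * ((1 - conjc z * w)^-1 * (1 - conjc z * w)^-1)) -
       s%:C * (conjc z * (w * (1 - conjc z * w)^-1)))).
    apply/funext => w; 
    rewrite [LHS]rmorphM /= oppr0 kernJ rmorphM /= conjcK /kern expr2 -invfM !mulrA; congr (_ * _).
  have c1 : cmod (conjc z) <= 1 by rewrite cmodJ ltW.
  have hi := holomorphic_one_sub_inv c1.
  apply: holomorphicZ; apply: holomorphicB; apply: holomorphicZ.
    by apply: holomorphicM; [exact: holomorphic_id|exact: holomorphicM].
  by apply: holomorphicZ; apply: holomorphicM; [exact: holomorphic_id|].
- have [] := cmeasJ (cmeas_bergman_kernel s z (@measurable_plane_disc R)).
  by split.
- exact: sqintJ (bergman_kernel_sqint s_gt s_lt z1).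
Qed.

(** The reproducing formula expresses [g z] as an integral of [g] against the kernel; the conjugate
    kernel lies in the Bergman space, so orthogonality lets [f] replace [g]. In particular two
    projections of [f] agree on the disc. *)
Lemma projection_eq f g z : Lp_space unit_disc mw 2 f ->
  is_bergman_projection unit_disc mw f g -> cmod z < 1 ->
  g z = wint s (fun w => bker z (pt w) * f (pt w)).
Proof.
move=> lf [bg /(_ _ (bergman_kernel_bergman _)) ort] z1.
have := ort _ z1; rewrite (L2_innerE s_gt) => H.
have [hg _ ig] := (bergmanP g).1 bg; have ik := bergman_kernel_sqint s_gt s_lt z1.
rewrite -(repro s_gt s_lt hg ig z1); apply/eqP; rewrite eq_sym -subr_eq0 -wintB; last 2 first.
  by apply: sqintM => //; exact: L2_sqint.
  exact: sqintM.
rewrite -H; apply/eqP/eq_wint => w _.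
by rewrite conjcK -mulrBr mulrC.
Qed.

(** An inequality covers both cases of the choice operator: a genuine projection gives equality, and
    the default 0 satisfies every bound. *)
Lemma cmod_projection_le f z : Lp_space unit_disc mw 2 f -> cmod z < 1 ->
  cmod (bergman_projection unit_disc mw f z) <=
  cmod (wint s (fun w => bker z (pt w) * f (pt w))).
Proof.
move=> lf z1; rewrite /bergman_projection; case: xgetP => [g _ Pg|_].
  by rewrite (projection_eq lf Pg z1).
by rewrite cmod0 cmod_ge0.
Qed.

Lemma projectionE f g z : Lp_space unit_disc mw 2 f ->
  is_bergman_projection unit_disc mw f g -> cmod z < 1 ->
  bergman_projection unit_disc mw f z = g z.
Proof.
move=> lf Pg z1.
have Q : is_bergman_projection unit_disc mw f (bergman_projection unit_disc mw f).
  exact: (xgetI (P := [set g | is_bergman_projection unit_disc mw f g]) (fun=> 0) Pg).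
by rewrite (projection_eq lf Pg z1) (projection_eq lf Q z1).
Qed.

Lemma pt_sqint : sqint s pt.
Proof.
apply: (sqint_lin s_lt (c := 1)); first exact: cmeas_pt.
by move=> w _; rewrite mul1r.
Qed.

(** For [|z| <= r] the kernel is at most [a * |w|], and w is square-integrable, so Cauchy-Schwarz
    applies to the reproducing formula. [N] is the norm of w; adding 1 makes the constant visibly
    positive. *)
Lemma bergman_bound (r : R) : r < 1 -> exists2 c : R, 0 < c &
  forall h, holomorphic_on unit_disc h -> sqint s (fun w => h (pt w)) ->
  forall z, cmod z <= r ->
  ((cmod (h z))%:E <= c%:E * sqnorm s (fun w => h (pt w)) `^ 2^-1)%E.
Proof.
move=> r1.
have [m0 n0] := pt_sqint.
pose N := fine (sqnorm s pt `^ 2^-1)%E.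
have NE : (sqnorm s pt `^ 2^-1 = N%:E)%E.
  by rewrite fineK// ge0_fin_numE ?poweR_ge0// poweR_lty.
have N0 : 0 <= N by rewrite fine_ge0// poweR_ge0.
pose a := kap^-1 / (1 - r) ^+ 2.
have a0 : 0 < a by rewrite divr_gt0 ?invr_gt0 ?disc_area_gt0// exprn_gt0// subr_gt0.
exists (2 * a * N + 1) => [|h hh ih z zr].
  by rewrite ltr_wpDl// mulr_ge0// mulr_ge0// ltW.
have z1 := le_lt_trans zr r1.
have ik := bergman_kernel_sqint s_gt s_lt z1.
have ci := sqintM ik ih.
have [mh nh] := ih.
rewrite -(repro s_gt s_lt hh ih z1).
apply: le_trans (wint_le ci) _.
have cs := cauchy_schwarz s m0 mh; rewrite NE in cs.
have H0 : (0 <= sqnorm s (fun w => h (pt w)) `^ 2^-1)%E by exact: poweR_ge0.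
apply: (@le_trans _ _ (2%:E * (a%:E * (N%:E * sqnorm s (fun w => h (pt w)) `^ 2^-1)))%E).
  rewrite lee_wpmul2l ?lee_fin//.
  apply: le_trans (lee_wpmul2l _ cs); last by rewrite lee_fin ltW.
  have mF : measurable_fun pdisc (fun w => (cmod (pt w * h (pt w)) * pw w)%:E).
    apply/measurable_EFinP; apply: measurable_funM; last exact: measurable_plane_weight.
    by apply: measurable_cmod; exact: cmeasM.
  rewrite -ge0_integralZl//; last 2 first.
    by move=> w _; rewrite lee_fin mulr_ge0 ?cmod_ge0 ?plane_weight_ge0.
    by rewrite lee_fin ltW.
  apply: ge0_le_integral => //.
  - by move=> w _; rewrite lee_fin mulr_ge0 ?cmod_ge0 ?plane_weight_ge0.
  - have [mc _] := ci; apply/measurable_EFinP.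
    by apply: measurable_funM; [exact: measurable_cmod|exact: measurable_plane_weight].
  - by apply: emeasurable_funM.
  - move=> w Dw; rewrite -EFinM lee_fin mulrA ler_wpM2r ?plane_weight_ge0//.
    rewrite (cmodM (bker z (pt w))) (cmodM (pt w)) mulrA.
    rewrite ler_wpM2r ?cmod_ge0//.
    apply: le_trans (bergman_kernel_lin s_gt s_lt z1 (pdisc_unit Dw)) _.
    rewrite ler_wpM2r ?cmod_ge0// ler_wpM2l ?invr_ge0 ?(ltW (disc_area_gt0 R))//.
    rewrite lef_pV2 ?posrE ?exprn_gt0 ?subr_gt0//.
    by rewrite ler_pXn2r ?nnegrE ?subr_ge0 ?(ltW r1) ?(ltW z1)// lerB.
rewrite !muleA -!EFinM lee_wpmul2r// lee_fin; lra.
Qed.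

Lemma cmod_continuous : continuous (@cmod R : C^o -> R).
Proof.
move=> z A /nbhs_ballP[e e0 eA]; apply: (nbhs_C (P := @cmod R @^-1` A)).
exists e => // w wz; apply: eA; rewrite /ball /=.
apply: le_lt_trans wz; rewrite ler_norml.
have := cmod_distD z w; have := cmod_distD w z; rewrite (cmod_distC z w); lra.
Qed.

Lemma disc_weight_admissible : admissible unit_disc mw.
Proof.
move=> K cK KD.
have [r r1 Kr] : exists2 r : R, r < 1 & forall z, K z -> cmod z <= r.
  have [/eqP K0|/set0P K0] := boolP (K == set0).
    by exists 0 => // z; rewrite K0.
  have [z zK zM] := compact_EVT_max K0 cK (continuous_subspaceT cmod_continuous).
  exists (cmod z); first by apply: KD; exact: set_mem zK.
  by move=> w Kw; apply: zM; rewrite inE.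
have [c c0 H] := bergman_bound r1.
exists c => // f bf z Kz; have [hf _ nf] := (bergmanP f).1 bf.
by rewrite (Lp_normE s_gt) pnorm2; apply: H => //; exact: Kr.
Qed.

Lemma sum_closed (A : Type) n (F : 'I_n -> A -> C) (P : (A -> C) -> Prop) :
  P (fun=> 0) -> (forall u v : A -> C, P u -> P v -> P (fun x => u x + v x)) ->
  (forall i, P (F i)) -> P (fun x => \sum_(i < n) F i x).
Proof.
move=> P0 PD; elim: n F => [|n IH] F PF.
  by rewrite (_ : (fun x => _) = fun=> 0)//; apply/funext => x; rewrite big_ord0.
rewrite (_ : (fun x => _) =
    (fun x => \sum_(i < n) F (widen_ord (leqnSn n) i) x + F ord_max x)).
  by apply: PD; [exact: IH|].
by apply/funext => x; rewrite big_ord_recr.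
Qed.

(** The monomials start at degree 1, as nonzero constants are not square-integrable. A combination
    of norm 0 vanishes on the disc by [bergman_bound], so it is a polynomial with too many roots. *)
Lemma disc_weight_infinite_dim : bergman_infinite_dim unit_disc mw.
Proof.
move=> n.
have bsum (c : 'I_n -> C) : bergman_space unit_disc mw (fun z => \sum_(i < n) c i * z ^+ i.+1).
  have mD (D : set plane) : measurable D -> cmeas D (fun w => \sum_(i < n) c i * pt w ^+ i.+1).
    move=> mD; apply: (@sum_closed _ _ (fun i w => c i * pt w ^+ i.+1) (fun u => cmeas D u)).
    - exact: cmeas_cst.
    - by move=> f g; exact: cmeasD.
    - move=> i; apply: cmeasM; first exact: cmeas_cst.
      elim: (i.+1) => [|k IH].
        by rewrite (_ : (fun w => _) = fun=> 1)//; exact: cmeas_cst.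
      have := cmeasM (cmeas_pt mD) IH; apply: eq_cmeas => w _.
      by rewrite exprS.
  apply/bergmanP; split.
  - apply: (@sum_closed _ _ (fun i w => c i * w ^+ i.+1)).
    + by move=> z _; exact: derivable_cst.
    + by move=> f g hf hg z z1; exact: (@derivableD C C^o C^o f g z 1 (hf z z1) (hg z z1)).
    + by move=> i; apply: holomorphicZ; exact: holomorphicX.
  - by split; have [] := mD _ (@measurable_plane_disc R).
  - apply: (sqint_lin s_lt (c := \sum_(i < n) cmod (c i))).
      by apply: mD; exact: measurable_pdisc.
    move=> w Dw; rewrite mulr_suml.
    apply: (big_ind2 (fun (a : C) b => cmod a <= b)) => [|a b a' b' h1 h2|i _].
    + by rewrite cmod0.
    + by apply: le_trans (cmodD _ _) _; exact: lerD.
    + rewrite cmodM cmodX ler_wpM2l ?cmod_ge0// exprS ler_piMr ?cmod_ge0//.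
      by rewrite exprn_ile1 ?cmod_ge0// ltW// pdisc_unit.
exists (fun i z => z ^+ i.+1); split.
  move=> i; have := bsum (fun j => (j == i)%:R).
  rewrite (_ : (fun z => _) = (fun z : C => z ^+ i.+1))//; apply/funext => z.
  rewrite (bigD1 i)//= eqxx mul1r big1 ?addr0// => j /negPf ->; by rewrite mul0r.
move=> c; set h := (fun z => _) => N0 i.
have hz z : cmod z < 1 -> h z = 0.
  move=> z1; have [k k0 H] := bergman_bound z1.
  have [hf _ nf] := (bergmanP h).1 (bsum c).
  have := H _ hf nf z (lexx _); rewrite -pnorm2 -(Lp_normE s_gt) N0 mule0 lee_fin.
  by move=> h0; apply/eqP; rewrite -cmod_eq0 eq_le h0 cmod_ge0.
pose P : {poly C} := \sum_(i < n) c i *: 'X^(i.+1).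
have P0 : P = 0.
  apply/eqP/negPn/negP => /max_poly_roots mr.
  (* These are n + 1 distinct points 1 / (k + 2) of the disc, while the degree of [P] is at most
     n. *)
  pose rs : seq C := [seq k.+2%:R^-1 | k <- iota 0 n.+1].
  have u : uniq rs.
    rewrite map_inj_uniq ?iota_uniq// => a b /(can_inj (@invrK _)) /eqP.
    by rewrite eqr_nat => /eqP[].
  have ar : all (root P) rs.
    apply/allP => _ /mapP[k _ ->]; rewrite /root /P horner_sum.
    rewrite -[X in _ == X](hz k.+2%:R^-1).
      by apply/eqP/eq_bigr => j _; rewrite hornerZ hornerXn.
    have -> : k.+2%:R^-1 = (k.+2%:R^-1)%:C :> C by rewrite fmorphV rmorph_nat.
    by rewrite cmodR ger0_norm ?invr_ge0// invf_lt1 ?ltr0n// ltr1n.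
  have := mr _ ar u; rewrite size_map size_iota.
  rewrite ltnNge => /negP; apply.
  apply: leq_trans (size_sum _ _ _) _; apply/bigmax_leqP => j _.
  by apply: leq_trans (size_scale_leq _ _) _; rewrite size_polyXn ltnS.
have := congr1 (fun p : {poly C} => p`_i.+1) P0.
rewrite /P coef_sum coef0 (bigD1 i)//= coefZ coefXn eqxx mulr1 big1 ?addr0// => j ji.
by rewrite coefZ coefXn eqSS (inj_eq (@ord_inj n)) eq_sym (negPf ji) mulr0.
Qed.

End Bergman.

(** * Schur's test and boundedness *)

Section Schur.
Context d (T : measurableType d) (R : realType)
  (mu : {sigma_finite_measure set T -> \bar R}).
Variable D : set T.
Hypothesis mD : measurable D.

(** Extension by 0 off [D * D] turns iterated integrals over [D] into integrals over the whole
    space, to which Tonelli's theorem applies. *)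
Let tonelli_patch (G : T * T -> R) x :
  (\int[mu]_y ((EFin \o G) \_ (D `*` D)) (x, y) =
   ((fun x => \int[mu]_(y in D) (G (x, y))%:E) \_ D) x)%E.
Proof.
rewrite [RHS]patchE; case: ifPn => Dx; last first.
  by apply: integral0_eq => y _; rewrite patchE in_setX (negPf Dx).
by rewrite [RHS]integral_mkcond; apply: eq_integral => y _; rewrite !patchE in_setX Dx.
Qed.

Lemma measurable_tonelli_on (G : T * T -> R) : measurable_fun (D `*` D) G ->
  (forall z, 0 <= G z) ->
  measurable_fun D (fun x => \int[mu]_(y in D) (G (x, y))%:E)%E.
Proof.
move=> mG G0; apply/(measurable_restrictT _ mD).
have <- : (fun x => \int[mu]_y ((EFin \o G) \_ (D `*` D)) (x, y))%E =
    (fun x => \int[mu]_(y in D) (G (x, y))%:E)%E \_ D.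
  by apply/funext => x; exact: tonelli_patch.
apply: measurable_fun_fubini_tonelli_F.
  by apply/(measurable_restrictT _ (measurableX mD mD)); exact/measurable_EFinP.
by move=> z; rewrite patchE; case: ifP => // _; rewrite /= lee_fin.
Qed.

Lemma tonelli_on (G : T * T -> R) : measurable_fun (D `*` D) G ->
  (forall z, 0 <= G z) ->
  (\int[mu]_(x in D) \int[mu]_(y in D) (G (x, y))%:E =
   \int[mu]_(y in D) \int[mu]_(x in D) (G (x, y))%:E)%E.
Proof.
move=> mG G0; pose F := (EFin \o G) \_ (D `*` D).
have mF : measurable_fun setT F.
  by apply/(measurable_restrictT _ (measurableX mD mD)); exact/measurable_EFinP.
have F0 z : (0 <= F z)%E by rewrite /F patchE; case: ifP => // _; rewrite /= lee_fin.
have := fubini_tonelli (m1 := mu) (m2 := mu) F mF F0.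
rewrite (eq_integral _ _ (fun x _ => tonelli_patch G x)) -integral_mkcond => ->.
rewrite [RHS]integral_mkcond; apply: eq_integral => y _.
rewrite [RHS]patchE; case: ifPn => Dy; last first.
  by apply: integral0_eq => x _; rewrite /F patchE in_setX (negPf Dy) andbF.
by rewrite [RHS]integral_mkcond; apply: eq_integral => x _;
  rewrite /F !patchE in_setX Dy andbT.
Qed.

Lemma measurable_on_fst (f : T -> R) : measurable_fun D f ->
  measurable_fun (D `*` D) (fun z : T * T => f z.1).
Proof.
move=> mf; apply: (measurable_comp mD _ mf).
  by move=> _ [[x y] [Dx _] <-].
by apply: measurable_funTS; exact: measurable_fst.
Qed.

Lemma measurable_on_snd (f : T -> R) : measurable_fun D f ->
  measurable_fun (D `*` D) (fun z : T * T => f z.2).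
Proof.
move=> mf; apply: (measurable_comp mD _ mf).
  by move=> _ [[x y] [_ Dy] <-].
by apply: measurable_funTS; exact: measurable_snd.
Qed.

Lemma powR_inv_cancel (x r : R) : 0 <= x -> r != 0 -> (x `^ r^-1) `^ r = x.
Proof. by move=> x0 r0; rewrite -powRrM mulVf// powRr1. Qed.

(** Write K u as K^(1/p) (u / psi) times K^(1/q) psi and apply Hoelder. The first kernel bound
    controls the second factor and contributes C1^(p/q) after raising to the power p; Tonelli and
    the second bound then integrate psi^p and return psi^p (u / psi)^p = u^p. *)
Lemma schur_test (K : T * T -> R) (W psi u g : T -> R) (p q C1 C2 : R) :
  0 < p -> 0 < q -> p^-1 + q^-1 = 1 -> 0 <= C1 -> 0 <= C2 ->
  measurable_fun (D `*` D) K -> (forall z, 0 <= K z) ->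
  measurable_fun D W -> (forall x, 0 <= W x) ->
  measurable_fun D psi -> (forall x, D x -> 0 < psi x) ->
  measurable_fun D u -> (forall x, 0 <= u x) ->
  measurable_fun D g -> (forall x, 0 <= g x) ->
  (forall z, D z ->
    (\int[mu]_(w in D) (K (z, w) * psi w `^ q * W w)%:E <= (C1 * psi z `^ q)%:E)%E) ->
  (forall w, D w ->
    (\int[mu]_(z in D) (K (z, w) * psi z `^ p * W z)%:E <= (C2 * psi w `^ p)%:E)%E) ->
  (forall z, D z -> ((g z)%:E <= \int[mu]_(w in D) (K (z, w) * u w * W w)%:E)%E) ->
  (\int[mu]_(z in D) (g z `^ p * W z)%:E <=
   (C1 `^ (p / q) * C2)%:E * \int[mu]_(w in D) (u w `^ p * W w)%:E)%E.
Proof.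
move=> p0 q0 pq C10 C20 mK K0 mW W0 mpsi psi0 mu' u0 mg g0 H1 H2 Hg.
have ps0 x : D x -> 0 <= psi x by move=> /psi0/ltW.
have pn0 : p != 0 by rewrite gt_eqF.
have qn0 : q != 0 by rewrite gt_eqF.
have mpow (r : R) (E : set (T * T)) (f : T * T -> R) : measurable_fun E f ->
    measurable_fun E (fun x => f x `^ r).
  by move=> mf; apply: (measurableT_comp (measurable_powR r)).
have mpow1 (r : R) (f : T -> R) : measurable_fun D f ->
    measurable_fun D (fun x => f x `^ r).
  by move=> mf; apply: (measurableT_comp (measurable_powR r)).
have mpsiV : measurable_fun D (fun x => (psi x)^-1).
  apply: eq_measurable_fun (mpow1 (- 1) _ mpsi) => x; rewrite inE => Dx.
  by rewrite powR_inv1// ps0.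
have mKz z : D z -> measurable_fun D (fun w => K (z, w)).
  move=> Dz; apply: (measurable_comp (measurableX mD mD) _ mK).
    by move=> _ [w Dw <-].
  by apply: measurable_funTS; exact: measurable_pair1.
pose v w := u w / psi w.
have mv : measurable_fun D v by exact: measurable_funM.
pose B z := (\int[mu]_(w in D) (K (z, w) * v w `^ p * W w)%:E)%E.
have B0 z : (0 <= B z)%E.
  by apply: integral_ge0 => w _; rewrite lee_fin !mulr_ge0 ?powR_ge0.
have hb z : D z -> ((g z)%:E <= B z `^ p^-1 * (C1 `^ q^-1 * psi z)%:E)%E.
  move=> Dz; apply: le_trans (Hg z Dz) _.
  have KW0 w : 0 <= K (z, w) * W w by rewrite mulr_ge0.
  have mKW : measurable_fun D (fun w => K (z, w) * W w).
    by apply: measurable_funM => //; exact: mKz.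
  have v0 w : D w -> 0 <= v w by move=> Dw; rewrite divr_ge0// ps0.
  have := @ge0_hoelder _ _ _ mu D (fun w => (K (z, w) * W w) `^ p^-1 * v w)
    (fun w => (K (z, w) * W w) `^ q^-1 * psi w) p q mD
    (measurable_funM (mpow1 _ _ mKW) mv) (measurable_funM (mpow1 _ _ mKW) mpsi).
  move=> /(_ _ _ p0 q0 pq).
  have E1 : (\int[mu]_(w in D) (((K (z, w) * W w) `^ p^-1 * v w) `^ p)%:E = B z)%E.
    apply: eq_integral => w; rewrite inE => Dw.
    by rewrite powRM ?powR_ge0 ?v0// powR_inv_cancel// mulrAC.
  have E2 : (\int[mu]_(w in D) (((K (z, w) * W w) `^ q^-1 * psi w) `^ q)%:E =
      \int[mu]_(w in D) (K (z, w) * psi w `^ q * W w)%:E)%E.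
    apply: eq_integral => w; rewrite inE => Dw.
    by rewrite powRM ?powR_ge0 ?ps0// powR_inv_cancel// mulrAC.
  have E3 : (\int[mu]_(w in D) (((K (z, w) * W w) `^ p^-1 * v w) *
      ((K (z, w) * W w) `^ q^-1 * psi w))%:E =
      \int[mu]_(w in D) (K (z, w) * u w * W w)%:E)%E.
    apply: eq_integral => w; rewrite inE => Dw.
    rewrite mulrACA -powRD; last by rewrite pq oner_eq0.
    by rewrite pq powRr1// /v divfK ?gt_eqF ?psi0// mulrAC.
  rewrite E1 E2 E3; move=> H; apply: le_trans (H _ _) _.
  - by move=> w Dw; rewrite mulr_ge0 ?powR_ge0 ?v0.
  - by move=> w Dw; rewrite mulr_ge0 ?powR_ge0// ps0.
  apply: lee_wpmul2l; first exact: poweR_ge0.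
  apply: (@le_trans _ _ ((C1 * psi z `^ q)%:E `^ q^-1)%E).
    apply: gt0_ler_poweR; rewrite ?invr_ge0 ?(ltW q0)// ?in_itv/= ?leey ?andbT.
    - by apply: integral_ge0 => w _; rewrite lee_fin !mulr_ge0 ?powR_ge0.
    - by rewrite lee_fin mulr_ge0 ?powR_ge0.
    - exact: H1.
  rewrite poweR_EFin lee_fin powRM ?powR_ge0// -powRrM mulfV// powRr1// ps0//.
have hp z : D z -> ((g z `^ p * W z)%:E <=
    (C1 `^ (p / q))%:E * ((psi z `^ p * W z)%:E * B z))%E.
  move=> Dz; have := hb z Dz => h.
  have : ((g z)%:E `^ p <= (B z `^ p^-1 * (C1 `^ q^-1 * psi z)%:E) `^ p)%E.
    apply: gt0_ler_poweR; rewrite ?(ltW p0)// ?in_itv/= ?leey ?andbT ?lee_fin//.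
    by rewrite mule_ge0 ?poweR_ge0// lee_fin mulr_ge0 ?powR_ge0// ps0.
  rewrite poweRM ?poweR_ge0//; last by rewrite lee_fin mulr_ge0 ?powR_ge0// ps0.
  rewrite -poweRrM mulVf// poweRe1// !poweR_EFin powRM ?powR_ge0 ?ps0//.
  rewrite -powRrM [q^-1 * p]mulrC => h'.
  rewrite EFinM; apply: le_trans (lee_wpmul2r _ h') _; first by rewrite lee_fin.
  by rewrite -muleA -EFinM muleC [leRHS]muleA -EFinM mulrA.
have mG : measurable_fun (D `*` D)
    (fun x : T * T => (psi x.1 `^ p * W x.1) * (K x * v x.2 `^ p * W x.2)).
  apply: measurable_funM.
    by apply: measurable_funM; [apply: mpow|]; exact: measurable_on_fst.
  apply: measurable_funM; last exact: measurable_on_snd.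
  by apply: measurable_funM => //; apply: mpow; exact: measurable_on_snd.
have G0 x : 0 <= (psi x.1 `^ p * W x.1) * (K x * v x.2 `^ p * W x.2).
  by rewrite !mulr_ge0 ?powR_ge0.
have EB z : D z -> ((psi z `^ p * W z)%:E * B z =
    \int[mu]_(w in D) ((psi z `^ p * W z) * (K (z, w) * v w `^ p * W w))%:E)%E.
  move=> Dz; rewrite /B -ge0_integralZl//.
  - apply/measurable_EFinP; apply: measurable_funM => //.
    by apply: measurable_funM; [exact: mKz|exact: mpow1].
  - by move=> w _; rewrite lee_fin !mulr_ge0 ?powR_ge0.
  - by rewrite lee_fin mulr_ge0 ?powR_ge0.
have mB : measurable_fun D (fun z => (psi z `^ p * W z)%:E * B z)%E.
  have := measurable_tonelli_on mG G0; apply: eq_measurable_fun => z.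
  by rewrite inE => Dz; rewrite EB.
apply: (@le_trans _ _ (\int[mu]_(z in D) ((C1 `^ (p / q))%:E *
    ((psi z `^ p * W z)%:E * B z)))%E).
  apply: ge0_le_integral => //.
  - by move=> z _; rewrite lee_fin mulr_ge0 ?powR_ge0.
  - by apply/measurable_EFinP; apply: measurable_funM => //; exact: mpow1.
  - exact: measurable_funeM.
rewrite ge0_integralZl//; last 2 first.
- by move=> z _; rewrite mule_ge0// lee_fin mulr_ge0 ?powR_ge0.
- by rewrite lee_fin powR_ge0.
rewrite EFinM -muleA lee_wpmul2l ?lee_fin ?powR_ge0//.
rewrite (eq_integral _ _ (fun z Dz => EB z (set_mem Dz))).
rewrite (tonelli_on mG G0).
apply: (@le_trans _ _ (\int[mu]_(w in D) (C2%:E * (u w `^ p * W w)%:E))%E).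
  apply: ge0_le_integral => //.
  - by move=> w _; apply: integral_ge0 => z _; rewrite lee_fin; exact: (G0 (z, w)).
  - have mG' : measurable_fun (D `*` D) (fun x : T * T =>
        (psi x.2 `^ p * W x.2) * (K (x.2, x.1) * v x.1 `^ p * W x.1)).
      apply: (measurable_comp (measurableX mD mD) _ mG (g := fun x => (x.2, x.1))).
        by move=> _ [[x y] [Dx Dy] <-].
      by apply: measurable_funTS; exact: measurable_swap.
    exact: (measurable_tonelli_on mG' (fun x => G0 (x.2, x.1))).
  - by apply: measurable_funeM; apply/measurable_EFinP; apply: measurable_funM => //; exact: mpow1.
  move=> w Dw.
  have E : (\int[mu]_(z in D) ((psi z `^ p * W z) * (K (z, w) * v w `^ p * W w))%:E =
      (v w `^ p * W w)%:E * \int[mu]_(z in D) (K (z, w) * psi z `^ p * W z)%:E)%E.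
    rewrite -ge0_integralZl//.
    + by apply: eq_integral => z _; rewrite -EFinM; congr (_%:E); ring.
    + apply/measurable_EFinP; apply: measurable_funM => //.
      apply: measurable_funM; last exact: mpow1.
      apply: (measurable_comp (measurableX mD mD) _ mK (g := fun z => (z, w))).
        by move=> _ [z Dz <-].
      by apply: measurable_funTS; exact: measurable_pair2.
    + by move=> z _; rewrite lee_fin !mulr_ge0 ?powR_ge0.
    + by rewrite lee_fin mulr_ge0 ?powR_ge0.
  rewrite E; apply: le_trans (lee_wpmul2l _ (H2 w Dw)) _.
    by rewrite lee_fin mulr_ge0 ?powR_ge0.
  rewrite -!EFinM lee_fin mulrCA ler_wpM2l// mulrAC ler_wpM2r//.
  by rewrite -powRM ?divr_ge0 ?ps0// /v divfK// gt_eqF ?psi0.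
rewrite ge0_integralZl//.
- by apply/measurable_EFinP; apply: measurable_funM => //; exact: mpow1.
- by move=> w _; rewrite lee_fin mulr_ge0 ?powR_ge0.
Qed.

End Schur.

(** * Boundedness between the endpoints *)

Section Bounded.
Variable R : realType.
Local Notation C := R[i].
Local Notation mR := (measurableTypeR R).
Local Notation plane := (mR * mR)%type.
Local Notation leb := (@lebesgue_measure R).
Local Notation area := (leb \x leb)%E.
Local Notation kap := (disc_area R).
Local Notation pt := (@plane_pt R).
Local Notation pdisc := (@pdisc R).
Variable s : R.
Hypotheses (s_gt : 2^-1 < s) (s_lt : s < 1).
Local Notation pw := (plane_weight s).
Local Notation mw := (disc_weight s).
Local Notation bker := (bergman_kernel s).
Implicit Types f g h : C -> C.

Let md := @measurable_pdisc R.

(* The factor 2 is lost in [wint_le], which bounds real and imaginary parts separately. *)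
Definition sker (z w : C) : R :=
  2 / kap * (cmod z * cmod w / cmod (1 - z * conjc w) ^+ 2).

Lemma sker_ge0 z w : 0 <= sker z w.
Proof.
rewrite /sker mulr_ge0 ?divr_ge0 ?(ltW (disc_area_gt0 R)) ?mulr_ge0 ?cmod_ge0//.
Qed.

Lemma skerC z w : sker z w = sker w z.
Proof.
rewrite /sker [cmod z * _]mulrC; congr (_ * (_ / _ ^+ 2)).
by rewrite -cmodJ rmorphB rmorphM rmorph1 /= conjcK mulrC.
Qed.

(** The squared modulus splits into a conjugate pair, so [cauchy_avg] applies with h(v) = 1 / (1 -
    conj(z) v). *)
Lemma average_sqr_kernel z w : cmod z < 1 -> cmod w < 1 ->
  cavg (fun x => ((cmod (1 - z * conjc (w * cexp x)) ^+ 2)^-1)%:C : C) =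
  ((1 - cmod z ^+ 2 * cmod w ^+ 2)^-1)%:C :> C.
Proof.
move=> z1 w1.
have zw : cmod z * cmod w < 1 by have := cmod_ge0 z; have := cmod_ge0 w; nra.
have E (a : C) : ((cmod a ^+ 2)^-1)%:C = (conjc a)^-1 / a :> C.
  by rewrite -invfM mulrC cmod_conjM fmorphV.
have c1 : cmod (conjc z) <= 1 by rewrite cmodJ ltW.
have -> : ((1 - cmod z ^+ 2 * cmod w ^+ 2)^-1)%:C =
    (1 - conjc z * (z * (cmod w ^+ 2)%:C))^-1 :> C.
  by rewrite mulrA [conjc z * z]mulrC cmod_conjM -rmorphM fmorphV rmorphB rmorph1.
rewrite -(cauchy_avg (holomorphic_one_sub_inv c1) w1 zw).
apply: eq_cavg => x; rewrite E; congr (_^-1 / _).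
by rewrite rmorphB rmorphM rmorph1 /= conjcK.
Qed.

Let kap0 := disc_area_gt0 R.

Lemma measurable_sker : measurable_fun setT (fun x : plane * plane => sker (pt x.1) (pt x.2)).
Proof.
have m1 : cmeas setT (fun x : plane * plane => pt x.1).
  by have [mr mj] := cmeas_pt (R := R) measurableT; split;
    [apply: (measurableT_comp mr)|apply: (measurableT_comp mj)]; exact: measurable_fst.
have m2 : cmeas setT (fun x : plane * plane => pt x.2).
  by have [mr mj] := cmeas_pt (R := R) measurableT; split;
    [apply: (measurableT_comp mr)|apply: (measurableT_comp mj)]; exact: measurable_snd.
apply: measurable_funM => //; apply: measurable_funM.
  by apply: measurable_funM; exact: measurable_cmod.
apply: measurable_inv; last by move=> x; rewrite exprn_ge0 ?cmod_ge0.
apply: measurable_sqr_cmod; apply: cmeasB; first exact: cmeas_cst.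
by apply: cmeasM => //; exact: cmeasJ.
Qed.

Lemma measurable_sker_r z : measurable_fun setT (fun w : plane => sker z (pt w)).
Proof.
case: z => a b; have := measurableT_comp measurable_sker (@measurable_pair1 _ _ plane plane (a, b)).
exact.
Qed.

(** After averaging over circles, the factor |w|, the power [sg / 2] and the weight combine to t^e
    with e = (sg - 1) / 2 - s. The lower bound on [sg] says exactly that e > -1. The upper bound
    lets the factor [|z|] of the kernel be replaced by [|z|^sg]. *)
Lemma disc_kernel_le (sg b : R) z : 2 * s - 1 < sg -> sg <= 1 -> 0 < b -> b < 1 ->
  cmod z < 1 ->
  (\int[area]_(w in pdisc)
    (sker z (pt w) * (sqn w `^ (sg / 2) * (1 - sqn w) `^ (- b)) * pw w)%:E <=
   (2 * (4 / ((sg - 1) / 2 - s + 1) + 2 * (b^-1 + (1 - b)^-1)) *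
     ((cmod z ^+ 2) `^ (sg / 2) * (1 - cmod z ^+ 2) `^ (- b)))%:E)%E.
Proof.
move=> sg1 sg2 b0 b1 z1; set e := (sg - 1) / 2 - s.
set c := 4 / (e + 1) + 2 * (b^-1 + (1 - b)^-1).
have e1 : - 1 < e by rewrite /e; lra.
set x := cmod z ^+ 2.
have x0 : 0 <= x by rewrite sqr_ge0.
have x1 : x < 1 by rewrite expr_lt1 ?cmod_ge0.
have xt t : 0 < t < 1 -> 0 < 1 - x * t.
  by move=> /andP[t0 t1]; have := x0; have := x1; nra.
pose D : set mR := `]0%R, 1%R[%classic.
have mD : measurable D by exact: measurable_itv.
have D0 : D `<=` `]0, +oo[ by move=> t; rewrite /D /= !in_itv/= => /andP[->].
pose psi t : R := t `^ e * (1 - t) `^ (- b) / (1 - x * t).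
have psi0 t : D t -> 0 <= psi t.
  rewrite /D /= in_itv/= => ht.
  by rewrite /psi !mulr_ge0 ?powR_ge0// invr_ge0 ltW// xt.
have mpsi : measurable_fun D psi.
  apply: measurable_funM.
    by apply: measurable_funM; [exact: measurable_powR_on|exact: measurable_powR_sub].
  have : measurable_fun D (fun t : R => (1 - x * t) `^ (- 1)).
    apply: measurable_funTS.
    apply: (measurableT_comp (f := fun t : R => t `^ (- 1))); first exact: measurable_powR.
    by apply: measurable_funB => //; exact: measurable_funM.
  apply: eq_measurable_fun => t; rewrite inE /D /= in_itv/= => ht.
  by rewrite powR_inv1//; exact/ltW/xt.
pose rad t : R := (t `^ (sg / 2) * (1 - t) `^ (- b)) * t `^ (- (1 + s)).
have mrad : measurable_fun pdisc (fun w => rad (sqn w)).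
  apply/measurable_EFinP; apply: (measurable_comp_sqn (Psi := fun t => (rad t)%:E) mD).
  apply/measurable_EFinP; rewrite /rad.
  apply: measurable_funM; last exact: measurable_powR_on.
  by apply: measurable_funM; [exact: measurable_powR_on|exact: measurable_powR_sub].
pose Psi t := 2 / kap * (cmod z * psi t).
have P0 t : D t -> 0 <= Psi t.
  move=> Dt; rewrite /Psi mulr_ge0 ?divr_ge0 ?(ltW kap0)//.
  by rewrite mulr_ge0 ?cmod_ge0 ?psi0.
have mP : measurable_fun D Psi by do 2 apply: measurable_funM => //.
rewrite (polar_ge0 (Psi := Psi) mD D0) //; last 3 first.
- have mS : measurable_fun pdisc (fun w => sker z (pt w)).
    by apply: measurable_funTS; exact: measurable_sker_r.
  have : measurable_fun pdisc (fun w =>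
      sker z (pt w) * (sqn w `^ (sg / 2) * (1 - sqn w) `^ (- b)) * pw w); last exact.
  by apply: eq_measurable_fun (measurable_funM mS mrad) => w _ /=; rewrite /rad mulrA.
- by move=> w _; rewrite mulr_ge0 ?plane_weight_ge0// mulr_ge0 ?sker_ge0// mulr_ge0 ?powR_ge0.
- move=> w; rewrite /D /= in_itv/= => hw; have /andP[w0 w1] := hw.
  have cw1 : cmod (pt w) < 1 by rewrite cmod_pt_lt1.
  have zw : cmod z * cmod (pt w) < 1 by have := cmod_ge0 z; have := cmod_ge0 (pt w); nra.
  pose g y := ((cmod (1 - z * conjc (pt w * cexp y)) ^+ 2)^-1)%:C : C.
  have cg : cctn g.
    move=> y; have k1 := ccont_kernel y zw; have := ccontM k1 (ccontJ k1).
    apply: eq_ccont => t; rewrite cmod_conjM cmodV exprVn.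
    by [].
  have E y : (sker z (pt (plane_rot y w)) *
      (sqn (plane_rot y w) `^ (sg / 2) * (1 - sqn (plane_rot y w)) `^ (- b)) *
      pw (plane_rot y w))%:E =
      ((2 / kap * (cmod z * cmod (pt w)) * rad (sqn w))%:E * (complex.Re (g y))%:E)%E.
    rewrite -EFinM; congr (_%:E).
    rewrite /plane_weight sqn_rot pt_rot /sker cmod_cexpM /rad /g.
    move: ((cmod (1 - _) ^+ 2)^-1) => k /=; ring.
  under eq_integral do rewrite E.
  rewrite integralZl//; last first.
    by have [] := @ccont_integrable _ (- pi) pi g (fun y _ => cg y).
  rewrite (integral_Re_cavg cg) /g average_sqr_kernel// -EFinM; congr (_%:E).
  rewrite cmod_pt /Psi /psi /rad -/x.
  have -> : sqn w `^ e = cmod (pt w) * (sqn w `^ (sg / 2) * sqn w `^ (- (1 + s))).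
    have -> : cmod (pt w) = sqn w `^ 2^-1.
      by rewrite powR12_sqrt ?ltW// -cmod_pt sqrtr_sqr ger0_norm ?cmod_ge0.
    by rewrite -!powRD_gt0//; congr (_ `^ _); rewrite /e; field.
  move: (sqn w `^ (sg/2)) (sqn w `^ _) (_ `^ _) (cmod (pt w)) => a1 a2 a3 a4 /=.
  move: ((1 - _)^-1) => a5; ring.
rewrite /Psi.
rewrite (_ : (\int[leb]_(t in D) (2 / kap * (cmod z * psi t))%:E =
    (2 / kap * cmod z)%:E * \int[leb]_(t in D) (psi t)%:E)%E); last first.
  rewrite -ge0_integralZl//.
  - by apply: eq_integral => t _; rewrite -EFinM mulrA.
  - by apply/measurable_EFinP.
  - by rewrite lee_fin mulr_ge0 ?divr_ge0 ?(ltW kap0) ?cmod_ge0.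
have K := integral_kernel_le e1 b0 b1 x0 x1.
apply: (@le_trans _ _ (kap%:E * ((2 / kap * cmod z)%:E * (c * (1 - x) `^ (- b))%:E))%E).
  rewrite lee_wpmul2l ?lee_fin ?(ltW kap0)// lee_wpmul2l// lee_fin.
  by rewrite mulr_ge0 ?divr_ge0 ?(ltW kap0) ?cmod_ge0.
rewrite -!EFinM lee_fin.
have c0 : 0 <= c.
  by rewrite /c addr_ge0 ?mulr_ge0 ?addr_ge0 ?invr_ge0// ?subr_ge0 ltW//; lra.
have -> : kap * (2 / kap * cmod z * (c * (1 - x) `^ (- b))) =
    2 * c * (cmod z * (1 - x) `^ (- b)) by field; rewrite gt_eqF.
rewrite ler_wpM2l ?mulr_ge0// ler_wpM2r ?powR_ge0//.
have [->|z0] := eqVneq z 0; first by rewrite cmod0 powR_ge0.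
have xp : 0 < x by rewrite exprn_gt0// cmod_gt0.
have -> : cmod z = x `^ 2^-1.
  by rewrite powR12_sqrt ?ltW// sqrtr_sqr ger0_norm ?cmod_ge0.
by apply: powR_anti => //; [exact: ltW|lra].
Qed.

Lemma cmeas_projection f : cmeas pdisc (fun w => bergman_projection unit_disc mw f (pt w)).
Proof.
rewrite /bergman_projection; case: xgetP => [g _ [bg _]|_]; last exact: cmeas_cst.
by have [_ cg _] := (bergmanP s_gt g).1 bg; exact: cmeasP.
Qed.

(** Taking the powers q and p of [psi] turns the exponent 1 / (p q) at the boundary into 1 / p and 1
    / q, both in (0, 1), so [disc_kernel_le] gives the two bounds that Schur's test asks for. *)
Lemma bergman_bounded_range (p q : R) : 0 < p -> 0 < q -> p^-1 + q^-1 = 1 ->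
  2 * s < p -> 2 * s < q -> bergman_bounded unit_disc mw p.
Proof.
move=> p0 q0 pq sp sq.
have pV : 0 < p^-1 by rewrite invr_gt0.
have qV : 0 < q^-1 by rewrite invr_gt0.
pose m := Num.min p^-1 q^-1.
pose psi (w : plane) := sqn w `^ (m / 2) * (1 - sqn w) `^ (- (p * q)^-1).
have psiE r w : pdisc w -> psi w `^ r = sqn w `^ (m * r / 2) * (1 - sqn w) `^ (- (r / (p * q))).
  move=> _; rewrite powRM ?powR_ge0// -!powRrM; congr (_ `^ _ * _ `^ _); ring.
have pn : p != 0 by rewrite gt_eqF.
have qn : q != 0 by rewrite gt_eqF.
have pqE : p * q = p + q by move: pq => /(congr1 (fun x => p * q * x)); rewrite mulr1 => <-; field; rewrite pn qn.
have qpE : q / (p * q) = p^-1 by field; rewrite pn qn.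
have ppE : p / (p * q) = q^-1 by field; rewrite pn qn.
(* For conjugate exponents r' / r = r' - 1, so m r' is either r' - 1 or 1. The minimum keeps it at
   most 1, and r' > 2 s puts it above 2 s - 1: these are the conditions on [sg] in
   [disc_kernel_le]. *)
have mP r r' : 0 < r -> 0 < r' -> r * r' = r + r' -> m = Num.min r^-1 r'^-1 ->
    2 * s < r' -> 2 * s - 1 < m * r' <= 1.
  move=> r0 r'0 rr -> h'.
  have rE : r^-1 * r' = r' - 1.
    apply: (mulfI (lt0r_neq0 r0)); rewrite mulVKf ?gt_eqF// mulrBr mulr1 rr; ring.
  have s1 := s_lt; case: (leP r^-1 r'^-1) => h.
    rewrite rE; apply/andP; split; first by lra.
    by rewrite -rE -(mulVf (lt0r_neq0 r'0)) ler_wpM2r// ltW.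
  by rewrite mulVf ?gt_eqF//; apply/andP; split => //; lra.
have /andP[mq1 mq2] : 2 * s - 1 < m * q <= 1 by apply: (mP p q).
have /andP[mp1 mp2] : 2 * s - 1 < m * p <= 1.
  by apply: (mP q p) => //; [rewrite mulrC pqE addrC|rewrite /m minC].
have p1 : p^-1 < 1 by lra.
have q1 : q^-1 < 1 by lra.
pose c (sg b : R) := 2 * (4 / ((sg - 1) / 2 - s + 1) + 2 * (b^-1 + (1 - b)^-1)).
have c0 sg b : 2 * s - 1 < sg -> 0 < b -> b < 1 -> 0 <= c sg b.
  move=> h1 h2 h3; rewrite /c mulr_ge0// addr_ge0 ?mulr_ge0 ?addr_ge0 ?invr_ge0//;
    first lra; lra.
pose c1 := c (m * q) p^-1; pose c2 := c (m * p) q^-1.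
have c10 : 0 <= c1 by exact: c0.
have c20 : 0 <= c2 by exact: c0.
have H1 z : pdisc z -> (\int[area]_(w in pdisc)
    (sker (pt z) (pt w) * psi w `^ q * pw w)%:E <= (c1 * psi z `^ q)%:E)%E.
  move=> Dz; have := disc_kernel_le mq1 mq2 pV p1 (pdisc_unit Dz).
  rewrite cmod_pt psiE// qpE; apply: le_trans.
  rewrite le_eqVlt; apply/orP; left; apply/eqP/eq_integral => w; rewrite inE => Dw.
  by rewrite psiE// qpE.
have H2 w : pdisc w -> (\int[area]_(z in pdisc)
    (sker (pt z) (pt w) * psi z `^ p * pw z)%:E <= (c2 * psi w `^ p)%:E)%E.
  move=> Dw; have := disc_kernel_le mp1 mp2 qV q1 (pdisc_unit Dw).
  rewrite cmod_pt psiE// ppE; apply: le_trans.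
  rewrite le_eqVlt; apply/orP; left; apply/eqP/eq_integral => z; rewrite inE => Dz.
  by rewrite psiE// ppE skerC.
have psi0 w : pdisc w -> 0 < psi w.
  by move=> /pdiscP[w0 w1]; rewrite mulr_gt0 ?powR_gt0 ?subr_gt0.
have mpsi : measurable_fun pdisc psi.
  have m2 : measurable_fun (`]0%R, 1%R[ : set mR)
      (fun t : R => t `^ (m / 2) * (1 - t) `^ (- (p * q)^-1)).
    by apply: measurable_funM; [exact: measurable_powR_on|exact: measurable_powR_sub].
  apply/measurable_EFinP; apply: (measurable_comp_sqn (Psi := fun t : R =>
    (t `^ (m / 2) * (1 - t) `^ (- (p * q)^-1))%:E) (measurable_itv _)).
  exact/measurable_EFinP.
pose A := c1 `^ (p / q) * c2.
have A0 : 0 <= A by rewrite mulr_ge0 ?powR_ge0.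
exists (A `^ p^-1 + 1); first by rewrite ltr_wpDl ?powR_ge0.
move=> f l2 /(Lp_spaceP s_gt f p0)[cf nf].
have mu' : measurable_fun pdisc (fun w => cmod (f (pt w))).
  by apply: measurable_cmod; exact: cmeasP.
have mg : measurable_fun pdisc (fun w => cmod (bergman_projection unit_disc mw f (pt w))).
  by apply: measurable_cmod; exact: cmeas_projection.
have hg z : pdisc z -> ((cmod (bergman_projection unit_disc mw f (pt z)))%:E <=
    \int[area]_(w in pdisc) (sker (pt z) (pt w) * cmod (f (pt w)) * pw w)%:E)%E.
  move=> Dz; have z1 := pdisc_unit Dz.
  apply: (@le_trans _ _ ((cmod (wint s (fun w => bker (pt z) (pt w) * f (pt w))))%:E)).
    by rewrite lee_fin; exact: cmod_projection_le.
  have ci := sqintM (bergman_kernel_sqint s_gt s_lt z1) (L2_sqint s_gt l2).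
  apply: le_trans (wint_le ci) _; have [mc _] := ci.
  have mci : measurable_fun pdisc (fun w => (cmod (bker (pt z) (pt w) * f (pt w)) * pw w)%:E).
    apply/measurable_EFinP; apply: measurable_funM; last exact: measurable_plane_weight.
    exact: measurable_cmod.
  rewrite -ge0_integralZl//; last first.
    by move=> w _; rewrite lee_fin mulr_ge0 ?cmod_ge0 ?plane_weight_ge0.
  apply: ge0_le_integral => //.
  - by move=> w _; rewrite -EFinM lee_fin !mulr_ge0 ?cmod_ge0 ?plane_weight_ge0.
  - exact: measurable_funeM.
  - apply/measurable_EFinP; apply: measurable_funM; last exact: measurable_plane_weight.
    apply: measurable_funM => //.
    by apply: measurable_funTS; exact: measurable_sker_r.
  - move=> w Dw; rewrite -EFinM lee_fin mulrA ler_wpM2r ?plane_weight_ge0//.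
    rewrite (cmodM (bker (pt z) (pt w))) mulrA ler_wpM2r ?cmod_ge0//.
    rewrite /sker -mulrA ler_wpM2l//.
    exact: (bergman_kernel_le s_gt s_lt z1 (pdisc_unit Dw)).
have mK : measurable_fun (pdisc `*` pdisc) (fun x : plane * plane => sker (pt x.1) (pt x.2)).
  by apply: measurable_funTS; exact: measurable_sker.
have H : (pnorm s p (bergman_projection unit_disc mw f) <= A%:E * pnorm s p f)%E.
  apply: (@schur_test _ _ _ (@plane_measure R) pdisc md
    (fun x => sker (pt x.1) (pt x.2)) pw psi (fun w => cmod (f (pt w)))
    (fun w => cmod (bergman_projection unit_disc mw f (pt w))) p q c1 c2) => //.
  - by move=> x; exact: sker_ge0.
  - exact: measurable_plane_weight.
  - exact: plane_weight_ge0.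
  - by move=> x; exact: cmod_ge0.
  - by move=> x; exact: cmod_ge0.
rewrite !(Lp_normE s_gt).
apply: (@le_trans _ _ ((A%:E * pnorm s p f) `^ p^-1)%E).
  apply: gt0_ler_poweR; rewrite ?(ltW pV)// ?in_itv/= ?leey ?andbT ?pnorm_ge0//.
  by rewrite mule_ge0 ?pnorm_ge0 ?lee_fin.
rewrite poweRM ?pnorm_ge0 ?lee_fin// lee_wpmul2r ?poweR_ge0//.
by rewrite poweR_EFin lee_fin lerDl.
Qed.

End Bounded.

(** * Radial test functions and unboundedness *)

Section Unbounded.
Variable R : realType.
Local Notation C := R[i].
Local Notation mR := (measurableTypeR R).
Local Notation plane := (mR * mR)%type.
Local Notation leb := (@lebesgue_measure R).
Local Notation kap := (disc_area R).
Local Notation pt := (@plane_pt R).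
Local Notation pdisc := (@pdisc R).
Local Notation D1 := (`]0%R, 1%R[%classic : set mR).
Variable s : R.
Hypotheses (s_gt : 2^-1 < s) (s_lt : s < 1).
Local Notation pw := (plane_weight s).
Local Notation mw := (disc_weight s).
Local Notation bker := (bergman_kernel s).
Implicit Types f g h : C -> C.
Local Notation radf phi := (fun w : C => (w * (phi (cmod w ^+ 2))%:C)%R).

Let md := @measurable_pdisc R.
Let mD1 : measurable D1. Proof. exact: measurable_itv. Qed.
Let kap0 := disc_area_gt0 R.
Let D10 : D1 `<=` `]0, +oo[.
Proof. by move=> t /=; rewrite !in_itv/= => /andP[->]. Qed.

Lemma integrable_powR (b : R) : - 1 < b ->
  leb.-integrable D1 (fun t : R => (t `^ b)%:E).
Proof.
move=> b1; apply/integrableP; split.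
  by apply/measurable_EFinP; exact: measurable_powR_on.
apply: le_lt_trans (ltry ((b + 1)^-1)); apply: le_trans (integral_powR_le b1).
rewrite le_eqVlt; apply/orP; left; apply/eqP/eq_integral => t _.
by rewrite gee0_abs// lee_fin powR_ge0.
Qed.

(** Up to the factor [kap], the inner product of w phi(|w|^2) with w; for phi = 1 it is the squared
    norm of w. *)
Definition mass (phi : R -> R) : R := Rintegral leb D1 (fun t => phi t * t `^ (- s)).

Lemma integrable_mass (phi : R -> R) (c : R) : measurable_fun setT phi ->
  (forall t, D1 t -> 0 <= phi t <= c) ->
  leb.-integrable D1 (fun t => (phi t * t `^ (- s))%:E).
Proof.
move=> mphi hphi.
have ic : leb.-integrable D1 (fun t : R => (c * t `^ (- s))%:E).
  have : leb.-integrable D1 (fun t : R => (t `^ (- s))%:E).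
    by apply: integrable_powR; have := s_lt; lra.
  by move=> /(integrableZl mD1 c); apply: eq_integrable.
apply: (le_integrable mD1 _ _ ic) => //.
  apply/measurable_EFinP; apply: measurable_funM; last exact: measurable_powR_on.
  exact: measurable_funTS.
move=> t Dt; have /andP[h0 h1] := hphi _ Dt.
rewrite /= lee_fin !normrM (ger0_norm (powR_ge0 _ _)) ler_wpM2r ?powR_ge0//.
by rewrite !ger0_norm// (le_trans h0).
Qed.

Lemma integral_powR_itv_gt0 (k u v : R) : 0 < k + 1 -> 0 < u -> u < v ->
  (0 < \int[leb]_(t in `[u, v]) (t `^ k)%:E)%E.
Proof.
move=> k1 u0 uv; rewrite integral_powR_itv ?gt_eqF ?ltW// lte_fin.
rewrite mulr_gt0 ?invr_gt0// subr_gt0; apply: gt0_ltr_powR => //;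
  by rewrite nnegrE ltW// (lt_trans u0).
Qed.

Lemma integral_powR_gt0 (k : R) : 0 < k + 1 -> (0 < \int[leb]_(t in D1) (t `^ k)%:E)%E.
Proof.
move=> k1.
have h1 : (0 : R) < 4^-1 by rewrite invr_gt0.
have h2 : (4^-1 : R) < 2^-1 by lra.
apply: lt_le_trans (integral_powR_itv_gt0 k1 h1 h2) _.
apply: ge0_subset_integral => //.
- by apply/measurable_EFinP; exact: measurable_powR_on.
- by move=> t _; rewrite lee_fin powR_ge0.
- by move=> t; rewrite /= !in_itv/= => /andP[ut tv]; apply/andP; split; lra.
Qed.

Lemma mass1_gt0 : 0 < mass (fun=> 1).
Proof.
have i1 := @integrable_mass (fun=> 1) 1 (measurable_cst _) (fun t _ => introT andP (conj ler01 (lexx 1))).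
have f1 := integrable_fin_num mD1 i1.
rewrite -lte_fin /mass /Rintegral fineK//.
have s1 : 0 < - s + 1 by have := s_lt; lra.
have -> : (\int[leb]_(t in D1) (1 * t `^ (- s))%:E = \int[leb]_(t in D1) (t `^ (- s))%:E)%E.
  by apply: eq_integral => t _; rewrite mul1r.
exact: integral_powR_gt0.
Qed.

Lemma radial_sqint (phi : R -> R) (c : R) : measurable_fun setT phi ->
  (forall t, D1 t -> 0 <= phi t <= c) ->
  sqint s (fun w => pt w * (phi (cmod (pt w) ^+ 2))%:C).
Proof.
move=> mphi hphi; apply: (sqint_lin s_lt (c := c)).
  apply: cmeasM; first exact: cmeas_pt.
  apply: cmeas_real; apply: measurable_funTS.
  have := measurableT_comp mphi (@measurable_sqn R).
  by apply: eq_measurable_fun => w _; rewrite /= cmod_pt.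
move=> w Dw; rewrite cmodM cmodR cmod_pt mulrC ler_wpM2r ?cmod_ge0//.
by have /andP[h0 h1] := hphi _ Dw; rewrite ger0_norm.
Qed.

Lemma radial_L2 (phi : R -> R) (c : R) : measurable_fun setT phi ->
  (forall t, D1 t -> 0 <= phi t <= c) ->
  Lp_space unit_disc mw 2 (fun w => w * (phi (cmod w ^+ 2))%:C).
Proof.
move=> mphi hphi; apply/(Lp_spaceP s_gt _ (ltr0n R 2)); split; last first.
  by rewrite pnorm2; have [] := radial_sqint mphi hphi.
have [rm jm] : cmeas (plane_set (@unit_disc R))
    (fun w => pt w * (phi (cmod (pt w) ^+ 2))%:C).
  apply: cmeasM; first exact: (cmeas_pt (@measurable_plane_disc R)).
  apply: cmeas_real; apply: measurable_funTS.
  have := measurableT_comp mphi (@measurable_sqn R).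
  by apply: eq_measurable_fun => w _; rewrite /= cmod_pt.
by split.
Qed.

(** The conjugate of [cdavg_deriv] at z = 0: on each circle v is orthogonal to all Taylor terms of h
    except the linear one. *)
Lemma average_conj h w : holomorphic_on unit_disc h -> cmod w < 1 ->
  cavg (fun x => w * cexp x * conjc (h (w * cexp x))) =
  (cmod w ^+ 2)%:C * conjc (hderiv h 0).
Proof.
move=> hh w1.
have z1 : cmod (0 : C) * cmod w < 1 by rewrite cmod0 mul0r.
have := cdavg_deriv hh w1 z1; rewrite mul0r => E.
have : conjc (cdavg h 0 w) = (cmod w ^+ 2)%:C * conjc (hderiv h 0).
  by rewrite E rmorphM /= oppr0.
move=> <-; rewrite /cdavg -cavgJ; last first.
  move=> x; apply: ccontM; first exact: ccont_circle.
  exact: ccont_kernel2.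
apply: eq_cavg => x.
by rewrite mul0r subr0 expr1n divr1 rmorphM /= conjcK mulrC.
Qed.

Section RadialProjection.
Variables (phi : R -> R) (c : R).
Hypotheses (mphi : measurable_fun setT phi) (hphi : forall t, D1 t -> 0 <= phi t <= c).
Let a := mass phi / mass (fun=> 1).

Let F h (w : plane) : C :=
  (pt w * (phi (cmod (pt w) ^+ 2))%:C - a%:C * pt w) * conjc (h (pt w)).

Let F_integrable h : sqint s (fun w => h (pt w)) -> cintegrable s (F h).
Proof.
move=> ih; apply: sqintM; last exact: sqintJ.
apply: (sqint_lin s_lt (c := c + `|a|)).
  apply: cmeasB; first by have [] := radial_sqint mphi hphi.
  by apply: cmeasM; [exact: cmeas_cst|exact: cmeas_pt].
move=> w Dw; apply: le_trans (cmodB _ _) _; rewrite mulrDl; apply: lerD.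
  rewrite cmodM cmodR cmod_pt mulrC ler_wpM2r ?cmod_ge0//.
  by have /andP[h0 h1] := hphi Dw; rewrite ger0_norm.
by rewrite cmodM cmodR.
Qed.

Let Re_wint0 h : holomorphic_on unit_disc h -> sqint s (fun w => h (pt w)) ->
  complex.Re (wint s (F h)) = 0.
Proof.
move=> hh ih; rewrite /wint /= /Rintegral.
have [iF _] := cintegrable_ReIm (F_integrable ih).
pose l := complex.Re (hderiv h 0).
pose Psi t := l * (phi t * t `^ (- s) - a * (1 * t `^ (- s))).
have i1 := integrable_mass mphi hphi.
have i2 := @integrable_mass (fun=> 1) 1 (measurable_cst _) (fun t _ => introT andP (conj ler01 (lexx 1))).
have i3 : leb.-integrable D1 (fun t : R => (a * (1 * t `^ (- s)))%:E).
  by have := integrableZl mD1 a i2; apply: eq_integrable.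
have i4 : leb.-integrable D1 (fun t : R => (phi t * t `^ (- s) - a * (1 * t `^ (- s)))%:E).
  by have := integrableB mD1 i1 i3; apply: eq_integrable.
have iP : leb.-integrable D1 (EFin \o Psi).
  by have := integrableZl mD1 l i4; apply: eq_integrable.
rewrite (polar_int mD1 D10 iF iP).
  have -> : (\int[leb]_(t in D1) (Psi t)%:E = (l * (mass phi - a * mass (fun=> 1)))%:E)%E.
    have -> : (\int[leb]_(t in D1) (Psi t)%:E = (Rintegral leb D1 Psi)%:E)%E.
      by rewrite /Rintegral fineK//; exact: integrable_fin_num iP.
    congr (_%:E); rewrite /Psi RintegralZl//; congr (_ * _).
    by rewrite RintegralB// RintegralZl.
  rewrite /a divfK ?gt_eqF ?mass1_gt0//.
  by rewrite subrr mulr0 mule0.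
move=> w Dw; have [w0 w1] := pdiscP Dw.
have cw1 : cmod (pt w) < 1 by rewrite cmod_pt_lt1.
pose g x := pt w * cexp x * conjc (h (pt w * cexp x)).
have cg : cctn g.
  move=> x; apply: ccontM; first by apply: ccontM; [exact: ccont_cst|exact: ccont_cexp].
  by apply: ccontJ; exact: ccont_circle.
have E y : (complex.Re (F h (plane_rot y w)) * pw (plane_rot y w))%:E =
    (((phi (sqn w) - a) * sqn w `^ (- (1 + s)))%:E * (complex.Re (g y))%:E)%E.
  rewrite -EFinM /F cmod_pt pt_rot /plane_weight !sqn_rot; congr (_%:E).
  have -> : (pt w * cexp y * (phi (sqn w))%:C - a%:C * (pt w * cexp y)) *
      conjc (h (pt w * cexp y)) = g y * (phi (sqn w) - a)%:C.
    by rewrite /g rmorphB; ring.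
  by rewrite cReMr mulrC mulrA [in RHS]mulrC mulrC; ring.
under eq_integral do rewrite E.
rewrite integralZl//; last first.
  by have [] := @ccont_integrable _ (- pi) pi g (fun y _ => cg y).
rewrite (integral_Re_cavg cg) /g average_conj// -EFinM; congr (_%:E).
rewrite mulrC [X in complex.Re X]mulrC cReMr cReJ cmod_pt /Psi -/l.
have -> : sqn w `^ (- s) = sqn w * sqn w `^ (- (1 + s)).
  rewrite -[X in X * _](powRr1 (ltW w0)) -powRD_gt0//; congr (_ `^ _); ring.
by move: (sqn w `^ _) => k; ring.
Qed.

(** By [average_conj] every test function h enters the inner product only through its derivative at
    0, multiplied by [mass phi - a * mass 1]. The ratio [a] makes this vanish. *)
Lemma radial_projection : is_bergman_projection unit_disc mw
  (fun w => w * (phi (cmod w ^+ 2))%:C) (fun w => a%:C * w).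
Proof.
split.
  apply/(bergmanP s_gt); split.
  - by apply: holomorphicZ; exact: holomorphic_id.
  - have [rm jm] : cmeas (plane_set (@unit_disc R)) (fun w => a%:C * pt w).
      by apply: cmeasM; [exact: cmeas_cst|exact: (cmeas_pt (@measurable_plane_disc R))].
    by split.
  - apply: sqintZ; exact: pt_sqint.
move=> h /(bergmanP s_gt)[hh _ ih]; rewrite (L2_innerE s_gt).
apply: complex_eq; first exact: Re_wint0.
(* Testing against i h multiplies the inner product by -i, which exchanges imaginary and real
   part. *)
have hi := holomorphicZ (k := 'i%C) hh.
have := Re_wint0 hi (sqintZ 'i%C ih).
have E u : complex.Re (- 'i%C * u) = complex.Im u :> R by case: u => x y; simpc.
rewrite (_ : wint s _ = - 'i%C * wint s (F h)) ?E//.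
rewrite -wintZ; last exact: F_integrable.
apply: eq_wint => w _; rewrite /F rmorphM /= mulrCA; congr (_ * _).
by case: (h _) => x y; simpc.
Qed.

End RadialProjection.


Lemma pnorm_radial (phi : R -> R) (p : R) : measurable_fun setT phi ->
  (forall t, D1 t -> 0 <= phi t) ->
  (pnorm s p (radf phi) = kap%:E *
   \int[leb]_(t in D1) ((t `^ 2^-1 * phi t) `^ p * t `^ (- (1 + s)))%:E)%E.
Proof.
move=> mphi hphi.
have mP : measurable_fun D1
    (fun t : R => ((t `^ 2^-1 * phi t) `^ p * t `^ (- (1 + s)))%:E).
  apply/measurable_EFinP; apply: measurable_funM; last exact: measurable_powR_on.
  apply: (measurableT_comp (measurable_powR p)); apply: measurable_funM.
    exact: measurable_powR_on.
  exact: measurable_funTS.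
rewrite -(radial_ge0 mD1 D10 mP); last first.
  by move=> t _; rewrite lee_fin mulr_ge0 ?powR_ge0.
apply: eq_integral => w; rewrite inE => Dw; congr ((_ `^ _ * _)%:E).
have [w0 _] := pdiscP Dw.
rewrite cmodM cmodR cmod_pt ger0_norm; last exact: hphi.
by rewrite powR12_sqrt ?ltW// -cmod_pt sqrtr_sqr ger0_norm ?cmod_ge0.
Qed.

(** The cut-off makes the power bounded, so that the test functions lie in every L^p even for
    negative [k]. *)
Definition cutpow (k e t : R) : R := if e < t then t `^ k else 0.

Lemma cutpow_ge0 k e t : 0 <= cutpow k e t.
Proof. by rewrite /cutpow; case: ifP => // _; exact: powR_ge0. Qed.

Lemma measurable_cutpow k e : measurable_fun setT (cutpow k e).
Proof.
apply: (measurable_fun_ifT (g := fun t : R => t `^ k) (h := fun=> 0)).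
- by apply: measurable_fun_ltr.
- exact: measurable_powR.
- exact: measurable_cst.
Qed.

(** A negative power is bounded by its value at the cut, a nonnegative one by 1 = e^0. *)
Lemma cutpow_le k e t : 0 < e -> D1 t -> 0 <= cutpow k e t <= e `^ Num.min k 0.
Proof.
move=> e0; rewrite /= in_itv/= => /andP[t0 t1]; rewrite cutpow_ge0 /cutpow.
case: ifPn => [et|_]; last exact: powR_ge0.
apply: (@le_trans _ _ (t `^ Num.min k 0)).
  by apply: powR_anti => //; [exact: ltW|rewrite ge_min lexx].
have m0 : 0 <= - Num.min k 0 by rewrite oppr_ge0 ge_min lexx orbT.
rewrite -[Num.min k 0]opprK ![_ `^ (- - _)]powRN lef_pV2 ?posrE ?powR_gt0//.
by apply: ge0_ler_powR; rewrite ?nnegrE//; exact: ltW.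
Qed.

Lemma integrable_cutpow k e : 0 < e -> leb.-integrable D1 (fun t => (cutpow k e t)%:E).
Proof.
move=> e0.
have i0 : leb.-integrable D1 (fun t : R => (e `^ Num.min k 0 * t `^ 0)%:E).
  have : leb.-integrable D1 (fun t : R => (t `^ 0)%:E) by apply: integrable_powR; lra.
  by move=> /(integrableZl mD1 (e `^ Num.min k 0)); apply: eq_integrable.
apply: (le_integrable mD1 _ _ i0).
  by apply/measurable_EFinP; apply: measurable_funTS; exact: measurable_cutpow.
move=> t Dt; have /andP[h0 h1] := cutpow_le k e0 Dt.
by rewrite powRr0 mulr1 /= lee_fin !ger0_norm ?powR_ge0.
Qed.

Lemma integral_cutpow_ge k e u v : 0 < e -> e < u -> u <= v -> v < 1 ->
  (\int[leb]_(t in `[u, v]) (t `^ k)%:E <= \int[leb]_(t in D1) (cutpow k e t)%:E)%E.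
Proof.
move=> e0 eu uv v1.
rewrite (@eq_integral _ _ _ leb _ (fun t => (cutpow k e t)%:E) (fun t => (t `^ k)%:E)); last first.
  move=> t; rewrite inE /= in_itv/= => /andP[ut tv].
  by rewrite /cutpow (lt_le_trans eu ut).
apply: ge0_subset_integral => //.
- by apply/measurable_EFinP; apply: measurable_funTS; exact: measurable_cutpow.
- by move=> t _; rewrite lee_fin cutpow_ge0.
- move=> t; rewrite /= !in_itv/= => /andP[ut tv].
  by rewrite (lt_le_trans (lt_trans e0 eu) ut) (le_lt_trans tv v1).
Qed.

Lemma mass_cutpow k e : 0 < e ->
  ((mass (cutpow k e))%:E = \int[leb]_(t in D1) (cutpow (k - s) e t)%:E)%E.
Proof.
move=> e0; have i1 := integrable_mass (measurable_cutpow k e) (fun t => cutpow_le k e0 (t := t)).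
rewrite /mass /Rintegral fineK; last exact: integrable_fin_num i1.
apply: eq_integral => t; rewrite inE /= in_itv/= => /andP[t0 t1].
by rewrite /cutpow; case: ifP => _; rewrite ?mul0r// -powRD_gt0.
Qed.

Lemma pnorm_cutpow k e p : 0 < e -> 0 < p ->
  (pnorm s p (radf (cutpow k e)) =
   kap%:E * \int[leb]_(t in D1) (cutpow (p / 2 + k * p - (1 + s)) e t)%:E)%E.
Proof.
move=> e0 p0; rewrite pnorm_radial; [|exact: measurable_cutpow|by move=> t _; exact: cutpow_ge0].
congr (_ * _)%E; apply: eq_integral => t; rewrite inE /= in_itv/= => /andP[t0 t1].
rewrite /cutpow; case: ifP => _; last by rewrite mulr0 powR0 ?mul0r ?gt_eqF.
rewrite powRM ?powR_ge0// -!powRrM -!powRD_gt0//; congr ((_ `^ _)%:E); ring.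
Qed.

Lemma pnorm_linear (a p : R) : 0 <= a -> 0 < p ->
  (pnorm s p (fun w => (a%:C * w)%R) = (kap * a `^ p)%:E *
   \int[leb]_(t in D1) (t `^ (p / 2 - (1 + s)))%:E)%E.
Proof.
move=> a0 p0.
rewrite (_ : (fun w => a%:C * w) = radf (fun=> a)); last first.
  by apply/funext => w; rewrite mulrC.
rewrite pnorm_radial// EFinM -muleA; congr (_ * _)%E.
have mt : measurable_fun D1 (fun t : R => (t `^ (p / 2 - (1 + s)))%:E).
  by apply/measurable_EFinP; exact: measurable_powR_on.
rewrite -(ge0_integralZl leb mD1 mt); last 2 first.
- by move=> t _; rewrite lee_fin powR_ge0.
- by rewrite lee_fin powR_ge0.
apply: eq_integral => t; rewrite inE /= in_itv/= => /andP[t0 t1].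
rewrite -EFinM powRM ?powR_ge0// -powRrM mulrAC mulrC -powRD_gt0//.
by congr ((_ * _ `^ _)%:E); ring.
Qed.

Lemma bergman_bounded_pnorm p : 0 < p -> bergman_bounded unit_disc mw p ->
  exists2 M : R, 0 < M & forall f, Lp_space unit_disc mw 2 f ->
    Lp_space unit_disc mw p f ->
    (pnorm s p (bergman_projection unit_disc mw f) <= M%:E * pnorm s p f)%E.
Proof.
move=> p0 [M M0 H]; exists (M `^ p); first exact: powR_gt0.
move=> f l2 lp; have := H f l2 lp; rewrite !(Lp_normE s_gt) => h.
have X f' : ((pnorm s p f' `^ p^-1) `^ p = pnorm s p f')%E.
  by rewrite -poweRrM mulVf ?gt_eqF// poweRe1// pnorm_ge0.
rewrite -[leLHS]X -[X in (_ * X)%E]X -poweR_EFin -poweRM ?poweR_ge0 ?lee_fin ?(ltW M0)//.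
apply: gt0_ler_poweR; rewrite ?(ltW p0)// ?in_itv/= ?leey ?andbT ?poweR_ge0//.
by rewrite mule_ge0 ?poweR_ge0 ?lee_fin// ltW.
Qed.

Lemma pnorm_projection_cutpow k e p : 0 < e -> 0 < p ->
  (pnorm s p (bergman_projection unit_disc mw (radf (cutpow k e))) =
   pnorm s p (fun w => ((mass (cutpow k e) / mass (fun=> 1))%:C * w)%R))%E.
Proof.
move=> e0 p0; have hc := fun t => cutpow_le k e0 (t := t).
have mc := measurable_cutpow k e.
apply: eq_integral => w; rewrite inE => Dw.
by rewrite (projectionE s_gt s_lt (radial_L2 mc hc) (radial_projection mc hc) (pdisc_unit Dw)).
Qed.

Lemma cutpow_Lp k e p : 0 < e -> 0 < p ->
  Lp_space unit_disc mw p (radf (cutpow k e)).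
Proof.
move=> e0 p0; apply/(Lp_spaceP s_gt _ p0); split.
  have := radial_L2 (measurable_cutpow k e) (fun t => cutpow_le k e0 (t := t)).
  by move=> /(Lp_spaceP s_gt _ (ltr0n R 2))[].
rewrite pnorm_cutpow// lte_mul_pinfty ?lee_fin ?(ltW kap0)//.
by have /integrable_fin_num := integrable_cutpow (p / 2 + k * p - (1 + s)) e0;
  rewrite ltey_eq => ->.
Qed.

Lemma mass_cutpow_gt0 k e : 0 < e -> e < 1 -> 0 < k - s + 1 -> 0 < mass (cutpow k e).
Proof.
move=> e0 e1 k1; rewrite -lte_fin mass_cutpow//.
have h1 : e < (2 * e + 1) / 3 by lra.
have h2 : (2 * e + 1) / 3 < (e + 2) / 3 by lra.
have h3 : (e + 2) / 3 < 1 by lra.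
apply: lt_le_trans (integral_cutpow_ge (k - s) e0 h1 (ltW h2) h3).
by apply: integral_powR_itv_gt0 => //; lra.
Qed.

Lemma bergman_unbounded_low p : 0 < p -> p <= 2 * s -> ~ bergman_bounded unit_disc mw p.
Proof.
move=> p0 ps /(bergman_bounded_pnorm p0)[M M0 H].
(* The power 0 cut off at 1/2 is the indicator of t > 1/2; its mass is positive, so its projection
   is a nonzero multiple of w. *)
have e0 : (0 : R) < 2^-1 by lra.
have e1 : (2^-1 : R) < 1 by lra.
have := H _ (cutpow_Lp 0 e0 (ltr0n R 2)) (cutpow_Lp 0 e0 p0).
have a0 : 0 < mass (cutpow 0 2^-1) / mass (fun=> 1).
  by rewrite divr_gt0 ?mass1_gt0 ?mass_cutpow_gt0//; have := s_lt; lra.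
rewrite pnorm_projection_cutpow// pnorm_linear ?(ltW a0)//.
rewrite integral_powR_pinfty//; last by lra.
rewrite gt0_muley ?lte_fin ?mulr_gt0 ?powR_gt0//.
have [_ h] := (Lp_spaceP s_gt _ p0).1 (cutpow_Lp 0 e0 p0).
by rewrite leNgt lte_mul_pinfty ?lee_fin ?(ltW M0).
Qed.

(** The test function w |w|^(q-2) is the extremal one in Hoelder's inequality against w. Its inner
    product with w and the p-th power of its norm are multiples of the same integral J, divergent
    when q <= 2 s. With a cut-off, boundedness would bound J^p by a multiple of J, uniformly in the
    cut. *)
Lemma bergman_unbounded_high p q : 0 < p -> 0 < q -> p^-1 + q^-1 = 1 ->
  q <= 2 * s -> ~ bergman_bounded unit_disc mw p.
Proof.
move=> p0 q0 pq qs /(bergman_bounded_pnorm p0)[M M0 H].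
have s1 := s_lt; have s2 := s_gt.
have pn : p != 0 by rewrite gt_eqF.
have qn : q != 0 by rewrite gt_eqF.
have pqE : p * q = p + q.
  by move: pq => /(congr1 (fun x => p * q * x)); rewrite mulr1 => <-; field; rewrite pn qn.
have p1 : 1 < p.
  have : p^-1 < 1 by have : 0 < q^-1 by [rewrite invr_gt0]; lra.
  by rewrite invf_lt1.
(* Since q < 2. Hence p > 2 s, so w itself is in L^p and [T] below is finite. *)
have p2 : 2 <= p by nra.
pose k := (q - 2) / 2.
(* The common exponent of the mass and of the p-th power of the norm, as [kE] and [sE] check. *)
pose E := q / 2 - (1 + s).
have kE : p / 2 + k * p - (1 + s) = E.
  rewrite /k /E; have -> : (q - 2) / 2 * p = (p * q - 2 * p) / 2 by field.
  by rewrite pqE; field.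
have sE : k - s = E by rewrite /k /E; field.
have E1 : E <= - 1 by rewrite /E; lra.
pose N := mass (fun=> 1).
have N0 : 0 < N by exact: mass1_gt0.
have T1 : - 1 < p / 2 - (1 + s) by lra.
pose T := fine (\int[leb]_(t in D1) (t `^ (p / 2 - (1 + s)))%:E)%E.
have TE : (\int[leb]_(t in D1) (t `^ (p / 2 - (1 + s)))%:E = T%:E)%E.
  by rewrite /T fineK//; exact: integrable_fin_num (integrable_powR T1).
have T0 : 0 < T.
  rewrite -lte_fin -TE.
  by apply: integral_powR_gt0; lra.
pose Q := M * N `^ p / T.
have Q0 : 0 <= Q by rewrite divr_ge0 ?mulr_ge0 ?powR_ge0 ?ltW.
(* Boundedness reads (J / N)^p T <= M J, which bounds J^(p-1) by [Q], independently of [e]. *)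
have bound e : 0 < e -> mass (cutpow k e) <= Q `^ (p - 1)^-1.
  move=> e0; set J := mass (cutpow k e).
  have JE : J%:E = (\int[leb]_(t in D1) (cutpow E e t)%:E)%E.
    by rewrite -sE; exact: mass_cutpow.
  have J0 : 0 <= J.
    by rewrite -lee_fin JE; apply: integral_ge0 => t _; rewrite lee_fin cutpow_ge0.
  have [->|Jn] := eqVneq J 0; first exact: powR_ge0.
  have Jp : 0 < J by rewrite lt0r Jn.
  have := H _ (cutpow_Lp k e0 (ltr0n R 2)) (cutpow_Lp k e0 p0).
  rewrite pnorm_projection_cutpow// pnorm_linear ?divr_ge0 ?(ltW N0)// -/J -/N TE.
  rewrite pnorm_cutpow// kE -JE -!EFinM lee_fin => h.
  have {}h : J `^ (p - 1) <= Q.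
    have JJ : J `^ p = J * J `^ (p - 1).
      rewrite -[X in X * _](powRr1 J0) -powRD_gt0//; congr (_ `^ _); ring.
    move: h; rewrite powRM ?invr_ge0 ?(ltW N0)// JJ.
    have -> : N^-1 `^ p = (N `^ p)^-1 by rewrite -powR_inv1 ?ltW// -powRrM mulN1r powRN.
    have Np : 0 < N `^ p by exact: powR_gt0.
    rewrite /Q ler_pdivlMr// => h.
    have : kap * J * (J `^ (p - 1) * T / N `^ p) <= kap * J * M.
      apply: le_trans (le_trans _ h) _; rewrite le_eqVlt; apply/orP; left; apply/eqP; ring.
    by rewrite ler_pM2l ?mulr_gt0// ler_pdivrMr.
  have -> : J = (J `^ (p - 1)) `^ (p - 1)^-1.
    by rewrite -powRrM mulfV ?powRr1// gt_eqF// subr_gt0.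
  by apply: ge0_ler_powR; rewrite ?nnegrE ?powR_ge0// invr_ge0 subr_ge0 ltW.
(* On each compact subinterval t^E coincides with a cut-off power, so the uniform bound passes to
   the whole integral, which is infinite. *)
have : (\int[leb]_(t in `]0%R, 1%R[) (t `^ E)%:E <= (Q `^ (p - 1)^-1)%:E)%E.
  apply: integral_oo_le => //.
  - exact: measurable_powR_on.
  - by move=> t _; exact: powR_ge0.
  - move=> u v u0 uv v1.
    have e0 : 0 < u / 2 by lra.
    have eu : u / 2 < u by lra.
    apply: le_trans (integral_cutpow_ge E e0 eu uv v1) _.
    by rewrite -sE -mass_cutpow// lee_fin bound.
by rewrite integral_powR_pinfty.
Qed.

End Unbounded.

Theorem theorem1p3 (R : realType) (p0 q0 : R)
    (hp0 : 2 < p0) (hq0 : p0^-1 + q0^-1 = 1) :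
  exists mu0 : R[i] -> R,
    [/\ weight unit_disc mu0,
        admissible unit_disc mu0,
        bergman_infinite_dim unit_disc mu0 &
        forall p : R, 1 < p ->
          (bergman_bounded unit_disc mu0 p <-> q0 < p < p0)].
Proof.
have p0V : 0 < p0^-1 by rewrite invr_gt0; lra.
have p0V2 : p0^-1 < 2^-1 by rewrite ltf_pV2 ?posrE//; lra.
have q0V : 0 < q0^-1 by lra.
have q0_gt0 : 0 < q0 by rewrite -invr_gt0.
have q0_gt1 : 1 < q0 by rewrite -[q0]invrK invf_gt1//; lra.
have q0_lt2 : q0 < 2 by rewrite -[q0]invrK -[2]invrK ltf_pV2 ?posrE//; lra.
pose s := q0 / 2.
have s_gt : 2^-1 < s by rewrite /s; lra.
have s_lt : s < 1 by rewrite /s; lra.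
have q0E : 2 * s = q0 by rewrite /s; field.
exists (disc_weight s); split.
- exact: disc_weight_weight.
- exact: disc_weight_admissible.
- exact: disc_weight_infinite_dim.
move=> p p1.
have p_gt0 : 0 < p by lra.
have pV1 : p^-1 < 1 by rewrite invf_lt1.
pose q := (1 - p^-1)^-1.
have q_gt0 : 0 < q by rewrite invr_gt0; lra.
have pq : p^-1 + q^-1 = 1 by rewrite /q invrK; ring.
(* Conjugation reverses the order, so the upper condition on [p] becomes a lower one on [q], in the
   form that the bounds above use. *)
have ltq : (q0 < q) = (p < p0).
  rewrite -[LHS](ltf_pV2 (x := q)) ?posrE// -[RHS](ltf_pV2 (x := p0)) ?posrE//; last by lra.
  by rewrite /q invrK; apply/idP/idP; lra.
split=> [hb|/andP[qp pp]].
  apply/andP; split; rewrite ltNge; apply/negP => h.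
    by apply: (bergman_unbounded_low s_gt s_lt p_gt0 _ hb); rewrite q0E.
  apply: (bergman_unbounded_high s_gt s_lt p_gt0 q_gt0 pq _ hb).
  by rewrite q0E leNgt ltq ltNge h.
apply: (bergman_bounded_range s_gt s_lt p_gt0 q_gt0 pq); first by rewrite q0E.
by rewrite q0E ltq.
Qed.
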